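(* For every integer $r\geq 4$, the limit $\lim_{n\to\infty} n^{-2} f^{(r)}(n;6r-10,6)$ exists and equals $\frac{1}{r^2-r}$.
   Context: An $r$-graph is an $r$-uniform hypergraph. For positive integers $s,k$, an $(s,k)$-configuration is an $r$-graph with exactly $k$ edges and at most $s$ vertices; an $r$-graph is $(s,k)$-free if it contains no $(s,k)$-configuration as a subgraph. For integers $r,n,s,k$, $f^{(r)}(n;s,k)$ denotes the maximum number of edges in an $n$-vertex $r$-graph that is $(s,k)$-free. *)

(* Defs.v *)
From mathcomp Require Import all_boot.
From Stdlib Require Import Reals.

Set Implicit Arguments.
Unset Strict Implicit.
Unset Printing Implicit Defensive.

Definition uniform (n r : nat) (H : {set {set 'I_n}}) : bool :=
  [forall e in H, #|e| == r].

Definition has_config (n s k : nat) (H : {set {set 'I_n}}) : bool :=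
  [exists F : {set {set 'I_n}},
     [&& F \subset H, #|F| == k & #|\bigcup_(e in F) e| <= s]].

Definition sk_free (n s k : nat) (H : {set {set 'I_n}}) : bool :=
  ~~ has_config s k H.

Definition f_ex (r n s k : nat) : nat :=
  \max_(H : {set {set 'I_n}} | uniform r H && sk_free s k H) #|H|.

(* Main.v *)
(* Write [d = r - 2] and let [phi S] be the number of vertices spanned by an edge
   set [S] minus [d |S|]; this function is submodular, single edges have
   [phi = 2], and a forbidden configuration is a six-edge set with [phi <= 2].

   Upper bound.  Join two edges when they share at least two vertices.  By
   submodularity every component of this relation has at most five edges and
   [phi <= 2].  Components own the pairs of vertices they cover, and a component
   with two or more edges may moreover claim, fully or in halves, some of the
   uncovered pairs [{x, y}] with [x] in [e - f] and [y] in [f - e], where [e, f]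
   are two of its edges sharing two vertices.  Except for [O(n)] exceptional
   components, each one then owns on average [r(r-1)/2] pairs per edge, while no
   pair is owned more than once.

   Lower bound.  A weighted semi-random construction: besides the current edge
   set, keep weights on the edges that can still be added, such that the weights
   of the edges through any pair of vertices sum to at most one.  A random set is
   chosen with small multiples of these probabilities, the edges in conflict are
   dropped, and the weights of the surviving edges are boosted to compensate for
   the probability of survival.  Since every quantity to control enters linearly
   into one potential, only its expectation is needed to pick a good outcome; the
   single second moment estimate concerns the sums of weights through a pair. *)

Require Import Defs.
From Stdlib Require Import Reals.
From mathcomp Require Import all_boot all_order all_algebra.
From mathcomp Require Import zify ring lra.
From mathcomp Require Import Rstruct.

Set Implicit Arguments.
Unset Strict Implicit.
Unset Printing Implicit Defensive.
Import Order.TTheory GRing.Theory Num.Theory.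
Local Open Scope ring_scope.

(* Hypotheses about sets only slow [lia] down. *)
Ltac slia := repeat match goal with
  | H : forall _, _ |- _ => clear H
  | H : is_true (_ \in _) |- _ => clear H
  | H : is_true (_ \notin _) |- _ => clear H
  | H : is_true (_ \subset _) |- _ => clear H
  | H : is_true (_ != _ :> Equality.sort _) |- _ => clear H
  | H : ~ _ |- _ => clear H
  end; lia.

(** * Excess of edge sets and minimal obstructions *)

(** The threshold [phi <= 2] comes from [6r - 10 = 6d + 2]. The lower bound lives on two scales.
    Good sets weigh O(n^2), as much as the number of edges itself, so in one step their total may
    only grow by a factor close to 1. This is delicate, because edges with a common killer survive
    together more often than independent ones. The combinatorial lemmas show that a common killer
    outside the set enlarges it to a set with [phi <= 1]. Such sets weigh only O(n), and for them a
    bound that loses the constant [3 ^ 23] in every step is affordable, since the number of steps is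
    fixed before [n] grows. *)

Section Excess.

Variables (T E : finType) (v : E -> {set T}) (d : nat).
Implicit Types (A B C I S H : {set E}) (e f g : E).

Definition span (S : {set E}) : {set T} := \bigcup_(e in S) v e.

Definition phi (S : {set E}) : int := #|span S|%:Z - (d * #|S|)%:Z.

Lemma spanU (A B : {set E}) : span (A :|: B) = span A :|: span B.
Proof. exact: bigcup_setU. Qed.

Lemma span1 e : span [set e] = v e.
Proof. by rewrite /span big_set1. Qed.

Lemma spanS (A B : {set E}) : A \subset B -> span A \subset span B.
Proof.
move=> sAB; apply/bigcupsP => e eA; apply: bigcup_sup; exact: (subsetP sAB).
Qed.

Lemma mem_span e (S : {set E}) x : e \in S -> x \in v e -> x \in span S.
Proof. by move=> eS xe; apply/bigcupP; exists e. Qed.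

Lemma sub_span e (S : {set E}) : e \in S -> v e \subset span S.
Proof. by move=> eS; apply/subsetP => x; apply: mem_span. Qed.

Lemma phiU (A B : {set E}) :
  phi (A :|: B) = phi A + phi B - #|span A :&: span B|%:Z + (d * #|A :&: B|)%:Z.
Proof.
rewrite /phi spanU.
have := cardsUI (span A) (span B); have := cardsUI A B.
move=> h1 h2; have : (d * #|A :|: B| + d * #|A :&: B| = d * #|A| + d * #|B|)%N.
  by rewrite -!mulnDr h1.
lia.
Qed.

Lemma phi_submod (A B : {set E}) : phi (A :|: B) + phi (A :&: B) <= phi A + phi B.
Proof.
rewrite phiU /phi.
have : (#|span (A :&: B)| <= #|span A :&: span B|)%N.
  by apply: subset_leq_card; rewrite subsetI !spanS ?subsetIl ?subsetIr.
lia.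
Qed.

Lemma phiU_disj (A B : {set E}) t : A :&: B = set0 -> (t <= #|span A :&: span B|)%N ->
  phi (A :|: B) <= phi A + phi B - t%:Z.
Proof. by move=> AB0 tle; rewrite phiU AB0 cards0 muln0; lia. Qed.

Lemma phi1 e : phi [set e] = #|v e|%:Z - d%:Z.
Proof. by rewrite /phi span1 cards1 muln1. Qed.

Lemma phi_add e (A : {set E}) t : #|v e| = d.+2 -> e \notin A -> (t <= #|v e :&: span A|)%N ->
  phi (e |: A) <= phi A + 2 - t%:Z.
Proof.
move=> ve eA tle; have AB : [set e] :&: A = set0.
  by apply/setP => x; rewrite !inE; apply/andP => -[/eqP -> ]; rewrite (negPf eA).
by have := @phiU_disj [set e] A t AB; rewrite span1 phi1 ve => /(_ tle); lia.
Qed.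

Section Uniform.

Hypothesis vcard : forall e, #|v e| = d.+2.

Lemma phi_single e : phi [set e] = 2.
Proof. by rewrite phi1 vcard; slia. Qed.

Lemma phi_pair e f : e != f -> phi [set e; f] = 4 - #|v e :&: v f|%:Z.
Proof.
move=> ef; rewrite phiU !phi_single !span1.
have -> : [set e] :&: [set f] = set0.
  apply/setP => x; rewrite !inE; apply/andP => -[/eqP -> /eqP efE].
  by move: ef; rewrite efE eqxx.
by rewrite cards0 muln0; slia.
Qed.

(* Stronger than what freeness requires: all the sizes from 2 to 6 are excluded, so
   that proper subsets of minimal bad sets have large [phi]. *)
Definition bad (S : {set E}) : bool := (2 <= #|S| <= 6)%N && (phi S <= 2).

Definition minbad (C : {set E}) : bool := minset bad C.

Definition clean (H : {set E}) : bool := [forall S : {set E}, (S \subset H) ==> ~~ bad S].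

(** A nonempty good set has [phi] exactly 2 and no nonempty part below that. Pairs must reach 3,
    that is share at most one vertex: two edges through a common pair of vertices are both killed by
    every other edge through it, a correlation that is not of lower order. *)
Definition good (S : {set E}) : bool :=
  (phi S <= 2) &&
  [forall I : {set E}, (I \subset S) ==>
     ((0 < #|I|)%N ==> (2 <= phi I)) && ((#|I| == 2%N) ==> (3 <= phi I))].

Lemma minbad_bad C : minbad C -> bad C.
Proof. exact: minsetp. Qed.

Lemma minbad_le6 C : minbad C -> (#|C| <= 6)%N.
Proof. by case/minbad_bad/andP => /andP[]. Qed.

Lemma minbad_ge2 C : minbad C -> (2 <= #|C|)%N.
Proof. by case/minbad_bad/andP => /andP[]. Qed.

Lemma minbad_phi C : minbad C -> phi C <= 2.
Proof. by case/minbad_bad/andP. Qed.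

Lemma bad_minbad S : bad S -> exists2 C, minbad C & C \subset S.
Proof. by case/minset_exists => C mC CS; exists C. Qed.

Lemma cleanP H : reflect (forall C, minbad C -> ~~ (C \subset H)) (clean H).
Proof.
apply: (iffP forallP) => [h C mC | h S].
  by apply/negP => CH; have := h C; rewrite CH minbad_bad.
apply/implyP => SH; apply/negP => /bad_minbad [C mC CS].
by have := h _ mC; rewrite (subset_trans CS SH).
Qed.

Lemma minbad_sub2 (C I : {set E}) : minbad C -> I \proper C -> (2 <= #|I|)%N -> 3 <= phi I.
Proof.
move=> mC pI I2; have /minsetP[_ minC] := mC.
have IC := proper_sub pI; have cI := proper_card pI.
case: (boolP (bad I)) => [bI | ].
  by have E1 := minC _ bI IC; rewrite E1 ltnn in cI.
rewrite /bad I2 /=; have := minbad_le6 mC; slia.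
Qed.

Lemma minbad_sub (C I : {set E}) : minbad C -> I \subset C -> I != set0 -> I = C \/ 2 <= phi I.
Proof.
move=> mC IC I0; case: (eqVneq I C) => [-> | nIC]; [by left | right].
have pI : I \proper C by rewrite properEneq nIC.
case: (ltnP 1 #|I|) => [|I1]; first by move/(minbad_sub2 mC pI); slia.
have /cards1P[x ->] : #|I| == 1%N by rewrite eqn_leq I1 card_gt0.
by rewrite phi_single.
Qed.

(** The intersection is [C] itself or has [phi >= 2 >= phi C], so submodularity lets a set absorb a
    minimal bad set for free. *)
Lemma phi_grow (C I : {set E}) : minbad C -> I :&: C != set0 -> phi (I :|: C) <= phi I.
Proof.
move=> mC IC0; have := phi_submod I C; have := minbad_phi mC.
by case: (minbad_sub mC (subsetIr I C) IC0) => [-> | ]; slia.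
Qed.

(** A proper part of [C] with two edges has [phi >= 3] by minimality, which gains one unit. *)
Lemma phi_grow2 (C I : {set E}) : minbad C -> (2 <= #|I :&: C|)%N -> ~~ (C \subset I) ->
  phi (I :|: C) + 1 <= phi I.
Proof.
move=> mC IC2 nCI; have := phi_submod I C; have := minbad_phi mC.
have := @minbad_sub2 C (I :&: C) mC; rewrite properE subsetIr subsetI subxx andbT.
by move/(_ nCI IC2); slia.
Qed.

Lemma minbad_linear (C : {set E}) e f : minbad C -> (3 <= #|C|)%N -> e \in C -> f \in C ->
  e != f -> 3 <= phi [set e; f].
Proof.
move=> mC C3 eC fC ef; apply: (minbad_sub2 mC); last by rewrite cards2 ef.
by rewrite properEcard subUset !sub1set eC fC cards2 ef.
Qed.

Lemma goodP S : reflect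
  [/\ phi S <= 2, forall I : {set E}, I \subset S -> I != set0 -> 2 <= phi I &
    forall e f, e \in S -> f \in S -> e != f -> 3 <= phi [set e; f]] (good S).
Proof.
apply: (iffP andP) => [[p /forallP h]|[p h1 h2]]; split=> //.
- move=> I IS I0; have := h I; rewrite IS card_gt0 I0 /=; by case/andP.
- move=> e f eS fS ef; have := h [set e; f].
  by rewrite subUset !sub1set eS fS cards2 ef; case/andP.
apply/forallP => I; apply/implyP => IS; apply/andP; split; apply/implyP.
  by rewrite card_gt0; apply: h1.
move=> /cards2P [e [f [ef IE]]]; rewrite IE; apply: h2 => //; apply: (subsetP IS);
  by rewrite IE !inE eqxx ?orbT.
Qed.

Lemma minbad_good C : minbad C -> (3 <= #|C|)%N -> good C || (phi C <= 1).
Proof.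
move=> mC C3; case: (boolP (phi C <= 1)) => [|p1]; rewrite ?orbT // orbF.
apply/goodP; split; first exact: minbad_phi.
  by move=> I IC I0; case: (minbad_sub mC IC I0) => [-> |//]; slia.
by move=> e f; apply: minbad_linear.
Qed.

(** Any nonempty subset of the union can absorb the set it meets and then the other one, so its
    [phi] is at least that of the union. The condition on pairs takes more work. *)
Lemma minbadU_good (C C' : {set E}) e : minbad C -> minbad C' -> (3 <= #|C|)%N -> (3 <= #|C'|)%N ->
  e \in C -> e \in C' -> good (C :|: C') || (phi (C :|: C') <= 1).
Proof.
move=> mC mC' C3 C3' eC eC'.
case: (boolP (phi (C :|: C') <= 1)) => [|p1]; rewrite ?orbT // orbF.
have ne (A B : {set E}) x : x \in A -> x \in B -> A :&: B != set0.
  by move=> xA xB; apply/set0Pn; exists x; rewrite inE xA.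
have half (A B I : {set E}) : minbad A -> minbad B -> e \in A -> e \in B -> I \subset A :|: B ->
    I :&: A != set0 -> phi (A :|: B) <= phi I.
  move=> mA mB eA eB IAB IA.
  have := phi_grow mA IA; have := @phi_grow B (I :|: A) mB.
  rewrite (ne _ _ e) ?inE ?eA ?orbT // => /(_ isT).
  by rewrite -setUA (setUidPr IAB); slia.
apply/goodP; split.
- by have := phi_grow mC' (ne _ _ _ eC eC'); have := minbad_phi mC; slia.
- move=> I IU /set0Pn [x xI]; suff : phi (C :|: C') <= phi I by slia.
  have := subsetP IU _ xI; rewrite inE => /orP[xC|xC'].
    by apply: half => //; apply: ne xI xC.
  by rewrite setUC; apply: half => //; rewrite 1?setUC //; apply: ne xI xC'.
(* Suppose [f] and [g] share two vertices. Absorbing [A] into [{f, g}] brings in [e]; then [B] is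
   met in both [e] and [g], and absorbing it is strict. If [A] and [B] have two common edges, their
   union is low already. *)
have cross (A B : {set E}) f g : minbad A -> minbad B -> (3 <= #|A|)%N -> (3 <= #|B|)%N ->
    e \in A -> e \in B -> ~ phi (A :|: B) <= 1 ->
    f \in A -> g \in B -> f \notin B -> g \notin A -> f != g -> 3 <= phi [set f; g].
  move=> mA mB A3 B3 eA eB pAB fA gB fB gA fg.
  case: (lerP 3 (phi [set f; g])) => // pfg; exfalso; apply: pAB.
  have pA := minbad_phi mA.
  case: (ltnP 1 #|A :&: B|) => AB.
    have nBA : ~~ (B \subset A) by apply: contra gA => /subsetP/(_ _ gB).
    by move: (phi_grow2 mB AB nBA) pA; clear; slia.
  have AB1 : A :&: B = [set e].
    by apply/esym/eqP; rewrite eqEcard cards1 AB sub1set inE eA eB.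
  have h1 : phi ([set f; g] :|: A) <= phi [set f; g].
    by apply: phi_grow => //; apply: ne (fA); rewrite !inE eqxx.
  have I2 : ([set f; g] :|: A) :&: B = [set e; g].
    apply/setP => x; rewrite !inE.
    have := AB1 => /setP /(_ x); rewrite !inE => AE.
    case: (eqVneq x f) => [->|xf] /=.
      by rewrite (negPf fB) (negPf fg) orbF; apply/esym/negP => /eqP fe; rewrite fe eB in fB.
    rewrite andb_orl AE; case: (eqVneq x g) => [->|]; rewrite ?gB ?orbT ?orbF //.
  have eg : e != g by apply: contraNneq gA => <-.
  have := @phi_grow2 B ([set f; g] :|: A) mB; rewrite I2 cards2 eg => /(_ isT).
  have -> : ~~ (B \subset [set f; g] :|: A).
    apply/negP => sB; have : B \subset [set e; g] by rewrite -I2 subsetI sB subxx.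
    by move/subset_leq_card; rewrite cards2 eg; slia.
  move=> /(_ isT); have : phi (A :|: B) <= phi ([set f; g] :|: A :|: B); last by slia.
  rewrite (_ : _ :|: A :|: B = A :|: B) //.
  by apply/setP => x; rewrite !inE; case: eqP => [->|_]; rewrite ?fA //; case: eqP => [->|_]; rewrite ?gB ?orbT.
move=> f g; rewrite !inE => fU gU fg; move/negP in p1.
case: (boolP (f \in C)) fU => fC /= fC'; case: (boolP (g \in C)) gU => gC /= gC'.
- exact: minbad_linear mC C3 fC gC fg.
- case: (boolP (f \in C')) => fC2; first exact: minbad_linear mC' C3' fC2 gC' fg.
  exact: (cross C C').
- case: (boolP (g \in C')) => gC2; first exact: minbad_linear mC' C3' fC' gC2 fg.
  rewrite setUC; rewrite eq_sym in fg; exact: (cross C C').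
- exact: minbad_linear mC' C3' fC' gC' fg.
Qed.

(* If [g] obstructs two edges of a good set, the union of the two obstructions loses a degree of freedom. *)
Lemma kill_phi (S C1 C2 : {set E}) f f' g : good S -> minbad C1 -> minbad C2 ->
  f \in S -> f' \in S -> g \notin S -> f != f' ->
  f \in C1 -> g \in C1 -> f' \in C2 -> g \in C2 -> f' \notin C1 -> f \notin C2 ->
  phi (S :|: C1 :|: C2) <= 1.
Proof.
move=> /goodP [pS hS lS] m1 m2 fS f'S gS ff' f1 g1 f2 g2 nf' nf.
have p1 := minbad_phi m1; have p2 := minbad_phi m2.
have ne (A B : {set E}) x : x \in A -> x \in B -> A :&: B != set0.
  by move=> xA xB; apply/set0Pn; exists x; rewrite inE xA.
have sub1 (A B : {set E}) : A :|: B = A :|: (A :|: B) by rewrite setUA setUid.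
(* With two common edges the obstructions alone have union at most 1; since nonempty parts of [S]
   have [phi >= 2 >= phi S], gluing to [S] does not raise this. *)
case: (ltnP 1 #|C1 :&: C2|) => C12.
  have h : phi (C1 :|: C2) <= 1.
    have := phi_grow2 m2 C12; have -> : ~~ (C2 \subset C1).
      by apply: contra nf' => /subsetP/(_ _ f2).
    by move=> /(_ isT); slia.
  rewrite -setUA; have := phi_submod S (C1 :|: C2).
  have := hS (S :&: (C1 :|: C2)) (subsetIl _ _).
  by rewrite (ne _ _ f) ?inE ?f1 // => /(_ isT); slia.
set I := S :&: (C1 :|: C2).
have IS : I \subset S by apply: subsetIl.
have h12 : phi (C1 :|: C2) <= 2.
  by have := phi_grow m2 (ne _ _ _ g1 g2); slia.
case: (lerP 3 (phi I)) => pI.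
  by rewrite -setUA; have := phi_submod S (C1 :|: C2); rewrite -/I; slia.
have fI : f \in I by rewrite !inE fS f1.
have f'I : f' \in I by rewrite !inE f'S f2 orbT.
(* If the trace [I] meets the obstruction [A] in two edges, [I :|: A] lies strictly below [I]. Its
   trace on [S] is still [I], so the gain survives gluing to [S], and [B] is absorbed for free. *)
have key (A B : {set E}) x y : minbad A -> minbad B -> x \in A -> y \in B -> y \in S ->
    x \in I -> g \in A -> g \in B -> A \subset C1 :|: C2 -> (2 <= #|I :&: A|)%N -> phi (S :|: A :|: B) <= 1.
  move=> mA mB xA yB yS xI gA gB sA IA.
  have nA : ~~ (A \subset I).
    by apply/negP => /subsetP /(_ _ gA); rewrite inE (negPf gS).
  have h1 := phi_grow2 mA IA nA.
  have SI : S :&: (I :|: A) = I.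
    rewrite setIUr (setIidPr IS); apply/setUidPl; rewrite /I setIS //.
  have := phi_submod S (I :|: A); rewrite SI setUA (setUidPl IS).
  have := @phi_grow B (S :|: A) mB; rewrite (ne _ _ y) ?inE ?yS // => /(_ isT).
  slia.
case: (ltnP 1 #|I :&: C1|) => I1.
  exact: (key C1 C2 f f' m1 m2 f1 f2 f'S fI g1 g2 (subsetUl _ _) I1).
case: (ltnP 1 #|I :&: C2|) => I2.
  rewrite -setUA (setUC C1) setUA.
  exact: (key C2 C1 f' f m2 m1 f2 f1 fS f'I g2 g1 (subsetUr _ _) I2).
have E1 : I :&: C1 = [set f].
  by apply/esym/eqP; rewrite eqEcard cards1 I1 sub1set inE fI f1.
have E2 : I :&: C2 = [set f'].
  by apply/esym/eqP; rewrite eqEcard cards1 I2 sub1set inE f'I f2.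
(* The only trace left is a pair of edges of a good set, which has [phi >= 3]. *)
have IE : I = [set f; f'].
  rewrite -E1 -E2 -setIUr; apply/esym/setIidPl; exact: subsetIr.
by move: pI; rewrite IE; have := lS _ _ fS f'S ff'; slia.
Qed.

(** If the obstructions share only [g], their spans share the [d + 2] vertices of [g], which would
    give 2, and moreover a vertex of [p] outside [g]. *)
Lemma pair_kill_phi (p : {set T}) (C1 C2 : {set E}) e e' g : minbad C1 -> minbad C2 ->
  #|p| = 2%N -> p \subset v e -> p \subset v e' -> ~~ (p \subset v g) ->
  e \in C1 -> g \in C1 -> e' \in C2 -> g \in C2 -> e' \notin C1 ->
  phi (C1 :|: C2) <= 1.
Proof.
move=> m1 m2 p2 pe pe' pg e1 g1 e2 g2 ne'.
have p1 := minbad_phi m1; have p2' := minbad_phi m2.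
case: (ltnP 1 #|C1 :&: C2|) => C12.
  have := phi_grow2 m2 C12; have -> : ~~ (C2 \subset C1).
    by apply: contra ne' => /subsetP/(_ _ e2).
  by move=> /(_ isT); slia.
have E1 : C1 :&: C2 = [set g].
  by apply/esym/eqP; rewrite eqEcard cards1 C12 sub1set inE g1 g2.
rewrite phiU E1 cards1 muln1.
have : (d.+3 <= #|span C1 :&: span C2|)%N.
  have : (#|v g :|: p| <= #|span C1 :&: span C2|)%N.
    apply: subset_leq_card; rewrite subUset !subsetI !sub_span //=.
    by rewrite (subset_trans pe (sub_span e1)) (subset_trans pe' (sub_span e2)).
  have : (#|v g| < #|v g :|: p|)%N.
    by apply: proper_card; rewrite properUl.
  by rewrite vcard; slia.
slia.
Qed.

End Uniform.
End Excess.

(** * Random subsets *)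

Section RandomSubset.

Variables (R : realFieldType) (E : finType) (p : E -> R).
Hypothesis p01 : forall e, 0 <= p e <= 1.
Implicit Types (A B K : {set E}) (F G : {set E} -> R).

Definition pr A : R := \prod_e (if e \in A then p e else 1 - p e).

Definition Ex F : R := \sum_A pr A * F A.

Lemma pr_ge0 A : 0 <= pr A.
Proof.
by apply: prodr_ge0 => e _; have /andP[p0 p1] := p01 e; case: ifP; lra.
Qed.

Lemma Ex_prod (a b : E -> R) :
  Ex (fun A => \prod_e (if e \in A then a e else b e)) =
  \prod_e (p e * a e + (1 - p e) * b e).
Proof.
rewrite bigA_distr /Ex; apply: eq_bigr => A _.
by rewrite /pr -big_split; apply: eq_bigr => e _; case: ifP.
Qed.

Lemma eq_Ex F G : F =1 G -> Ex F = Ex G.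
Proof. by move=> FG; apply: eq_bigr => A _; rewrite FG. Qed.

Lemma ExD F G : Ex (fun A => F A + G A) = Ex F + Ex G.
Proof. by rewrite -big_split; apply: eq_bigr => A _; rewrite /= mulrDr. Qed.

Lemma ExZ c F : Ex (fun A => c * F A) = c * Ex F.
Proof. by rewrite mulr_sumr; apply: eq_bigr => A _; ring. Qed.

Lemma ExN F : Ex (fun A => - F A) = - Ex F.
Proof. by rewrite -sumrN; apply: eq_bigr => A _; rewrite mulrN. Qed.

Lemma ExB F G : Ex (fun A => F A - G A) = Ex F - Ex G.
Proof. by rewrite ExD ExN. Qed.

Lemma Ex_sum (I : finType) (P : pred I) (F : I -> {set E} -> R) :
  Ex (fun A => \sum_(i | P i) F i A) = \sum_(i | P i) Ex (F i).
Proof.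
rewrite exchange_big; apply: eq_bigr => A _ /=.
by rewrite mulr_sumr.
Qed.

Lemma Ex_le F G : (forall A, F A <= G A) -> Ex F <= Ex G.
Proof. by move=> FG; apply: ler_sum => A _; apply: ler_wpM2l (FG A); apply: pr_ge0. Qed.

Lemma Ex_const c : Ex (fun=> c) = c.
Proof.
rewrite /Ex -mulr_suml (_ : \sum_A pr A = 1) ?mul1r //.
transitivity (Ex (fun A => \prod_e (if e \in A then 1 else 1))).
  by rewrite /Ex; apply: eq_bigr => A _; rewrite big1 ?mulr1 // => e _; apply: if_same.
by rewrite Ex_prod big1 // => e _; ring.
Qed.

Lemma Ex_exists F c : c <= Ex F -> exists A, c <= F A.
Proof.
move=> cF; case: (boolP [exists A, c <= F A]) => [/existsP //|].
rewrite negb_exists => /forallP h.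
have pos A : 0 <= pr A * (c - F A).
  by rewrite mulr_ge0 ?pr_ge0 // subr_ge0 ltW // ltNge h.
have s0 : \sum_A pr A * (c - F A) <= 0.
  by rewrite (_ : \sum_A _ = Ex (fun A => c - F A)) // ExB Ex_const subr_le0.
have /psumr_eq0P z : \sum_A pr A * (c - F A) = 0.
  by apply/eqP; rewrite eq_le s0 sumr_ge0.
have pr0 A : pr A = 0.
  have /eqP := z (fun A _ => pos A) A isT; rewrite mulf_eq0 subr_eq0 => /orP[/eqP //|/eqP cE].
  by have := h A; rewrite cE lexx.
by have := Ex_const 1; rewrite /Ex big1 => [/eqP|A _]; rewrite ?pr0 ?mul0r // eq_sym oner_eq0.
Qed.

(** * Probability of avoiding prescribed edges *)

Definition avoid K : R := \prod_(e in K) (1 - p e).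

Lemma avoid_ge0 K : 0 <= avoid K.
Proof. by apply: prodr_ge0 => e _; have := p01 e; lra. Qed.

Lemma avoid_le1 K : avoid K <= 1.
Proof. by apply: prodr_ile1 => e _; have := p01 e; lra. Qed.

Lemma avoidUI A B : avoid (A :|: B) * avoid (A :&: B) = avoid A * avoid B.
Proof.
rewrite /avoid !(big_mkcond (fun e => e \in _)) -!big_split; apply: eq_bigr => e _ /=.
by rewrite !inE; case: (e \in A); case: (e \in B); rewrite ?mulr1 ?mul1r.
Qed.

(** The Weierstrass product inequality, serving as union bound. *)
Lemma prod_ge_1B (I : finType) (P : pred I) (x : I -> R) :
  (forall i, P i -> 0 <= x i <= 1) -> 1 - \sum_(i | P i) (1 - x i) <= \prod_(i | P i) x i.
Proof.
move=> x01.
suff : 1 - \sum_(i | P i) (1 - x i) <= \prod_(i | P i) x i /\ 0 <= \prod_(i | P i) x i <= 1 by case.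
apply: (big_ind2 (fun s q => 1 - s <= q /\ 0 <= q <= 1)).
- by split; lra.
- move=> s q s' q' [h1 /andP[h2 h3]] [h1' /andP[h2' h3']]; split.
    have : 0 <= (1 - q) * (1 - q') by rewrite mulr_ge0 ?subr_ge0.
    by lra.
  by rewrite mulr_ge0 ?mulr_ile1.
- by move=> i Pi; have := x01 _ Pi; split; lra.
Qed.

Lemma avoid_ge K : 1 - \sum_(e in K) p e <= avoid K.
Proof.
have := @prod_ge_1B E (mem K) (fun e => 1 - p e).
rewrite (eq_bigr p) => [|e _]; last by ring.
by apply=> e _; have := p01 e; lra.
Qed.

Lemma Ex_in_out B K : Ex (fun A => ((B \subset A) && [disjoint K & A])%:R) =
  if [disjoint B & K] then \prod_(e in B) p e * avoid K else 0.
Proof.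
pose a e : R := (e \notin K)%:R; pose b e : R := (e \notin B)%:R.
transitivity (Ex (fun A => \prod_e (if e \in A then a e else b e))).
  apply: eq_Ex => A; case: (boolP (_ && _)) => [/andP[BA KA]|].
    rewrite big1 // => e _; case: ifP => eA; rewrite /a /b.
      by rewrite (_ : e \in K = false) //; apply: contraTF eA => /(disjointFr KA) ->.
    by rewrite (_ : e \in B = false) //; apply: contraFF eA => /(subsetP BA).
  rewrite negb_and => /orP[/subsetPn[e eB eA]|/pred0Pn[e /andP[/= eK eA]]].
    by rewrite (bigD1 e) //= (negPf eA) /b eB mul0r.
  by rewrite (bigD1 e) //= eA /a eK mul0r.
rewrite Ex_prod; case: ifP => [BK|/negbT/pred0Pn[e /andP[/= eB eK]]]; last first.
  by rewrite (bigD1 e) //= /a /b eB eK !mulr0 addr0 mul0r.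
rewrite /avoid !(big_mkcond (fun e => e \in _)) -!big_split; apply: eq_bigr => e _ /=.
rewrite /a /b; case: (boolP (e \in B)) => eB; case: (boolP (e \in K)) => eK /=.
- by rewrite (disjointFr BK eB) in eK.
- by ring.
- by ring.
- by ring.
Qed.

Lemma Ex_sub B : Ex (fun A => (B \subset A)%:R) = \prod_(e in B) p e.
Proof.
transitivity (Ex (fun A => ((B \subset A) && [disjoint set0 & A])%:R)).
  by apply: eq_Ex => A; rewrite disjoints_subset sub0set andbT.
by rewrite Ex_in_out disjoint_sym disjoints_subset sub0set /avoid big_set0 mulr1.
Qed.

Lemma Ex_disj K : Ex (fun A => [disjoint K & A]%:R) = avoid K.
Proof.
transitivity (Ex (fun A => ((set0 \subset A) && [disjoint K & A])%:R)).
  by apply: eq_Ex => A; rewrite sub0set.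
by rewrite Ex_in_out disjoints_subset sub0set /avoid big_set0 mul1r.
Qed.

(* Joint avoidance of several sets is nearly independent when their overlaps are light. *)
Lemma avoid_bigcup (I : eqType) (s : seq I) (K : I -> {set E}) : uniq s ->
  avoid (\bigcup_(i <- s) K i) *
    (1 - \sum_(i <- s) \sum_(j <- s | i != j) \sum_(e in K i :&: K j) p e)
  <= \prod_(i <- s) avoid (K i).
Proof.
elim: s => [|i s IH] /=; first by rewrite !big_nil /avoid big_set0 mul1r subr0.
move=> /andP[nis us]; rewrite !big_cons.
set U := \bigcup_(j <- s) K j in IH *.
set X := \sum_(j <- s) _ in IH.
set x := \sum_(j <- s) \sum_(e in K i :&: K j) p e.
set Y := (X in 1 - X).
have ge0S (J : {set E}) : 0 <= \sum_(e in J) p e.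
  by apply: sumr_ge0 => e _; have /andP[] := p01 e.
have YX : X + x <= Y.
  rewrite /Y eqxx /=; set y := \sum_(j <- s | _) _.
  have -> : y = x.
    rewrite /y /x big_seq_cond [RHS]big_seq; apply: eq_bigl => j.
    by case: (boolP (j \in s)) => //= js; apply: contraNneq nis => ->.
  rewrite addrC lerD2l; apply: ler_sum => j _; rewrite big_cons.
  by case: ifP => _; rewrite ?lerDr ?ge0S.
have KU : 1 - x <= avoid (K i :&: U).
  apply: le_trans (avoid_ge _); rewrite lerD2l lerN2 /x /U.
  elim: (s) => [|j s' IHs]; first by rewrite !big_nil setI0 big_set0.
  rewrite !big_cons setIUr.
  have : \sum_(e in K i :&: K j :|: K i :&: \bigcup_(j <- s') K j) p e <=
     \sum_(e in K i :&: K j) p e + \sum_(e in K i :&: \bigcup_(j <- s') K j) p e.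
    rewrite !(big_mkcond (fun e => e \in _ :|: _)) (big_mkcond (fun e => e \in K i :&: K j)).
    rewrite (big_mkcond (fun e => e \in K i :&: \bigcup_(j <- s') K j)) -big_split.
    apply: ler_sum => e _; have /andP[p0 _] := p01 e.
    by rewrite /= inE; do 2![case: (e \in _ :&: _)] => /=; lra.
  move=> /le_trans; apply; rewrite lerD2l //.
have x0 : 0 <= x by apply: sumr_ge0.
have X0 : 0 <= X by apply: sumr_ge0 => j _; apply: sumr_ge0.
have U0 := avoid_ge0 (K i :|: U).
(* A negative factor makes the claim trivial. Otherwise [1 - Y <= (1 - x) * (1 - X)]: the first
   factor is bounded by [avoid (K i :&: U)] and absorbed through [avoidUI], the second goes to the
   induction hypothesis. *)
case: (lerP 0 (1 - Y)) => Y1; last first.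
  by apply: le_trans (_ : 0 <= _); [rewrite mulr_ge0_le0 // ltW | rewrite mulr_ge0 ?avoid_ge0 ?prodr_ge0 // => *; apply: avoid_ge0].
apply: le_trans (_ : avoid (K i :|: U) * (avoid (K i :&: U) * (1 - X)) <= _).
  apply: ler_wpM2l => //.
  have h1 : (1 - x) * (1 - X) <= avoid (K i :&: U) * (1 - X) by apply: ler_wpM2r => //; lra.
  have h2 : 0 <= x * X by apply: mulr_ge0.
  by move: h1 h2; lra.
rewrite mulrA avoidUI -mulrA ler_wpM2l ?avoid_ge0 //; exact: IH.
Qed.

End RandomSubset.

(** * Weighted states *)

Section State.

Variables (R : realFieldType) (T E : finType) (v : E -> {set T}) (d : nat).
Hypothesis vcard : forall e, #|v e| = d.+2.
Implicit Types (A B C S U H K : {set E}) (e f g : E) (w : E -> R) (om : R).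

Definition rho H w e : R := (e \in H)%:R + w e.

Definition wt H w S : R := \prod_(e in S) rho H w e.

(* Under the initial weights [w ~ n ^- d] a set [S] occurs with total weight
   [n ^ (phi S)], hence [O(n^2)] for good sets and [O(n)] for [eclass].  The size
   bounds are those of a union of two minimal bad sets sharing an edge,
   [11 = 6 + 6 - 1], and of such a union with two further ones, [23 = 11 + 6 + 6]. *)
Definition mclass S : bool := [&& (0 < #|S|)%N, (#|S| <= 11)%N & good v d S].

Definition eclass S : bool := [&& (0 < #|S|)%N, (#|S| <= 23)%N & phi v d S <= 1].

Definition Msum H w : R := \sum_(S | mclass S) wt H w S.

Definition Esum H w : R := \sum_(S | eclass S) wt H w S.

(** The pair condition stands in for any regularity assumption: it bounds deterministically the
    weight of the edges overlapping a given one, and the total weight by [pairs]. *)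
Record state om H w : Prop := State {
  state_clean : clean v d H;
  state_ge0 : forall e, 0 <= w e;
  state_om : forall e, w e <= om;
  state_avail : forall e, w e != 0 -> (e \notin H) && clean v d (e |: H);
  state_pair : forall p : {set T}, #|p| = 2%N -> \sum_(e | p \subset v e) w e <= 1 }.

Definition pairs : nat := 'C(#|T|, 2).

(** [e] and [g] are the last two missing edges of an obstruction, so choosing [g] rules [e] out. An
    edge kills itself because it leaves the pool once chosen. *)
Definition killers H e : {set E} :=
  [set g | (g == e) || [exists C, minbad v d C && (C :\: H == [set e; g])]].

(** Obstructions with two edges are left out: they are overlapping pairs of edges, controlled
    through [overlap]. *)
Definition killers3 H e : {set E} :=
  [set g | [exists C, [&& minbad v d C, (3 <= #|C|)%N & C :\: H == [set e; g]]] & g != e].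

Definition overlap e : {set E} := [set g | (2 <= #|v e :&: v g|)%N].

Section Fixed.

Variables (om : R) (H : {set E}) (w : E -> R).
Hypothesis st : state om H w.

Let w0 e : 0 <= w e := state_ge0 st e.

Lemma wH e : e \in H -> w e = 0.
Proof.
move=> eH; apply/eqP; apply: contraTT eH => we; by case/andP: (state_avail st we).
Qed.

Lemma rho_ge0 e : 0 <= rho H w e.
Proof. by rewrite addr_ge0 ?ler0n. Qed.

Lemma wt_ge0 S : 0 <= wt H w S.
Proof. by apply: prodr_ge0 => e _; apply: rho_ge0. Qed.

Lemma wtE S : wt H w S = \prod_(e in S :\: H) w e.
Proof.
rewrite /wt (big_setID H) /= big1 ?mul1r => [|e /setIP[_ eH]]; last first.
  by rewrite /rho eH wH // addr0.
by apply: eq_bigr => e /setDP[_ eH]; rewrite /rho (negPf eH) add0r.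
Qed.

(** Charging principle: every nonzero term is dominated by the weight of a set [U] of the class, and
    each [U] is charged at most [N] times. The estimates against [Msum] and [Esum] below all have
    this form. *)
Lemma sum_class (X : finType) (P : pred X) (a : X -> R) (Q : pred {set E})
    (c : X -> {set E} -> bool) (N : nat) :
  (forall x, P x -> a x = 0 \/ exists U, [/\ Q U, c x U & a x <= wt H w U]) ->
  (forall U, Q U -> (#|[set x | P x & c x U]| <= N)%N) ->
  \sum_(x | P x) a x <= N%:R * \sum_(U | Q U) wt H w U.
Proof.
move=> ha hN.
apply: (@le_trans _ _ (\sum_(x | P x) \sum_(U | Q U && c x U) wt H w U)).
  apply: ler_sum => x Px; have s0 (D : pred {set E}) : 0 <= \sum_(U | D U) wt H w U.
    by apply: sumr_ge0 => U _; apply: wt_ge0.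
  have [-> //|[U [QU cU aU]]] := ha x Px.
  by rewrite (bigD1 U) ?QU //=; apply: le_trans aU _; rewrite lerDl s0.
rewrite (exchange_big_dep Q) /=; last by move=> x U _ /andP[].
rewrite mulr_sumr; apply: ler_sum => U QU.
rewrite sumr_const mulr_natl ler_wpMn2l ?wt_ge0 //.
apply: leq_trans (hN U QU); apply: subset_leq_card; apply/subsetP => x.
by rewrite !inE unfold_in /= => /andP[-> /andP[]].
Qed.

Lemma sum_meclass : \sum_(U | mclass U || eclass U) wt H w U <= Msum H w + Esum H w.
Proof.
rewrite /Msum /Esum (bigID mclass) /= lerD //.
  rewrite le_eqVlt; apply/orP; left; apply/eqP; apply: eq_bigl => U.
  by case: (mclass U); rewrite ?andbF ?andbT.
rewrite [leRHS](bigID mclass) /= (eq_bigl (fun U => eclass U && ~~ mclass U)) => [|U].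
  by rewrite lerDr; apply: sumr_ge0 => U _; apply: wt_ge0.
by case: (mclass U); rewrite ?andbF ?andbT.
Qed.

Lemma minbad_class C : minbad v d C -> (3 <= #|C|)%N -> mclass C || eclass C.
Proof.
move=> mC C3; have := minbad_good vcard mC C3; rewrite /mclass /eclass.
by have := minbad_le6 mC; move: (good _ _ _) (phi _ _ _ <= 1) => a b; lia.
Qed.

Lemma minbadU_class C C' e : minbad v d C -> minbad v d C' -> (3 <= #|C|)%N ->
  (3 <= #|C'|)%N -> e \in C -> e \in C' -> mclass (C :|: C') || eclass (C :|: C').
Proof.
move=> mC mC' C3 C3' eC eC'; have := minbadU_good vcard mC mC' C3 C3' eC eC'.
have : (0 < #|C :&: C'|)%N by rewrite card_gt0; apply/set0Pn; exists e; rewrite inE eC.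
rewrite /mclass /eclass; have := cardsUI C C'; have := subset_leq_card (subsetIl C C').
have := minbad_le6 mC; have := minbad_le6 mC'.
by move: (good _ _ _) (phi _ _ _ <= 1) => a b; lia.
Qed.

Lemma minbad3_sum : \sum_(C | minbad v d C && (3 <= #|C|)%N) wt H w C <= Msum H w + Esum H w.
Proof.
apply: le_trans sum_meclass; rewrite -[leRHS]mul1r.
apply: (@sum_class _ _ _ _ (fun C U => C == U) 1%N) => [C /andP[mC C3]|U _].
  by right; exists C; split=> //; apply: minbad_class.
rewrite -(cards1 U); apply: subset_leq_card; apply/subsetP => C.
by rewrite !inE => /andP[_ /eqP ->].
Qed.

Lemma killers3P e g : reflect
  (exists C, [/\ minbad v d C, (3 <= #|C|)%N, C :\: H = [set e; g] & g != e]) (g \in killers3 H e).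
Proof.
rewrite inE; apply: (iffP andP) => [[/existsP[C /and3P[? ? /eqP ?]] ?]|[C [mC C3 CH ge]]].
  by exists C.
by split=> //; apply/existsP; exists C; rewrite mC C3 CH eqxx.
Qed.

Lemma killers_sub e : killers H e \subset overlap e :|: killers3 H e.
Proof.
apply/subsetP => g; rewrite !inE => /orP[/eqP ->|/existsP[C /andP[mC /eqP CH]]].
  by rewrite setIid vcard.
case: (eqVneq g e) => [->|ge] /=; first by rewrite setIid vcard.
case: (ltnP 2 #|C|) => C3.
  apply/orP; right; rewrite andbT; apply/existsP; exists C.
  by rewrite mC C3 CH eqxx.
have CE : C = [set e; g].
  apply/esym/eqP; rewrite eqEcard -CH subsetDl CH cards2 eq_sym ge.
  by have := minbad_ge2 mC; lia.
apply/orP; left; have := minbad_phi mC.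
by rewrite CE phi_pair // 1?eq_sym //; lia.
Qed.

(** An edge overlapping [e] contains one of its vertex pairs, each of which carries weight at most
    one. *)
Lemma overlap_sum e : \sum_(g in overlap e) w g <= 'C(d.+2, 2)%:R.
Proof.
apply: (@le_trans _ _ (\sum_(g in overlap e) \sum_(p : {set T} | (p \subset v e) && (#|p| == 2%N) && (p \subset v g)) w g)).
  apply: ler_sum => g; rewrite inE => h.
  have [p pI p2] : exists2 p : {set T}, p \subset v e :&: v g & #|p| = 2%N.
    have [x [y [xI yI xy]]] : exists x, exists y, [/\ x \in v e :&: v g, y \in v e :&: v g & x != y].
      by move: h => /card_gt1P [x [y [? ? ?]]]; exists x, y.
    by exists [set x; y]; rewrite ?cards2 ?xy // subUset !sub1set xI yI.
  move: pI; rewrite subsetI => /andP[pe pg].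
  by rewrite (bigD1 p) ?pe ?p2 ?pg //= lerDl; apply: sumr_ge0.
rewrite (exchange_big_dep (fun p : {set T} => (p \subset v e) && (#|p| == 2%N))) /=; last first.
  by move=> g p _ /andP[].
apply: (@le_trans _ _ (\sum_(p : {set T} | (p \subset v e) && (#|p| == 2%N)) 1)).
  apply: ler_sum => p /andP[pe /eqP p2]; apply: le_trans (state_pair st p2).
  rewrite [leRHS](bigID (mem (overlap e))) /= (eq_bigl (fun i => (p \subset v i) && (i \in overlap e))).
    by rewrite lerDl; apply: sumr_ge0.
  by move=> g; rewrite pe p2 /= andbC.
rewrite sumr_const -(vcard e) -cards_draws ler_nat.
by rewrite -(cardsE (fun p : {set T} => (p \subset v e) && (#|p| == 2%N))).
Qed.

Lemma killers_weight e :
  \sum_(g in killers H e) w g <= 'C(d.+2, 2)%:R + \sum_(g in killers3 H e) w g.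
Proof.
apply: le_trans (lerD (overlap_sum e) (lexx _)).
apply: (@le_trans _ _ (\sum_(g in overlap e :|: killers3 H e) w g)).
  rewrite [leRHS](big_setID (killers H e)) /= (setIidPr (killers_sub e)).
  by rewrite lerDl sumr_ge0.
rewrite (big_setID (overlap e)) /= setIUl setIid (setUidPl (subsetIr _ _)).
rewrite lerD2l setDUl setDv set0U [leRHS](big_setID (overlap e)) /=.
by rewrite lerDr sumr_ge0.
Qed.

Lemma total_sum : \sum_e w e <= pairs%:R.
Proof.
have -> : pairs%:R = \sum_(p : {set T} | #|p| == 2%N) 1 :> R.
  by rewrite sumr_const /pairs -card_draws cardsE.
apply: (@le_trans _ _ (\sum_(p : {set T} | #|p| == 2%N) \sum_(e | p \subset v e) w e)); last first.
  by apply: ler_sum => p /eqP p2; apply: (state_pair st p2).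
rewrite (exchange_big_dep xpredT) //=; apply: ler_sum => e _.
have [p pe p2] : exists2 p : {set T}, p \subset v e & #|p| = 2%N.
  have : (1 < #|v e|)%N by rewrite vcard.
  move=> /card_gt1P [x [y [xI yI xy]]].
  by exists [set x; y]; rewrite ?cards2 ?xy // subUset !sub1set xI yI.
by rewrite (bigD1 p) ?p2 ?pe //= lerDl; apply: sumr_ge0.
Qed.

Hypothesis om01 : 0 <= om <= 1.
Let om0 : 0 <= om. Proof. by case/andP: om01. Qed.
Let om1 : om <= 1. Proof. by case/andP: om01. Qed.

Let w1 e : w e <= 1. Proof. exact: le_trans (state_om st e) om1. Qed.

Lemma card_setX_le (A B : finType) (X : {set A}) (Y : {set B}) (a b : nat) :
  (#|X| <= a)%N -> (#|Y| <= b)%N -> (#|setX X Y| <= a * b)%N.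
Proof. by move=> ha hb; rewrite cardsX leq_mul. Qed.

Lemma class_card U : mclass U || eclass U -> (#|U| <= 23)%N.
Proof. by case/orP => /and3P[_ h _]; lia. Qed.

(** All other edges of the obstruction are in [H], so [w e * w g] is exactly its weight. *)
Lemma killers3_sum1 :
  \sum_e w e * (\sum_(g in killers3 H e) w g) <= 23%:R ^+ 2 * (Msum H w + Esum H w).
Proof.
under eq_bigr do rewrite mulr_sumr.
rewrite pair_big_dep /=.
apply: (@le_trans _ _ ((23 * 23)%N%:R * \sum_(U | mclass U || eclass U) wt H w U)); last first.
  by rewrite natrM -expr2 ler_wpM2l ?sum_meclass // exprn_ge0 ?ler0n.
apply: (@sum_class _ _ _ _ (fun x U => (x.1 \in U) && (x.2 \in U))) => [[e g] /= /killers3P[C [mC C3 CH ge]]|U QU].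
  right; exists C; rewrite minbad_class //; have CE x : x \in [set e; g] -> x \in C.
    by rewrite -CH inE => /andP[].
  rewrite !CE ?set21 ?set22 //; split=> //.
  by rewrite wtE CH big_setU1 ?inE 1?eq_sym // big_set1.
apply: leq_trans (@card_setX_le _ _ U U 23 23 _ _); rewrite ?class_card //.
by apply: subset_leq_card; apply/subsetP => -[e g]; rewrite !inE /= => /andP[_].
Qed.

(** Two killers of [e] come from two obstructions through [e]. By [minbadU_good] their union stays
    within the two tracked classes, so even the second moment is controlled by them. *)
Lemma killers3_sum2 :
  \sum_e w e * (\sum_(g in killers3 H e) w g) ^+ 2 <= 23%:R ^+ 3 * (Msum H w + Esum H w).
Proof.
have -> : \sum_e w e * (\sum_(g in killers3 H e) w g) ^+ 2 =
  \sum_(x : E * (E * E) | (x.2.1 \in killers3 H x.1) && (x.2.2 \in killers3 H x.1))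
     w x.1 * w x.2.1 * w x.2.2.
  rewrite -(pair_big_dep xpredT (fun e x => (x.1 \in killers3 H e) && (x.2 \in killers3 H e))
     (fun e x => w e * w x.1 * w x.2)) /=.
  apply: eq_bigr => e _; rewrite expr2 mulr_suml mulr_sumr.
  rewrite -(pair_big_dep (mem (killers3 H e)) (fun _ => mem (killers3 H e))
     (fun g g' => w e * w g * w g')) /=.
  by apply: eq_bigr => g _; rewrite mulrA mulr_sumr.
apply: (@le_trans _ _ ((23 * (23 * 23))%N%:R * \sum_(U | mclass U || eclass U) wt H w U)); last first.
  by rewrite !natrM -expr2 -exprS ler_wpM2l ?sum_meclass // exprn_ge0 ?ler0n.
apply: (@sum_class _ _ _ _ (fun x U => [&& x.1 \in U, x.2.1 \in U & x.2.2 \in U]))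
  => [[e [g g']] /= /andP[/killers3P[C [mC C3 CH ge]] /killers3P[C' [mC' C3' CH' ge']]]|U QU].
  right; have CE x : x \in [set e; g] -> x \in C by rewrite -CH inE => /andP[].
  have CE' x : x \in [set e; g'] -> x \in C' by rewrite -CH' inE => /andP[].
  have eC : e \in C by rewrite CE ?set21.
  have eC' : e \in C' by rewrite CE' ?set21.
  have gC : g \in C by rewrite CE ?set22.
  have gC' : g' \in C' by rewrite CE' ?set22.
  exists (C :|: C'); rewrite (minbadU_class mC mC' C3 C3' eC eC').
  split=> //; first by rewrite !inE eC gC gC' orbT.
  rewrite wtE setDUl CH CH'.
  have -> : [set e; g] :|: [set e; g'] = e |: (g |: [set g']).
    by apply/setP => x; rewrite !inE; case: (x == e) => //=; rewrite orbF.
  rewrite big_setU1 ?inE ?negb_or 1?eq_sym ?ge 1?eq_sym ?ge' // -mulrA ler_wpM2l //.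
  (* If the two killers coincide, the union has one free edge less, and the spare factor is at most
     1. *)
  case: (eqVneq g g') => [->|gg]; last by rewrite big_setU1 ?inE // big_set1.
  by rewrite setUid big_set1 ler_piMl.
apply: leq_trans (@card_setX_le _ _ U (setX U U) 23 (23 * 23) _ _).
- by apply: subset_leq_card; apply/subsetP => -[e [g g']]; rewrite !inE /= => /andP[_].
- exact: class_card.
- by apply: card_setX_le; apply: class_card.
Qed.

Lemma killersP e g : g != e -> reflect (exists2 C, minbad v d C & C :\: H = [set e; g]) (g \in killers H e).
Proof.
move=> ge; rewrite inE (negPf ge) /=; apply: (iffP existsP) => [[C /andP[? /eqP ?]]|[C mC CH]].
  by exists C.
by exists C; rewrite mC CH eqxx.
Qed.

(** A subset and three elements of a set of size [m]: the data charged to one [U] in the next two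
    estimates. *)
Definition Ckill_of (m : nat) : nat := (2 ^ m * (m * m * m))%N.

Definition Ckill : nat := Ckill_of 23.

Lemma Ckill_bound (m : nat) U : (#|U| <= m)%N ->
  (#|setX (powerset U) (setX (setX U U) U)| <= Ckill_of m)%N.
Proof.
move=> Um; rewrite cardsX card_powerset leq_mul ?leq_pexp2l //.
by rewrite card_setX_le ?card_setX_le.
Qed.

(** Measures how far the survivals of two edges of a good set are from independent. A common killer
    [g] outside [S] leads by [kill_phi] to a set with [phi <= 1] whose only new free edge is [g]; a
    killer inside [S] costs a factor [om]. *)
Lemma kill_sum : \sum_(S | mclass S) wt H w S *
    (\sum_(x : E * E | [&& x.1 \in S :\: H, x.2 \in S :\: H & x.1 != x.2])
       \sum_(g in killers H x.1 :&: killers H x.2) w g)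
  <= Ckill%:R * Esum H w + (11 ^ 3)%N%:R * om * Msum H w.
Proof.
pose Px S (x : E * E) := [&& x.1 \in S :\: H, x.2 \in S :\: H & x.1 != x.2].
pose Kx (x : E * E) := killers H x.1 :&: killers H x.2.
have -> : \sum_(S | mclass S) wt H w S * (\sum_(x | Px S x) \sum_(g in Kx x) w g) =
   \sum_(S | mclass S) (\sum_(x | Px S x) \sum_(g in Kx x | g \notin S) wt H w S * w g) +
   \sum_(S | mclass S) (\sum_(x | Px S x) \sum_(g in Kx x | g \in S) wt H w S * w g).
  rewrite -big_split; apply: eq_bigr => S _ /=; rewrite mulr_sumr -big_split.
  apply: eq_bigr => x _ /=; rewrite mulr_sumr (bigID (fun g => g \in S)) /= addrC //.
apply: lerD.
  under eq_bigr do rewrite pair_big_dep.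
  rewrite pair_big_dep /=.
  apply: (@sum_class _ _ _ _ (fun (x : {set E} * (E * E * E)) U =>
     [&& x.1 \subset U, x.2.1.1 \in U, x.2.1.2 \in U & x.2.2 \in U])).
    move=> [S [[f f'] g]] /= /and4P[mS /and3P[/= fS f'S ff']].
    rewrite inE => /= /andP[gf gf'] gS; right.
    move: fS f'S => /setDP[fS fH] /setDP[f'S f'H].
    have nf : g != f by apply: contraNneq gS => ->.
    have nf' : g != f' by apply: contraNneq gS => ->.
    have /killersP -/(_ nf) [C1 m1 CH1] := gf.
    have /killersP -/(_ nf') [C2 m2 CH2] := gf'.
    have CE1 x : x \in [set f; g] -> x \in C1 by rewrite -CH1 inE => /andP[].
    have CE2 x : x \in [set f'; g] -> x \in C2 by rewrite -CH2 inE => /andP[].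
    exists (S :|: C1 :|: C2); move: mS => /and3P[S0 S11 gdS]; split.
    - apply/and3P; split.
      + by rewrite card_gt0; apply/set0Pn; exists f; rewrite !inE fS.
      + move: (leq_card_setU (S :|: C1) C2).1 (leq_card_setU S C1).1 S11.
        by move: (minbad_le6 m1) (minbad_le6 m2); clear; lia.
      + apply: (kill_phi vcard gdS m1 m2 fS f'S gS ff'); rewrite ?(CE1 f) ?(CE1 g) ?(CE2 f') ?(CE2 g) ?set21 ?set22 //.
          apply/negP => h; have : f' \in [set f; g] by rewrite -CH1 inE f'H h.
          by rewrite !inE eq_sym (negPf ff') eq_sym (negPf nf').
        apply/negP => h; have : f \in [set f'; g] by rewrite -CH2 inE fH h.
        by rewrite !inE (negPf ff') eq_sym (negPf nf).
    - by rewrite -!setUA subsetUl !inE fS f'S (CE1 g) ?set22 ?orbT.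
    - rewrite [leRHS]wtE !setDUl CH1 CH2 wtE.
      have -> : S :\: H :|: [set f; g] :|: [set f'; g] = g |: (S :\: H).
        apply/setP => x; rewrite !inE; case: (eqVneq x g) => [->|_]; first by rewrite ?orbT.
        rewrite /= !orbF; case: (eqVneq x f) => [->|_]; first by rewrite fS fH ?orbT.
        by case: (eqVneq x f') => [->|_]; rewrite ?f'S ?f'H ?orbT ?orbF.
      by rewrite big_setU1 ?inE ?(negPf gS) ?andbF // mulrC.
  move=> U /and3P[_ U23 _].
  apply: leq_trans (_ : #|setX (powerset U) (setX (setX U U) U)| <= _)%N.
    apply: subset_leq_card; apply/subsetP => -[S [[f f'] g]]; rewrite !inE /=.
    by case/andP => _ /and4P[-> -> -> ->].
  exact: Ckill_bound.
rewrite /Msum mulr_sumr; apply: ler_sum => S /and3P[_ S11 _].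
apply: (@le_trans _ _ (\sum_(x in setX S S) \sum_(g in S) wt H w S * om)); last first.
  rewrite !sumr_const cardsX -mulrnA -mulrA [om * _]mulrC mulr_natl.
  rewrite ler_wpMn2l ?mulr_ge0 ?wt_ge0 //.
  by rewrite mulnC (leq_trans (leq_mul (leq_mul S11 S11) S11)).
rewrite [leRHS](bigID (Px S)) /=; apply: ler_wpDr.
  by apply: sumr_ge0 => x _; apply: sumr_ge0 => g _; rewrite mulr_ge0 ?wt_ge0.
rewrite [leRHS](eq_bigl (Px S)) => [|x]; last first.
  rewrite !inE /Px !inE; case: (x.1 \in S) => //=; rewrite ?andbF //.
  by case: (x.2 \in S); rewrite ?andbF.
apply: ler_sum => x _; rewrite [leRHS](bigID (mem (Kx x))) /=; apply: ler_wpDr.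
  by apply: sumr_ge0 => g _; rewrite mulr_ge0 ?wt_ge0.
rewrite [leRHS](eq_bigl (fun g => (g \in Kx x) && (g \in S))) => [|g]; last by rewrite andbC.
by apply: ler_sum => g _; rewrite ler_wpM2l ?wt_ge0 ?(state_om st).
Qed.

(** Needed for the variance of the weight through [p]. Killers containing [p] act on all edges
    through [p] simultaneously and would not be of lower order. *)
Lemma pair_kill_sum :
  \sum_(p : {set T} | #|p| == 2%N)
    \sum_(x : E * E | [&& p \subset v x.1, p \subset v x.2 & x.1 != x.2]) w x.1 * w x.2 *
       \sum_(g in killers H x.1 :&: killers H x.2 | ~~ (p \subset v g)) w g
  <= (Ckill_of (23 * d.+2))%:R * Esum H w.
Proof.
under eq_bigr => p _ do under eq_bigr => x _ do rewrite mulr_sumr.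
under eq_bigr do rewrite pair_big_dep.
rewrite pair_big_dep /=.
apply: (@sum_class _ _ _ _ (fun (x : {set T} * (E * E * E)) U =>
     [&& x.1 \subset span v U, x.2.1.1 \in U, x.2.1.2 \in U & x.2.2 \in U])).
  move=> [p [[e e'] g]] /= /and3P[/eqP p2 /and3P[pe pe' ee'] /andP[]].
  rewrite inE => /andP[ge ge'] pg; right.
  have ne : g != e by apply: contraNneq pg => ->.
  have ne' : g != e' by apply: contraNneq pg => ->.
  have /killersP -/(_ ne) [C1 m1 CH1] := ge.
  have /killersP -/(_ ne') [C2 m2 CH2] := ge'.
  have CE1 x : x \in [set e; g] -> x \in C1 by rewrite -CH1 inE => /andP[].
  have CE2 x : x \in [set e'; g] -> x \in C2 by rewrite -CH2 inE => /andP[].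
  have e'H : e' \notin H.
    by have : e' \in C2 :\: H; [rewrite CH2 set21 | case/setDP].
  have e1 : e \in C1 by rewrite CE1 ?set21.
  have g1 : g \in C1 by rewrite CE1 ?set22.
  have e2 : e' \in C2 by rewrite CE2 ?set21.
  have g2 : g \in C2 by rewrite CE2 ?set22.
  have e'1 : e' \notin C1.
    apply/negP => h; have : e' \in [set e; g] by rewrite -CH1 inE e'H h.
    by rewrite !inE eq_sym (negPf ee') eq_sym (negPf ne').
  exists (C1 :|: C2); split.
  - apply/and3P; split.
    + by rewrite card_gt0; apply/set0Pn; exists e; rewrite inE e1.
    + move: (leq_card_setU C1 C2).1.
      by move: (minbad_le6 m1) (minbad_le6 m2); clear; lia.
    + exact: (pair_kill_phi vcard m1 m2 p2 pe pe' pg).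
  - rewrite !inE e1 g1 e2 orbT !andbT.
    by apply: subset_trans pe _; apply: sub_span; rewrite inE e1.
  - rewrite wtE setDUl CH1 CH2.
    have -> : [set e; g] :|: [set e'; g] = e |: (e' |: [set g]).
      by apply/setP => x; rewrite !inE; case: (x == g); rewrite ?orbT ?orbF.
    have h1 : e \notin e' |: [set g] by rewrite !inE negb_or ee' eq_sym.
    have h2 : e' \notin [set g] by rewrite inE eq_sym.
    by rewrite (big_setU1 _ h1) /= (big_setU1 _ h2) /= big_set1 mulrA.
move=> U /and3P[_ U23 _].
apply: leq_trans (_ : #|setX (powerset (span v U)) (setX (setX U U) U)| <= _)%N.
  apply: subset_leq_card; apply/subsetP => -[S [[f f'] g]]; rewrite !inE /=.
  by case/andP => _ /and4P[-> -> -> ->].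
have sU : (#|span v U| <= 23 * d.+2)%N.
  apply: leq_trans (leq_mul U23 (leqnn _)).
  have -> : (#|U| * d.+2 = \sum_(e in U) #|v e|)%N.
    by rewrite (eq_bigr (fun=> d.+2)) ?sum_nat_const.
  rewrite /span; apply: (big_ind2 (fun (A : {set T}) m => (#|A| <= m)%N)) => //; first by rewrite cards0.
  by move=> A a B b Aa Bb; apply: leq_trans (leq_card_setU _ _).1 (leq_add Aa Bb).
rewrite cardsX card_powerset leq_mul ?leq_pexp2l //.
have U23' : (#|U| <= 23 * d.+2)%N by apply: leq_trans U23 _; rewrite leq_pmulr.
by rewrite card_setX_le ?card_setX_le.
Qed.

End Fixed.
End State.

(** * One step of the random construction *)

Section Step.

Variables (R : realFieldType) (T E : finType) (v : E -> {set T}) (d : nat).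
Hypothesis vcard : forall e, #|v e| = d.+2.
Variables (om : R) (H : {set E}) (w : E -> R) (dl : R).
Hypothesis st : state v d om H w.
Hypothesis om01 : 0 <= om <= 1.
Hypothesis dl01 : 0 < dl <= 2^-1.
Hypothesis tame : forall e, w e != 0 -> dl * (\sum_(g in killers v d H e) w g) <= 2^-1.
Implicit Types (A B C S U K : {set E}) (e f g : E) (q : {set T}).

Let w0 e : 0 <= w e. Proof. exact: state_ge0 st e. Qed.
Let dl0 : 0 <= dl. Proof. by case/andP: dl01 => /ltW. Qed.
Let dl1 : dl <= 1. Proof. by case/andP: dl01; lra. Qed.
Let cdl0 : 0 <= 1 - dl. Proof. by rewrite subr_ge0. Qed.
Let w1' e : w e <= 1.
Proof. by apply: le_trans (state_om st e) _; case/andP: om01. Qed.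

Let p e : R := dl * w e.

Let p0 e : 0 <= p e. Proof. exact: mulr_ge0. Qed.

Let p01 e : 0 <= p e <= 1.
Proof. by rewrite p0 mulr_ile1. Qed.

Notation Kl e := (killers v d H e).
Let surv e : R := avoid p (Kl e).
Let boost e : R := (1 - dl) / surv e.

(* [boost] compensates for the conflicts, so that [new1] has mean [(1 - dl) * w e];
   [new3] divides by the loads to restore the bound on the sums through pairs, at a
   cost measured by [excess]. *)
Definition new1 A e : R := w e * boost e * [disjoint Kl e & A]%:R.

(** Obstructions with at least two missing edges besides [e], all chosen at once. [killers] does not
    foresee them, but they have order [dl ^ 2] and need no compensation. *)
Definition multi A e : bool :=
  [exists C, [&& minbad v d C, e \in C, (3 <= #|C :\: H|)%N & (C :\: H) :\ e \subset A]].

Definition new2 A e : R := new1 A e * (~~ multi A e)%:R.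

Definition load A (q : {set T}) : R := \sum_(e | q \subset v e) new1 A e.

Definition new3 A e : R :=
  new2 A e * \prod_(q : {set T} | (#|q| == 2%N) && (q \subset v e)) (Num.max 1 (load A q))^-1.

(** All newly chosen edges of a completed obstruction are dropped, with no choice of which to save;
    this costs only order [dl ^ 2]. *)
Definition kept A : {set E} :=
  [set e in A | (e \notin H) && ~~ [exists C, [&& minbad v d C, e \in C & C \subset H :|: A]]].

Definition newH A : {set E} := H :|: kept A.

Lemma bool_le1 (b : bool) : b%:R <= 1 :> R.
Proof. by case: b; rewrite ?ler01. Qed.

Lemma natrM_and (a b : bool) : a%:R * b%:R = (a && b)%:R :> R.
Proof. by rewrite -natrM mulnb. Qed.

Lemma disjointsU A B C : [disjoint A :|: B & C] = [disjoint A & C] && [disjoint B & C].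
Proof. by rewrite !disjoints_subset subUset. Qed.

Lemma big_pred1_eq_sym e (F : R) : \sum_(f | e == f) F = F.
Proof. by rewrite (big_pred1 e) // => f; rewrite eq_sym. Qed.

Lemma surv_ge e : w e != 0 -> 2^-1 <= surv e.
Proof.
move=> we; apply: le_trans (avoid_ge p01 _); rewrite -mulr_sumr.
by have := tame we; lra.
Qed.

Lemma surv_gt0 e : w e != 0 -> 0 < surv e.
Proof. by move/surv_ge; apply: lt_le_trans; rewrite invr_gt0. Qed.

Lemma boost_ge0 e : 0 <= boost e.
Proof. by rewrite divr_ge0 ?avoid_ge0. Qed.

Lemma boost_le2 e : w e != 0 -> boost e <= 2.
Proof.
move=> we; rewrite ler_pdivrMr ?surv_gt0 //; have := surv_ge we; have := dl0; lra.
Qed.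

Lemma wboost_le e : w e * boost e <= 2 * w e.
Proof.
case: (eqVneq (w e) 0) => [->|we]; first by rewrite mul0r mulr0.
by rewrite mulrC ler_wpM2r ?boost_le2.
Qed.

Lemma new1_ge0 A e : 0 <= new1 A e.
Proof. by rewrite /new1 mulr_ge0 ?ler0n // mulr_ge0 ?boost_ge0. Qed.

Lemma new1_le A e : new1 A e <= 2 * w e.
Proof.
apply: le_trans (wboost_le e); by rewrite /new1 ler_piMr ?bool_le1 // mulr_ge0 ?boost_ge0.
Qed.

Lemma new2_ge0 A e : 0 <= new2 A e.
Proof. by rewrite /new2 mulr_ge0 ?new1_ge0 ?ler0n. Qed.

Lemma new2_le A e : new2 A e <= new1 A e.
Proof. by rewrite /new2 ler_piMr ?new1_ge0 ?bool_le1. Qed.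

Lemma load_ge0 A q : 0 <= load A q.
Proof. by apply: sumr_ge0 => e _; apply: new1_ge0. Qed.

Lemma max1_gt0 A q : 0 < Num.max 1 (load A q).
Proof. by rewrite lt_max ltr01. Qed.

Lemma max1_inv A q : 0 <= (Num.max 1 (load A q))^-1 <= 1.
Proof.
rewrite invr_ge0 (ltW (max1_gt0 A q)) /= invf_le1 ?max1_gt0 //.
by rewrite le_max lexx.
Qed.

Lemma new3_ge0 A e : 0 <= new3 A e.
Proof.
by rewrite /new3 mulr_ge0 ?new2_ge0 ?prodr_ge0 // => q _; case/andP: (max1_inv A q).
Qed.

Lemma new3_le A e : new3 A e <= new2 A e.
Proof.
by rewrite /new3 ler_piMr ?new2_ge0 // prodr_ile1 // => q _; apply: max1_inv.
Qed.

Lemma new3_le1 A e : new3 A e <= new1 A e.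
Proof. exact: le_trans (new3_le A e) (new2_le A e). Qed.

Lemma newH_clean A : clean v d (newH A).
Proof.
apply/cleanP => C mC; apply/negP => CH.
case: (boolP (C \subset H)) => [CsH|/subsetPn[e eC eH]].
  by move/cleanP: (state_clean st) => /(_ C mC); rewrite CsH.
have := subsetP CH e eC; rewrite !inE (negPf eH) /= => /andP[_ /negP]; apply.
apply/existsP; exists C; rewrite mC eC /=.
by apply: subset_trans CH (setUS _ _); apply/subsetP => x; rewrite inE => /andP[].
Qed.

Lemma new_bad e C A : w e != 0 -> minbad v d C -> e \in C -> C \subset e |: (H :|: A) ->
  (exists2 g, g \in Kl e & (g != e) && (g \in A)) \/
  ((3 <= #|C :\: H|)%N /\ (C :\: H) :\ e \subset A).
Proof.
move=> we mC eC CA; case/andP: (state_avail st we) => eH cl.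
have eCH : e \in C :\: H by rewrite inE eH.
have sA : (C :\: H) :\ e \subset A.
  apply/subsetP => x; rewrite !inE => /and3P[xe xH xC].
  by have := subsetP CA x xC; rewrite !inE (negPf xe) (negPf xH).
case: (ltnP 2 #|C :\: H|) => C3; [by right | left].
have [g gC] : exists g, g \in (C :\: H) :\ e.
  apply/set0Pn; apply/eqP => C0; move/cleanP: cl => /(_ C mC) /negP; apply.
  apply/subsetP => x xC; rewrite !inE; case: (eqVneq x e) => //= xe.
  by have /setP/(_ x) := C0; rewrite !inE xe xC andbT /= => /negbFE ->.
have ge : g != e by move: gC; rewrite !inE => /and3P[].
exists g; last by rewrite ge (subsetP sA).
rewrite inE (negPf ge) /=; apply/existsP; exists C; rewrite mC /=.
rewrite eq_sym eqEcard subUset !sub1set eCH cards2 eq_sym ge C3 andbT.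
by move: gC; rewrite inE => /andP[].
Qed.

Lemma new3_avail A e : new3 A e != 0 -> (e \notin newH A) && clean v d (e |: newH A).
Proof.
rewrite /new3 /new2 /new1 !(mulf_eq0, negb_or).
move=> /andP[/andP[/andP[/andP[we _] dis] mult] _].
move: dis mult; rewrite !pnatr_eq0 !eqb0 => /negPn dis /negPn mult.
case/andP: (state_avail st we) => eH cl.
have eA : e \notin A.
  by rewrite (disjointFr dis) // inE eqxx.
have keptA : kept A \subset A by apply/subsetP => x; rewrite inE => /andP[].
rewrite inE (negPf eH) /= (contra (subsetP keptA e)) //=.
apply/cleanP => C mC; apply/negP => CH.
case: (boolP (e \in C)) => eC; last first.
  move/cleanP: (newH_clean A) => /(_ C mC) /negP; apply.
  apply/subsetP => x xC; have := subsetP CH x xC; rewrite in_setU1 => /orP[/eqP xe|//].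
  by rewrite -xe xC in eC.
have CA : C \subset e |: (H :|: A).
  by apply: subset_trans CH _; rewrite setUS // setUS.
case: (new_bad we mC eC CA) => [[g gK /andP[_ gA]]|[C3 sA]].
  by rewrite (disjointFr dis gK) in gA.
by move/negP: mult; apply; apply/existsP; exists C; rewrite mC eC C3.
Qed.

Lemma new3_pair A (q : {set T}) : #|q| = 2%N -> \sum_(e | q \subset v e) new3 A e <= 1.
Proof.
move=> q2; apply: (@le_trans _ _ (\sum_(e | q \subset v e) new1 A e * (Num.max 1 (load A q))^-1)).
  apply: ler_sum => e qe; rewrite /new3 (bigD1 q) ?q2 ?qe //= mulrA.
  apply: (@le_trans _ _ (new2 A e * (Num.max 1 (load A q))^-1)).
    have [m0 _] := andP (max1_inv A q).
    apply: ler_piMr; first by rewrite mulr_ge0 ?new2_ge0.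
    by apply: prodr_ile1 => r _; apply: max1_inv.
  by rewrite ler_wpM2r ?new2_le //; case/andP: (max1_inv A q).
rewrite -mulr_suml -/(load A q) ler_pdivrMr ?max1_gt0 // mul1r.
by rewrite le_max lexx orbT.
Qed.

Lemma new_state A : state v d (2 * om) (newH A) (new3 A).
Proof.
split; [exact: newH_clean | exact: new3_ge0 | | exact: new3_avail | exact: new3_pair].
move=> e; apply: le_trans (new3_le1 A e) _; apply: le_trans (new1_le A e) _.
by rewrite ler_pM2l ?(state_om st) // ltr0n.
Qed.

(** * Expected weight of edge sets after one step *)

Lemma Ex_new1 e : Ex p (fun A => new1 A e) = (1 - dl) * w e.
Proof.
rewrite ExZ Ex_disj // -/(surv e) /boost.
case: (eqVneq (w e) 0) => [->|we]; first by rewrite !(mul0r, mulr0).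
by rewrite -mulrA divfK 1?mulrC // gt_eqF ?surv_gt0.
Qed.

Lemma wt_new_le A S : wt (newH A) (new3 A) S <= \prod_(e in S :\: H) ((e \in A)%:R + new1 A e).
Proof.
rewrite /wt (big_setID H) /= big1 ?mul1r; last first.
  move=> e /setIP[_ eH]; rewrite /rho inE eH /=.
  have -> : new3 A e = 0; last by rewrite addr0.
  by rewrite /new3 /new2 /new1 (wH st eH) !mul0r.
apply: ler_prod => e /setDP[_ eH]; rewrite addr_ge0 ?ler0n ?new3_ge0 //=.
rewrite /rho lerD ?new3_le1 // ler_nat inE (negPf eH) /= inE.
by case: (e \in A); rewrite ?leq_b1.
Qed.

Lemma prod_split (a b : E -> R) U :
  \prod_(e in U) (a e + b e) =
  \sum_(B : {set E} | B \subset U) (\prod_(e in B) a e) * \prod_(e in U :\: B) b e.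
Proof.
transitivity (\prod_e ((if e \in U then a e else 0) + (if e \in U then b e else 1))).
  by rewrite big_mkcond; apply: eq_bigr => e _; case: ifP; rewrite ?add0r.
rewrite bigA_distr [RHS]big_mkcond; apply: eq_bigr => B _; case: ifP => [BU|/negbT/subsetPn[e eB eU]].
  rewrite !(big_mkcond (fun e => e \in _)) -big_split; apply: eq_bigr => e _ /=.
  rewrite inE; case: (boolP (e \in B)) => eB /=; rewrite ?mulr1 ?mul1r //.
  by rewrite (subsetP BU).
by rewrite (bigD1 e) //= eB (negPf eU) mul0r.
Qed.

Definition jointk U : R := \sum_(x : E * E | [&& x.1 \in U, x.2 \in U & x.1 != x.2])
       \sum_(g in Kl x.1 :&: Kl x.2) w g.

(** [avoid_bigcup] reads [a * (1 - x) <= P]. Here [a <= 1], and every survival probability is at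
    least 1/2, so [a * x <= 2 ^ #|U| * P * x]. *)
Lemma avoid_cup U : (forall e, e \in U -> w e != 0) ->
  avoid p (\bigcup_(e in U) Kl e) <= (\prod_(e in U) surv e) * (1 + 2 ^+ #|U| * (dl * jointk U)).
Proof.
move=> wU; have := avoid_bigcup p01 (fun e => Kl e) (enum_uniq (mem U)).
rewrite !big_enum /=.
have -> : \sum_(i in U) \sum_(j <- enum U | i != j) \sum_(e in Kl i :&: Kl j) p e = dl * jointk U.
  under eq_bigr => i _ do rewrite big_enum_cond /=.
  rewrite pair_big_dep /= /jointk mulr_sumr; apply: eq_bigr => x _.
  by rewrite mulr_sumr.
set a := avoid _ _; set P := \prod_(e in U) _; set x := dl * _ => h.
have a1 : a <= 1 by apply: avoid_le1.
have x0 : 0 <= x.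
  by rewrite mulr_ge0 // sumr_ge0 // => y _; apply: sumr_ge0.
have P2 : 1 <= 2 ^+ #|U| * P.
  rewrite -prodr_const -big_split /=; elim/big_ind: _ => //.
    by move=> y z y1 z1; rewrite mulr_ege1.
  by move=> e eU; have := surv_ge (wU e eU); rewrite -/(surv e); lra.
have := ler_wpM2r x0 (le_trans a1 P2); lra.
Qed.

(** Up to common killers the weight of a set is a martingale: an edge is chosen with probability
    [dl * w e] and otherwise keeps mean weight [(1 - dl) * w e], which add up to [w e]. Both sides
    are expanded over the set [B] of edges chosen in this step. *)
Lemma Ex_wt S : (#|S| <= 11)%N ->
  Ex p (fun A => wt (newH A) (new3 A) S) <= wt H w S * (1 + 2 ^+ 11 * (dl * jointk (S :\: H))).
Proof.
move=> S11; set U := S :\: H.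
have jge0 (V : {set E}) : 0 <= jointk V by rewrite sumr_ge0 // => y _; apply: sumr_ge0.
apply: (@le_trans _ _ (Ex p (fun A => \prod_(e in U) ((e \in A)%:R + new1 A e)))).
  by apply: Ex_le => // A; apply: wt_new_le.
have -> : Ex p (fun A => \prod_(e in U) ((e \in A)%:R + new1 A e)) =
  Ex p (fun A => \sum_(B : {set E} | B \subset U) (\prod_(e in B) (e \in A)%:R) * \prod_(e in U :\: B) new1 A e).
  by apply: eq_Ex => A; rewrite prod_split.
rewrite Ex_sum (wtE st) -/U.
have -> : \prod_(e in U) w e = \prod_(e in U) (dl * w e + (1 - dl) * w e).
  by apply: eq_bigr => e _; ring.
rewrite prod_split mulr_suml; apply: ler_sum => B BU; set M := U :\: B.
have -> : Ex p (fun A => (\prod_(e in B) (e \in A)%:R) * \prod_(e in M) new1 A e) =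
   (\prod_(e in M) (w e * boost e)) *
   Ex p (fun A => ((B \subset A) && [disjoint \bigcup_(e in M) Kl e & A])%:R).
  rewrite -ExZ; apply: eq_Ex => A; rewrite /new1 big_split /= mulrCA; congr (_ * _).
  rewrite -mulnb natrM; congr (_ * _).
    case: (boolP (B \subset A)) => [BA|/subsetPn[e eB eA]].
      by rewrite big1 // => e eB; rewrite (subsetP BA).
    by rewrite (bigD1 e) //= (negPf eA) mul0r.
  case: (boolP [disjoint _ & _]) => [dis|/pred0Pn[e /andP[/= /bigcupP[f fM ef] eA]]].
    rewrite big1 // => e eM; rewrite (_ : [disjoint _ & _]) //.
    by apply: disjointWl dis; apply: bigcup_sup eM.
  rewrite (bigD1 f) //= (_ : [disjoint _ & _] = false) ?mul0r //.
  by apply/negP => /disjointFr /(_ ef); rewrite eA.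
have c0 : 0 <= \prod_(e in M) (w e * boost e).
  by apply: prodr_ge0 => e _; rewrite mulr_ge0 ?boost_ge0.
have b0 : 0 <= \prod_(e in B) p e by apply: prodr_ge0.
(* Survival is bounded below only for edges of nonzero weight; if one vanishes, so does the whole
   term. *)
case: (boolP [forall (e | e \in M), w e != 0]) => [/forallP wM|]; last first.
  rewrite negb_forall => /existsP[e]; rewrite negb_imply negbK => /andP[eM /eqP we].
  rewrite (bigD1 e) //= we !mul0r !mulr_ge0 //.
  - by apply: prodr_ge0 => f _; rewrite mulr_ge0.
  - by rewrite addr_ge0 // !mulr_ge0 // exprn_ge0.
have {}wM e : e \in M -> w e != 0 by move=> eM; have := wM e; rewrite eM.
apply: (@le_trans _ _ ((\prod_(e in M) (w e * boost e)) *
    ((\prod_(e in B) p e) * avoid p (\bigcup_(e in M) Kl e)))).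
  rewrite ler_wpM2l // Ex_in_out //; case: ifP => // _.
  by rewrite mulr_ge0 // avoid_ge0.
have av := avoid_cup wM.
apply: (@le_trans _ _ ((\prod_(e in M) (w e * boost e)) * ((\prod_(e in B) p e) *
   ((\prod_(e in M) surv e) * (1 + 2 ^+ #|M| * (dl * jointk M)))))).
  by rewrite ler_wpM2l // ler_wpM2l.
have -> : \prod_(e in M) (w e * boost e) * (\prod_(e in B) p e *
   (\prod_(e in M) surv e * (1 + 2 ^+ #|M| * (dl * jointk M)))) =
   (\prod_(e in B) p e) * (\prod_(e in M) ((1 - dl) * w e)) * (1 + 2 ^+ #|M| * (dl * jointk M)).
  rewrite (_ : \prod_(e in M) ((1 - dl) * w e) =
     \prod_(e in M) (w e * boost e) * \prod_(e in M) surv e); first by ring.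
  rewrite -big_split; apply: eq_bigr => e eM /=; rewrite /boost.
  by rewrite -mulrA divfK 1?mulrC // gt_eqF ?surv_gt0 ?wM.
rewrite ler_wpM2l ?mulr_ge0 //; first by apply: prodr_ge0 => e _; rewrite mulr_ge0.
rewrite lerD2l ler_pM //.
- by rewrite exprn_ge0.
- by rewrite mulr_ge0.
- rewrite ler_weXn2l ?ler1n //; apply: leq_trans S11; apply: subset_leq_card.
  by apply: subset_trans (subsetDl _ _) (subsetDl _ _).
rewrite ler_wpM2l // /jointk [leRHS](bigID (fun x => (x.1 \in M) && (x.2 \in M))) /=.
apply: ler_wpDr; first by apply: sumr_ge0 => x _; apply: sumr_ge0.
rewrite le_eqVlt; apply/orP; left; apply/eqP; apply: eq_bigl => x.
have MU y : y \in M -> y \in U by rewrite inE => /andP[].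
by case: (boolP (x.1 \in M)) => [/MU ->|_]; case: (boolP (x.2 \in M)) => [/MU ->|_]; rewrite ?andbF ?andbT.
Qed.

Lemma Ex_Msum : Ex p (fun A => Msum v d (newH A) (new3 A)) <=
  Msum v d H w + 2 ^+ 11 * dl * (Ckill%:R * Esum v d H w + (11 ^ 3)%N%:R * om * Msum v d H w).
Proof.
rewrite /Msum Ex_sum.
apply: (@le_trans _ _ (\sum_(S | mclass v d S) wt H w S * (1 + 2 ^+ 11 * (dl * jointk (S :\: H))))).
  by apply: ler_sum => S /and3P[_ S11 _]; apply: Ex_wt.
rewrite (eq_bigr (fun S => wt H w S + 2 ^+ 11 * dl * (wt H w S * jointk (S :\: H)))); last first.
  by move=> S _; ring.
rewrite big_split /= lerD2l -mulr_sumr ler_wpM2l ?mulr_ge0 ?exprn_ge0 //.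
exact: (kill_sum vcard st om01).
Qed.

(** Correlations are ignored: a weight at most doubles, and the chance of being chosen adds at most
    itself once more, hence 3 per edge. *)
Lemma Ex_wt_crude S : (#|S| <= 23)%N ->
  Ex p (fun A => wt (newH A) (new3 A) S) <= 3 ^+ 23 * wt H w S.
Proof.
move=> S23; pose c e : R := (e \in H)%:R + 2 * w e.
have c0 e : 0 <= c e by rewrite addr_ge0 ?ler0n // mulr_ge0.
apply: (@le_trans _ _ (Ex p (fun A => \prod_e (if e \in A then (if e \in S then c e + 1 else 1)
     else (if e \in S then c e else 1))))).
  apply: Ex_le => // A; rewrite /wt big_mkcond; apply: ler_prod => e _ /=.
  case: (boolP (e \in S)) => eS; last by case: ifP; rewrite ler01 lexx.
  apply/andP; split; first by rewrite addr_ge0 ?ler0n ?new3_ge0.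
  have h : rho (newH A) (new3 A) e <= c e + (e \in A)%:R.
    have n3 := le_trans (new3_le1 A e) (new1_le A e).
    rewrite /rho /c addrAC lerD // -natrD ler_nat !inE.
    by case: (e \in H); case: (e \in A); rewrite //= ?leq_b1 //; case: [exists _, _].
  by move: h; case: (e \in A); rewrite ?addr0.
rewrite Ex_prod.
apply: (@le_trans _ _ (\prod_(e in S) (3 * rho H w e))).
  rewrite [leRHS]big_mkcond; apply: ler_prod => e _.
  have := p01 e; case: ifP => eS /andP[pe0 pe1]; last by apply/andP; split; lra.
  have -> : p e * (c e + 1) + (1 - p e) * c e = c e + p e by ring.
  rewrite addr_ge0 //= /c /rho /p; have : dl * w e <= w e by rewrite ler_piMl.
  by have : 0 <= (e \in H)%:R :> R; [rewrite ler0n | lra].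
rewrite big_split /= prodr_const ler_wpM2r ?(wt_ge0 st) // ler_weXn2l ?ler1n //.
Qed.

(** * Second moment of the weight through a pair *)

Let Lk (q : {set T}) e : {set E} := Kl e :\: [set g | q \subset v g].

(** Bounds the load from above by forgetting the killers that contain [q]. They hit all the weight
    through [q] at once, which would spoil the variance, but they can only lower the load. *)
Let upload A (q : {set T}) : R :=
  \sum_(e | q \subset v e) w e * boost e * [disjoint Lk q e & A]%:R.

Let mean (q : {set T}) : R := \sum_(e | q \subset v e) w e * boost e * avoid p (Lk q e).

Let coef_ge0 e : 0 <= w e * boost e.
Proof. by rewrite mulr_ge0 ?boost_ge0. Qed.

Lemma load_upload A q : load A q <= upload A q.
Proof.
apply: ler_sum => e _; rewrite /new1 ler_wpM2l // ler_nat.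
case: (boolP [disjoint Kl e & A]) => // dis.
by rewrite (disjointWl (subsetDl _ _) dis).
Qed.

(* The factor [1 - dl] in the boost pays for the killers containing the pair [q]. *)
Lemma mean_le1 q : #|q| = 2%N -> mean q <= 1.
Proof.
move=> q2; apply: le_trans (state_pair st q2); apply: ler_sum => e _.
case: (eqVneq (w e) 0) => [->|we]; first by rewrite !mul0r.
rewrite -mulrA ler_piMr // /boost mulrAC ler_pdivrMr ?surv_gt0 // mul1r.
have -> : surv e = avoid p (Kl e :&: [set g | q \subset v g]) * avoid p (Lk q e).
  by rewrite /surv /avoid (big_setID [set g | q \subset v g]).
rewrite ler_wpM2r ?avoid_ge0 //; apply: le_trans (avoid_ge p01 _).
rewrite lerD2l lerN2 -mulr_sumr ler_piMr //; apply: le_trans (state_pair st q2).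
rewrite [leRHS](bigID (mem (Kl e))) /=; apply: ler_wpDr; first exact: sumr_ge0.
by rewrite le_eqVlt; apply/orP; left; apply/eqP; apply: eq_bigl => g; rewrite in_setI inE [in RHS]andbC.
Qed.

Lemma Ex_var q : Ex p (fun A => (upload A q - mean q) ^+ 2) <=
  4 * om * (\sum_(e | q \subset v e) w e) +
  4 * dl * (\sum_(x : E * E | [&& q \subset v x.1, q \subset v x.2 & x.1 != x.2]) w x.1 * w x.2 *
       \sum_(g in Kl x.1 :&: Kl x.2 | ~~ (q \subset v g)) w g).
Proof.
pose c e := w e * boost e; pose a e := avoid p (Lk q e).
have Eup : Ex p (fun A => upload A q) = mean q.
  by rewrite Ex_sum; apply: eq_bigr => e _; rewrite ExZ Ex_disj.
have -> : Ex p (fun A => (upload A q - mean q) ^+ 2) =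
    \sum_(x : E * E | (q \subset v x.1) && (q \subset v x.2))
      c x.1 * c x.2 * (avoid p (Lk q x.1 :|: Lk q x.2) - a x.1 * a x.2).
  have -> : Ex p (fun A => (upload A q - mean q) ^+ 2) = Ex p (fun A => upload A q ^+ 2) - mean q ^+ 2.
    rewrite (@eq_Ex _ _ _ _ (fun A => (upload A q ^+ 2 + mean q ^+ 2) - 2 * mean q * upload A q)); last first.
      by move=> A; ring.
    by rewrite ExB ExD Ex_const ExZ Eup; ring.
  have -> : Ex p (fun A => upload A q ^+ 2) =
     \sum_(x : E * E | (q \subset v x.1) && (q \subset v x.2)) c x.1 * c x.2 * avoid p (Lk q x.1 :|: Lk q x.2).
    rewrite (@eq_Ex _ _ _ _ (fun A => \sum_(x : E * E | (q \subset v x.1) && (q \subset v x.2))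
       c x.1 * c x.2 * [disjoint Lk q x.1 :|: Lk q x.2 & A]%:R)).
      by rewrite Ex_sum; apply: eq_bigr => x _; rewrite ExZ Ex_disj.
    move=> A; rewrite expr2 mulr_suml -(pair_big (fun e => q \subset v e) (fun e => q \subset v e)
      (fun e f => c e * c f * [disjoint Lk q e :|: Lk q f & A]%:R)) /=.
    apply: eq_bigr => e _; rewrite mulr_sumr; apply: eq_bigr => f _.
    by rewrite mulrACA disjointsU natrM_and.
  have -> : mean q ^+ 2 = \sum_(x : E * E | (q \subset v x.1) && (q \subset v x.2)) c x.1 * c x.2 * (a x.1 * a x.2).
    rewrite expr2 mulr_suml -(pair_big (fun e => q \subset v e) (fun e => q \subset v e)
      (fun e f => c e * c f * (a e * a f))) /=.
    by apply: eq_bigr => e _; rewrite mulr_sumr; apply: eq_bigr => f _; rewrite mulrACA.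
  by rewrite -sumrB; apply: eq_bigr => x _; rewrite mulrBr.
(* Diagonal terms are at most [(2 * w e) ^ 2 <= 4 * om * w e]. Off the diagonal the covariance is at
   most the probability that a common killer is chosen. *)
rewrite (bigID (fun x => x.1 == x.2)) /=; apply: lerD.
  rewrite mulr_sumr; apply: (@le_trans _ _ (\sum_(x : E * E | [&& q \subset v x.1 & x.1 == x.2]) 4 * om * w x.1)).
    rewrite [leRHS](eq_bigl (fun x => (q \subset v x.1) && (q \subset v x.2) && (x.1 == x.2))); last first.
      by move=> [e f] /=; case: eqP => [->|]; rewrite ?andbF // !andbT andbb.
    apply: ler_sum => -[e f] /= /andP[_ /eqP <-].
    have b1 : avoid p (Lk q e :|: Lk q e) - a e * a e <= 1.
      have := avoid_le1 p01 (Lk q e :|: Lk q e); have : 0 <= a e * a e by rewrite mulr_ge0 ?avoid_ge0.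
      by lra.
    apply: (@le_trans _ _ (c e * c e)).
      by rewrite ler_piMr // mulr_ge0 ?coef_ge0.
    have h := wboost_le e; have := state_om st e; have := coef_ge0 e; rewrite -/(c e).
    move=> c0 wom; have := ler_pM c0 c0 h h; have := ler_wpM2l (w0 e) wom; lra.
  rewrite -(pair_big_dep (fun e => q \subset v e) (fun e f => e == f) (fun e f => 4 * om * w e)) /=.
  by apply: ler_sum => e _; rewrite big_pred1_eq_sym.
rewrite mulr_sumr [leRHS](eq_bigl (fun x => (q \subset v x.1) && (q \subset v x.2) && (x.1 != x.2))); last first.
  by move=> x; rewrite andbA.
apply: ler_sum => -[e f] /= /andP[/andP[qe qf] ef].
have cc : c e * c f <= 4 * (w e * w f).
  by have := ler_pM (coef_ge0 e) (coef_ge0 f) (wboost_le e) (wboost_le f); rewrite /c; lra.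
have dif : avoid p (Lk q e :|: Lk q f) - a e * a f <= dl * (\sum_(g in Kl e :&: Kl f | ~~ (q \subset v g)) w g).
  rewrite /a -(avoidUI p); apply: (@le_trans _ _ (1 - avoid p (Lk q e :&: Lk q f))).
    have := avoid_le1 p01 (Lk q e :|: Lk q f); have := avoid_le1 p01 (Lk q e :&: Lk q f).
    set y := avoid _ _; set z := avoid _ _ => y1 z1.
    have : 0 <= (1 - y) * (1 - z) by rewrite mulr_ge0 // subr_ge0.
    by lra.
  have := avoid_ge p01 (Lk q e :&: Lk q f); rewrite -mulr_sumr.
  rewrite (eq_bigl (fun g => (g \in Kl e :&: Kl f) && ~~ (q \subset v g))); first by lra.
  by move=> g; rewrite !inE; case: (q \subset v g) => /=; rewrite ?andbF ?andbT.
have dif0 : 0 <= avoid p (Lk q e :|: Lk q f) - a e * a f.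
  rewrite /a -(avoidUI p) subr_ge0 ler_piMr ?avoid_ge0 ?avoid_le1 //.
have := ler_pM (mulr_ge0 (coef_ge0 e) (coef_ge0 f)) dif0 cc dif.
by rewrite -/(c e) -/(c f) => /le_trans; apply; rewrite le_eqVlt; apply/orP; left; apply/eqP; ring.
Qed.

Let Cp : R := (Ckill_of (23 * d.+2))%:R.
Let N2 : R := (pairs T)%:R.
Let ME : R := Msum v d H w + Esum v d H w.

Definition excess A : R := \sum_(q : {set T} | #|q| == 2%N) Num.max 0 (load A q - 1).

(** An additive Chebyshev bound: as [mean <= 1], the excess at [q] is at most
    [eta + (upload - mean) ^ 2 / eta]. *)
Lemma Ex_excess (eta : R) : 0 < eta -> Ex p excess <=
  eta * N2 + (4 * om * N2 + 4 * dl * (Cp * Esum v d H w)) / eta.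
Proof.
move=> eta0; have N2E : N2 = \sum_(q : {set T} | #|q| == 2%N) 1.
  by rewrite sumr_const /N2 /pairs -card_draws cardsE.
have om0 : 0 <= om by case/andP: om01.
apply: (@le_trans _ _ (\sum_(q : {set T} | #|q| == 2%N)
   (eta + Ex p (fun A => (upload A q - mean q) ^+ 2) / eta))).
  rewrite /excess Ex_sum; apply: ler_sum => q /eqP q2.
  rewrite -[X in X + _](Ex_const p) [_ / eta]mulrC -ExZ -ExD; apply: Ex_le => // A.
  have := load_upload A q; have := mean_le1 q2.
  move: (load A q) (upload A q) (mean q) => l u m m1 lu.
  have sq : u - m <= eta + eta^-1 * (u - m) ^+ 2.
    rewrite -(ler_pM2l eta0) [leRHS]mulrDr mulVKf ?gt_eqF //.
    by have := sqr_ge0 (u - m - eta); have := sqr_ge0 (u - m); have := sqr_ge0 eta; lra.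
  rewrite ge_max; apply/andP; split; last by lra.
  by rewrite addr_ge0 ?(ltW eta0) // mulr_ge0 ?sqr_ge0 // invr_ge0 ltW.
rewrite big_split /= lerD //.
  by rewrite N2E mulr_sumr; apply: ler_sum => q _; rewrite mulr1.
rewrite -mulr_suml ler_wpM2r ?invr_ge0 ?(ltW eta0) //.
apply: le_trans (ler_sum _ _) _; first by move=> q _; apply: Ex_var.
rewrite big_split /= -!mulr_sumr lerD //.
  rewrite ler_wpM2l ?mulr_ge0 // N2E; apply: ler_sum => q /eqP q2; exact: (state_pair st q2).
rewrite ler_wpM2l ?mulr_ge0 //; exact: (pair_kill_sum vcard st).
Qed.

(** The product inequality spreads the loss of [e] over its pairs; for one pair,
    [load * (1 - 1 / max 1 load)] is the excess exactly. *)
Lemma new2_new3 A : \sum_e (new2 A e - new3 A e) <= excess A.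
Proof.
have bnd e : new2 A e - new3 A e <=
    \sum_(q : {set T} | (#|q| == 2%N) && (q \subset v e)) new1 A e * (1 - (Num.max 1 (load A q))^-1).
  rewrite -mulr_sumr; apply: (@le_trans _ _ (new2 A e * (\sum_(q : {set T} | (#|q| == 2%N) && (q \subset v e))
      (1 - (Num.max 1 (load A q))^-1)))).
    rewrite /new3; have := @prod_ge_1B _ _ (fun q : {set T} => (#|q| == 2%N) && (q \subset v e))
      (fun q => (Num.max 1 (load A q))^-1) (fun q _ => max1_inv A q).
    move: (\sum_(_ | _) _) (\prod_(_ | _) _) => x y h.
    by have := ler_wpM2l (new2_ge0 A e) h; lra.
  rewrite ler_wpM2r ?new2_le //; apply: sumr_ge0 => q _.
  by have /andP[_] := max1_inv A q; rewrite subr_ge0.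
apply: le_trans (ler_sum _ (fun e _ => bnd e)) _.
rewrite (exchange_big_dep (fun q : {set T} => #|q| == 2%N)) /=; last by move=> e q _ /andP[].
apply: ler_sum => q /eqP q2.
rewrite (eq_bigl (fun e => q \subset v e)) => [|e]; last by rewrite q2 eqxx.
rewrite -mulr_suml -/(load A q); have l0 := load_ge0 A q.
case: (leP 1 (load A q)) => l1.
  have lp : 0 < load A q by apply: lt_le_trans l1.
  by rewrite mulrBr mulr1 divff ?gt_eqF // le_max lexx orbT.
by rewrite invr1 subrr mulr0 le_max lexx.
Qed.

(** Two missing edges besides [e] give [dl ^ 2]; the 6 counts the choices of [e] in [C]. *)
Lemma big_new_sum :
  \sum_e \sum_(C | [&& minbad v d C, e \in C & (3 <= #|C :\: H|)%N])
     w e * \prod_(f in (C :\: H) :\ e) p f <= 6 * dl ^+ 2 * ME.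
Proof.
rewrite (exchange_big_dep (fun C => minbad v d C && (3 <= #|C|)%N)) /=; last first.
  move=> e C _ /and3P[-> _ h]; apply: leq_trans h _; apply: subset_leq_card; exact: subsetDl.
apply: (@le_trans _ _ (\sum_(C | minbad v d C && (3 <= #|C|)%N) 6 * dl ^+ 2 * wt H w C)); last first.
  by rewrite -mulr_sumr ler_wpM2l ?mulr_ge0 ?exprn_ge0 //; exact: (minbad3_sum vcard st).
apply: ler_sum => C /andP[mC C3].
have one e : [&& minbad v d C, e \in C & (3 <= #|C :\: H|)%N] ->
    w e * (\prod_(f in (C :\: H) :\ e) p f) <= dl ^+ 2 * wt H w C.
  case/and3P => _ eC C3'; case: (boolP (e \in H)) => eH.
    by rewrite (wH st eH) mul0r mulr_ge0 ?exprn_ge0 ?(wt_ge0 st).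
  have eCH : e \in C :\: H by rewrite inE eH.
  rewrite (wtE st) [X in _ <= _ * X](big_setD1 e) //= /p big_split /= prodr_const.
  rewrite mulrCA ler_wpM2r ?mulr_ge0 ?prodr_ge0 //.
  by rewrite ler_wiXn2l //; move: (cardsD1 e (C :\: H)) C3'; rewrite eCH; clear; lia.
apply: le_trans (ler_sum _ one) _; rewrite sumr_const -mulrA mulr_natl.
rewrite ler_wpMn2l ?mulr_ge0 ?exprn_ge0 ?(wt_ge0 st) //.
apply: leq_trans (minbad_le6 mC); apply: subset_leq_card.
by apply/subsetP => e; rewrite unfold_in => /and3P[].
Qed.

Lemma Ex_new3 (eta : R) : 0 < eta ->
  (1 - dl) * (\sum_e w e) - 12 * dl ^+ 2 * ME
   - (eta * N2 + (4 * om * N2 + 4 * dl * (Cp * Esum v d H w)) / eta)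
  <= Ex p (fun A => \sum_e new3 A e).
Proof.
move=> eta0; pose Lm e A : R := \sum_(C | [&& minbad v d C, e \in C & (3 <= #|C :\: H|)%N])
   ((C :\: H) :\ e \subset A)%:R.
apply: (@le_trans _ _ (Ex p (fun A => \sum_e (new1 A e - 2 * w e * Lm e A) - excess A))).
  rewrite ExB Ex_sum; have := Ex_excess eta0.
  have -> : \sum_e Ex p (fun A => new1 A e - 2 * w e * Lm e A) =
     (1 - dl) * (\sum_e w e) - 2 * \sum_e \sum_(C | [&& minbad v d C, e \in C & (3 <= #|C :\: H|)%N])
     w e * \prod_(f in (C :\: H) :\ e) p f.
    rewrite !mulr_sumr -sumrB; apply: eq_bigr => e _.
    rewrite ExB Ex_new1 ExZ /Lm Ex_sum -mulrA; congr (_ - 2 * _).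
    by rewrite mulr_sumr; apply: eq_bigr => C _; rewrite Ex_sub.
  by have := big_new_sum; lra.
apply: Ex_le => // A; have := new2_new3 A; rewrite sumrB.
suff : \sum_e (new1 A e - 2 * w e * Lm e A) <= \sum_e new2 A e by lra.
apply: ler_sum => e _; rewrite /new2; have n0 := new1_ge0 A e; have n1 := new1_le A e.
have L0 : 0 <= Lm e A by apply: sumr_ge0 => C _; apply: ler0n.
case: (boolP (multi A e)) => [/existsP[C /and4P[mC eC C3 sA]]|_]; last first.
  rewrite mulr1; have : 0 <= w e * Lm e A by apply: mulr_ge0.
  by lra.
have L1 : 1 <= Lm e A.
  rewrite /Lm (bigD1 C) ?mC ?eC //= sA lerDl; apply: sumr_ge0 => D _; apply: ler0n.
by rewrite mulr0; have := ler_wpM2l (w0 e) L1; lra.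
Qed.

Lemma wkill_sum : \sum_e w e * (\sum_(g in Kl e) w g) <=
  'C(d.+2, 2)%:R * N2 + 23%:R ^+ 2 * ME.
Proof.
apply: (@le_trans _ _ (\sum_e (w e * 'C(d.+2, 2)%:R + w e * \sum_(g in killers3 v d H e) w g))).
  by apply: ler_sum => e _; rewrite -mulrDr ler_wpM2l // (killers_weight vcard st).
rewrite big_split /= -mulr_suml mulrC lerD //.
  by rewrite ler_wpM2l ?ler0n //; exact: (total_sum vcard st).
exact: (killers3_sum1 vcard st).
Qed.

Lemma Ex_card : #|H|%:R + dl * (\sum_e w e)
   - dl ^+ 2 * ('C(d.+2, 2)%:R * N2 + (23%:R ^+ 2 + 6) * ME)
  <= Ex p (fun A => #|newH A|%:R).
Proof.
(* A chosen edge is lost only if a killer is chosen with it ([Lk2]) or a larger obstruction is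
   chosen entirely ([Lm]); subtracting both counts keeps the estimate linear. *)
pose Lm e A : R := \sum_(C | [&& minbad v d C, e \in C & (3 <= #|C :\: H|)%N]) (C :\: H \subset A)%:R.
pose Lk2 e A : R := \sum_(g in Kl e :\ e) ([set e; g] \subset A)%:R.
apply: (@le_trans _ _ (Ex p (fun A => #|H|%:R + \sum_(e | w e != 0) (([set e] \subset A)%:R - Lk2 e A - Lm e A)))).
  rewrite ExD Ex_const -addrA lerD2l Ex_sum.
  have ME0 : 0 <= ME by rewrite addr_ge0 // sumr_ge0 // => S _; apply: (wt_ge0 st).
  have step e : w e != 0 -> dl * w e - dl ^+ 2 * (w e * \sum_(g in Kl e) w g)
      - dl * (\sum_(C | [&& minbad v d C, e \in C & (3 <= #|C :\: H|)%N])
         w e * \prod_(f in (C :\: H) :\ e) p f) <=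
      Ex p (fun A => ([set e] \subset A)%:R - Lk2 e A - Lm e A).
    move=> we; have /andP[eH _] := state_avail st we.
    rewrite !ExB Ex_sub // big_set1 !Ex_sum lerB // ?lerB //.
      rewrite mulrA mulr_sumr [leRHS](big_setID [set e]) /=; apply: ler_wpDl.
        by apply: sumr_ge0 => g _; rewrite !mulr_ge0 ?exprn_ge0.
      apply: ler_sum => g; rewrite !inE => /andP[ge _].
      rewrite Ex_sub // big_setU1 ?inE 1?eq_sym // big_set1 /p.
      by rewrite le_eqVlt; apply/orP; left; apply/eqP; rewrite /=; ring.
    rewrite mulr_sumr; apply: ler_sum => C /and3P[mC eC _].
    by rewrite Ex_sub // (big_setD1 e) ?inE ?eH //= mulrA.
  apply: le_trans (ler_sum _ step).
  have z e : ~~ (w e != 0) -> 0 = dl * w e - dl ^+ 2 * (w e * \sum_(g in Kl e) w g)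
      - dl * (\sum_(C | [&& minbad v d C, e \in C & (3 <= #|C :\: H|)%N])
         w e * \prod_(f in (C :\: H) :\ e) p f).
    rewrite negbK => /eqP ->; rewrite !(mul0r, mulr0) [X in dl * X]big1; first by rewrite mulr0 !subr0.
    by move=> C _; rewrite mul0r.
  pose F e := dl * w e - dl ^+ 2 * (w e * \sum_(g in Kl e) w g) - dl * (\sum_(C |
    [&& minbad v d C, e \in C & (3 <= #|C :\: H|)%N]) w e * \prod_(f in (C :\: H) :\ e) p f).
  have -> : \sum_(e | w e != 0) F e = \sum_e F e.
    by rewrite [RHS](bigID (fun e => w e != 0)) /= [X in _ + X]big1 ?addr0 // => e /z; rewrite -/(F e) => <-.
  rewrite /F.
  rewrite !sumrB -!mulr_sumr.
  have := ler_wpM2l dl0 big_new_sum; have := ler_wpM2l (exprn_ge0 2 dl0) wkill_sum.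
  have : dl * (6 * dl ^+ 2 * ME) <= 6 * dl ^+ 2 * ME.
    by rewrite ler_piMl // !mulr_ge0 ?exprn_ge0.
  lra.
apply: Ex_le => // A.
have -> : #|newH A|%:R = #|H|%:R + \sum_e (e \in kept A)%:R :> R.
  have -> : #|newH A| = (#|H| + #|kept A|)%N.
    rewrite /newH cardsU (_ : H :&: kept A = set0) ?cards0 ?subn0 //.
    by apply/setP => e; rewrite !inE; case: (e \in H); rewrite ?andbF.
  by rewrite natrD -[#|kept A|]sum1_card natr_sum big_mkcond; congr (_ + _); apply: eq_bigr => e _; case: (e \in kept A).
rewrite lerD2l [leRHS](bigID (fun e => w e != 0)) /=; apply: ler_wpDr.
  by apply: sumr_ge0 => e _; apply: ler0n.
apply: ler_sum => e we.
have L0 : 0 <= Lm e A by apply: sumr_ge0 => C _; apply: ler0n.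
have K0 : 0 <= Lk2 e A by apply: sumr_ge0 => g _; apply: ler0n.
rewrite sub1set; case: (boolP (e \in A)) => eA; last first.
  by rewrite mulr0n; have : 0 <= (e \in kept A)%:R :> R; [apply: ler0n|lra].
rewrite mulr1n; case: (boolP (e \in kept A)) => ek; first by rewrite mulr1n; lra.
rewrite mulr0n.
have /andP[eH _] := state_avail st we.
move: ek; rewrite inE eA eH /= negbK => /existsP[C /and3P[mC eC CA]].
have CA' : C \subset e |: (H :|: A) by apply: subset_trans CA (subsetUr _ _).
case: (new_bad we mC eC CA') => [[g gK /andP[ge gA]]|[C3 sA]].
  suff : 1 <= Lk2 e A by lra.
  rewrite /Lk2 (bigD1 g) ?inE ?ge ?gK //=; last by move: gK; rewrite inE.
  rewrite subUset !sub1set eA gA lerDl; apply: sumr_ge0 => h _; apply: ler0n.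
suff : 1 <= Lm e A by lra.
rewrite /Lm (bigD1 C) ?mC ?eC //= (_ : C :\: H \subset A) ?lerDl.
  by apply: sumr_ge0 => D _; apply: ler0n.
by apply/subsetP => x; rewrite inE => /andP[xH xC]; have := subsetP CA x xC; rewrite inE (negPf xH).
Qed.

End Step.

(** * Iteration *)

Section Iterate.

Variables (R : realFieldType) (T E : finType) (v : E -> {set T}) (d : nat).
Hypothesis vcard : forall e, #|v e| = d.+2.
Implicit Types (H : {set E}) (w : E -> R) (om dl eta a b beta : R).

Let k2 : R := 'C(d.+2, 2)%:R.
Let N2 : R := (pairs T)%:R.
Let Cp : R := (Ckill_of (23 * d.+2))%:R.

(** Collects the [dl ^ 2] losses of a tame step: the binomial, [23 ^ 2] and 6 from [Ex_card], and 12
    from [Ex_new3]. [Closs] adds the weight discarded in [step]. *)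
Definition Closs0 : R := 'C(d.+2, 2)%:R + 23%:R ^+ 2 + 18.

Definition Closs : R := Closs0 + 8 * 'C(d.+2, 2)%:R ^+ 2 + 8 * 23%:R ^+ 3.

(* The error terms of a step: all of order [n] initially, against [n^2] for the
   number of edges. *)
Definition Zsum om H w : R := Esum v d H w + om * (Msum v d H w + (pairs T)%:R).

Definition Zcoef eta a b : R :=
  Closs + 4 * (1 + (Ckill_of (23 * d.+2))%:R) / eta +
  a * (2 ^+ 11 * (Ckill%:R + (11 ^ 3)%N%:R)) + b * (2 * 3 ^+ 23).

Lemma Msum_ge0 om H w : state v d om H w -> 0 <= Msum v d H w.
Proof. by move=> st; apply: sumr_ge0 => S _; apply: (wt_ge0 st). Qed.

Lemma Esum_ge0 om H w : state v d om H w -> 0 <= Esum v d H w.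
Proof. by move=> st; apply: sumr_ge0 => S _; apply: (wt_ge0 st). Qed.

Lemma Zcoef_ge eta a b : 0 < eta -> 0 <= a -> 0 <= b -> Closs <= Zcoef eta a b.
Proof.
move=> eta0 a0 b0.
have sum4 (c x y z : R) : 0 <= x -> 0 <= y -> 0 <= z -> c <= c + x + y + z by lra.
apply: sum4.
- by rewrite mulr_ge0 ?invr_ge0 ?(ltW eta0) // mulr_ge0 // addr_ge0 ?ler0n.
- by apply: (mulr_ge0 a0); apply: mulr_ge0; [exact: exprn_ge0 | apply: addr_ge0; exact: ler0n].
- by apply: (mulr_ge0 b0); apply: mulr_ge0; [exact: ler0n | exact: exprn_ge0].
Qed.

Lemma Closs0_ge0 : 0 <= Closs0.
Proof. by rewrite /Closs0 -/k2; have : 0 <= k2; [exact: ler0n|lra]. Qed.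

Lemma Closs_ge0 : 0 <= Closs.
Proof.
have := Closs0_ge0; rewrite /Closs -/k2; have : 0 <= k2 ^+ 2 by exact: exprn_ge0 (ler0n _ _).
by lra.
Qed.

(** The multipliers [beta], [a], [b] are whatever the remaining steps require; [iterate] fixes them
    by backward recursion. *)
Lemma step_tame om H w dl eta a b beta : state v d om H w -> 0 <= om <= 1 ->
  0 < dl <= 2^-1 ->
  (forall e, w e != 0 -> dl * (\sum_(g in killers v d H e) w g) <= 2^-1) ->
  0 < eta -> 0 <= a -> 0 <= b -> 0 <= beta <= 1 ->
  exists H' w', state v d (2 * om) H' w' /\
    #|H|%:R + (dl + beta * (1 - dl)) * (\sum_e w e) - a * Msum v d H w
     - Closs0 * dl ^+ 2 * (N2 + Msum v d H w) - eta * N2 - (Zcoef eta a b - (8 * k2 ^+ 2 + 8 * 23%:R ^+ 3)) * Zsum om H w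
    <= #|H'|%:R + beta * (\sum_e w' e) - a * Msum v d H' w' - b * Zsum (2 * om) H' w'.
Proof.
move=> st om01 dl01 tame eta0 a0 b0 /andP[be0 be1].
set N := newH v d H; set W := new3 v d H w dl.
have p01 e : 0 <= dl * w e <= 1.
  have := state_ge0 st e; have := state_om st e; case/andP: om01 => o0 o1.
  case/andP: dl01 => h1 h2 wo w0; rewrite mulr_ge0 ?(ltW h1) // mulr_ile1 ?(ltW h1) //; lra.
have [om0 om1] := andP om01; have [dl0 dl1] := andP dl01.
have M0 := Msum_ge0 st; have E0 := Esum_ge0 st.
have e1 := Ex_card vcard st om01 dl01.
have e2 := Ex_new3 vcard st om01 dl01 tame eta0.
have e3 := Ex_Msum vcard st om01 dl01 tame.
have e4 : Ex (fun e => dl * w e) (fun A => Zsum (2 * om) (N A) (W A)) <=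
   2 * 3 ^+ 23 * Zsum om H w.
  have cr (Q : pred {set E}) : (forall S : {set E}, Q S -> (#|S| <= 23)%N) ->
     Ex (fun e => dl * w e) (fun A => \sum_(S | Q S) wt (N A) (W A) S) <= 3 ^+ 23 * \sum_(S | Q S) wt H w S.
    move=> Q23; rewrite Ex_sum mulr_sumr; apply: ler_sum => S QS.
    exact: (Ex_wt_crude st om01 dl01 tame (Q23 S QS)).
  have c1 : Ex (fun e => dl * w e) (fun A => Esum v d (N A) (W A)) <= 3 ^+ 23 * Esum v d H w.
    by apply: cr => S /and3P[].
  have c2 : Ex (fun e => dl * w e) (fun A => Msum v d (N A) (W A)) <= 3 ^+ 23 * Msum v d H w.
    by apply: cr => S /and3P[_ h _]; apply: leq_trans h _.
  rewrite /Zsum ExD ExZ ExD Ex_const -/N2.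
  have K1 : 1 <= 3 ^+ 23 :> R by rewrite exprn_ege1 // ler1n.
  move: (3 ^+ 23) K1 c1 c2 => K K1 c1 c2.
  have N20 : 0 <= N2 by rewrite ler0n.
  have h1 := ler_wpM2l om0 c2; have h2 : om * N2 <= K * (om * N2) by rewrite ler_peMl // mulr_ge0.
  have h3 : 0 <= K * Esum v d H w by rewrite mulr_ge0 //; lra.
  lra.
pose G A := #|N A|%:R + beta * (\sum_e W A e) - a * Msum v d (N A) (W A) - b * Zsum (2 * om) (N A) (W A).
have [A hA] : exists A, Ex (fun e => dl * w e) G <= G A by apply: (Ex_exists p01).
exists (N A), (W A); split; first exact: (new_state st om01 dl01 tame).
apply: le_trans hA; rewrite /G !ExB ExD !ExZ.
have f2 := ler_wpM2l be0 e2; have f3 := ler_wpM2l a0 e3; have f4 := ler_wpM2l b0 e4.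
move: e1 f2 f3 f4; rewrite -/N -/W /Zcoef /Zsum -/N2 -/Cp -/k2.
move: (Ex _ _) (Ex _ _) (Ex _ _) (Ex _ _) => X1 X2 X3 X4.
rewrite /Closs /Closs0 -/k2.
set M := Msum _ _ _ _ in M0 *; set Er := Esum _ _ _ _ in E0 *.
set S := \sum_e w e; set h := #|H|%:R.
have N20 : 0 <= N2 by rewrite ler0n.
have k20 : 0 <= k2 by rewrite ler0n.
have Cp0 : 0 <= Cp by rewrite ler0n.
have Ck0 : 0 <= Ckill%:R :> R by rewrite ler0n.
have K0 : 0 <= 3 ^+ 23 :> R by rewrite exprn_ge0.
have P0 : 0 <= 2 ^+ 11 :> R by rewrite exprn_ge0.
have Q0 : 0 <= (11 ^ 3)%N%:R :> R by rewrite ler0n.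
have I0 : 0 <= eta^-1 by rewrite invr_ge0 ltW.
move: (Ckill%:R) (3 ^+ 23) (2 ^+ 11) ((11 ^ 3)%N%:R) (eta^-1) Ck0 K0 P0 Q0 I0 => Ck K P Q I Ck0 K0 P0 Q0 I0.
move=> f1 f2 f3 f4.
(* each loss is dominated by the corresponding term of the bound *)
have oM0 : 0 <= om * M by rewrite mulr_ge0.
have oN0 : 0 <= om * N2 by rewrite mulr_ge0.
have d20 : 0 <= dl ^+ 2 by rewrite exprn_ge0 // ltW.
have d21 : dl ^+ 2 <= 1 by rewrite exprn_ile1 ?(ltW dl0) //; lra.
set X := eta * N2 + (4 * om * N2 + 4 * dl * (Cp * Er)) * I in f2.
have X0 : 0 <= X.
  by rewrite addr_ge0 // ?mulr_ge0 // ?addr_ge0 ?mulr_ge0 // ltW.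
have b2 : beta * ((1 - dl) * S) - (12 * dl ^+ 2 * (M + Er) + X) <=
    beta * ((1 - dl) * S - 12 * dl ^+ 2 * (M + Er) - X).
  have y0 : 0 <= 12 * dl ^+ 2 * (M + Er) + X by rewrite addr_ge0 // mulr_ge0 ?addr_ge0 // mulr_ge0.
  by have := ler_piMl y0 be1; lra.
have z1 : dl * (Cp * Er * I) <= Cp * Er * I.
  by rewrite ler_piMl ?mulr_ge0 //; lra.
have z2 : dl * (a * P * (Ck * Er + Q * om * M)) <= a * P * (Ck * Er + Q * om * M).
  by rewrite ler_piMl ?mulr_ge0 ?addr_ge0 ?mulr_ge0 //; lra.
have z3 : dl ^+ 2 * ((k2 + 23 ^+ 2 + 18) * Er) <= (k2 + 23 ^+ 2 + 18) * Er.
  by rewrite ler_piMl // mulr_ge0 // addr_ge0 // addr_ge0 // exprn_ge0.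
have z5 : 0 <= (k2 + 23 ^+ 2 + 18) * (om * (M + N2)).
  by rewrite mulr_ge0 ?addr_ge0 ?exprn_ge0 // mulr_ge0 ?addr_ge0.
have z6 : 0 <= I * (Er + Cp * (om * (M + N2)) + om * M).
  by rewrite mulr_ge0 ?addr_ge0 ?mulr_ge0 ?addr_ge0.
have z7 : 0 <= a * P * (Ck * (om * (M + N2)) + Q * Er + Q * (om * N2)).
  by rewrite mulr_ge0 ?addr_ge0 ?mulr_ge0 ?addr_ge0.
have z8 : 0 <= dl ^+ 2 * (k2 * M) by rewrite mulr_ge0 // mulr_ge0.
have z9 : 0 <= dl ^+ 2 * N2 by rewrite mulr_ge0.
have z10 : 0 <= dl ^+ 2 * (k2 * Er) by rewrite mulr_ge0 // mulr_ge0.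
move: f1 f2 f3 f4 b2; rewrite /X; lra.
Qed.

(* The edges violating the hypothesis of [step_tame] are discarded beforehand; by the
   second moment bound [killers3_sum2] this loses weight of order [dl ^+ 2]. *)
Lemma step om H w dl eta a b beta : state v d om H w -> 0 <= om <= 1 ->
  0 < dl <= 2^-1 -> 0 < eta -> 0 <= a -> 0 <= b -> 0 <= beta <= 1 ->
  exists H' w', state v d (2 * om) H' w' /\
    #|H|%:R + (dl + beta * (1 - dl)) * (\sum_e w e) - a * Msum v d H w
     - Closs * dl ^+ 2 * (N2 + Msum v d H w) - eta * N2 - Zcoef eta a b * Zsum om H w
    <= #|H'|%:R + beta * (\sum_e w' e) - a * Msum v d H' w' - b * Zsum (2 * om) H' w'.
Proof.
move=> st om01 dl01 eta0 a0 b0 be01.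
have [om0 om1] := andP om01; have [dl0 dl1] := andP dl01; have [be0 be1] := andP be01.
pose D e := \sum_(g in killers v d H e) w g.
pose u e := if dl * D e <= 2^-1 then w e else 0.
have w0 e : 0 <= w e := state_ge0 st e.
have u0 e : 0 <= u e by rewrite /u; case: ifP.
have uw e : u e <= w e by rewrite /u; case: ifP.
have stu : state v d om H u.
  split=> //; first exact: state_clean st.
  - by move=> e; apply: le_trans (uw e) (state_om st e).
  - by move=> e; rewrite /u; case: ifP => [_ h|_]; [exact: (state_avail st h) | rewrite eqxx].
  - by move=> p p2; apply: le_trans (state_pair st p2); apply: ler_sum => e _.
have tame e : u e != 0 -> dl * (\sum_(g in killers v d H e) u g) <= 2^-1.
  rewrite {1}/u; case: ifP => [h _|]; last by rewrite eqxx.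
  apply: le_trans h; rewrite ler_wpM2l ?(ltW dl0) //; exact: ler_sum.
have wtu S : wt H u S <= wt H w S.
  by apply: ler_prod => e _; rewrite (rho_ge0 stu) lerD2l uw.
have Mu : Msum v d H u <= Msum v d H w by apply: ler_sum.
have Eu : Esum v d H u <= Esum v d H w by apply: ler_sum.
have Zu : Zsum om H u <= Zsum om H w by rewrite lerD // ler_wpM2l // lerD2r.
(* A discarded edge has [dl * D e > 1/2]; with [D e <= k2 + x] this gives [1 <= (2 * dl * D e) ^ 2
   <= 8 * dl ^ 2 * (k2 ^ 2 + x ^ 2)]. *)
have lost : \sum_e w e - \sum_e u e <=
    8 * dl ^+ 2 * (k2 ^+ 2 * N2 + 23%:R ^+ 3 * (Msum v d H w + Esum v d H w)).
  rewrite -sumrB; apply: (@le_trans _ _ (\sum_e (8 * dl ^+ 2 * (k2 ^+ 2 * w e +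
      w e * (\sum_(g in killers3 v d H e) w g) ^+ 2)))).
    apply: ler_sum => e _; have := killers_weight vcard st e; rewrite -/(D e) -/k2.
    have D30 : 0 <= \sum_(g in killers3 v d H e) w g by apply: sumr_ge0.
    have k20 : 0 <= k2 by rewrite ler0n.
    rewrite /u; move: (\sum_(_ in _) _) D30 => x x0 Dx.
    have rhs0 : 0 <= 8 * dl ^+ 2 * (k2 ^+ 2 * w e + w e * x ^+ 2).
      by rewrite mulr_ge0 ?addr_ge0 ?mulr_ge0 ?exprn_ge0 ?(ltW dl0).
    case: ifP => [_|/negbT]; first by rewrite subrr.
    rewrite -ltNge subr0 => Dbig.
    have h1 : 2^-1 <= dl * (k2 + x).
      by apply: le_trans (ltW Dbig) _; rewrite ler_wpM2l ?(ltW dl0).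
    have h2 : 2^-1 ^+ 2 <= (dl * (k2 + x)) ^+ 2.
      by rewrite ler_pXn2r // nnegrE ?invr_ge0 //; apply: le_trans h1; rewrite invr_ge0.
    have h3 : 1 <= 8 * dl ^+ 2 * (k2 ^+ 2 + x ^+ 2).
      have h4 : 0 <= dl ^+ 2 * (k2 - x) ^+ 2 by rewrite mulr_ge0 ?sqr_ge0.
      lra.
    by have := ler_wpM2l (w0 e) h3; lra.
  rewrite -mulr_sumr ler_wpM2l ?mulr_ge0 ?exprn_ge0 ?(ltW dl0) // big_split /= lerD //.
    by rewrite -mulr_sumr ler_wpM2l ?exprn_ge0 ?ler0n //; exact: (total_sum vcard st).
  exact: (killers3_sum2 vcard st om01).
have [H' [w' [st' le']]] := step_tame stu om01 dl01 tame eta0 a0 b0 be01.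
exists H', w'; split=> //; apply: le_trans le'.
have M0 := Msum_ge0 st; have E0 := Esum_ge0 st.
have Z0 : 0 <= Zsum om H w - Esum v d H w.
  by rewrite /Zsum addrAC subrr add0r mulr_ge0 // addr_ge0 ?ler0n.
have N20 : 0 <= N2 by rewrite ler0n.
have k20 : 0 <= k2 by rewrite ler0n.
have d20 : 0 <= dl ^+ 2 by rewrite exprn_ge0 // ltW.
have d21 : dl ^+ 2 <= 1 by rewrite exprn_ile1 ?(ltW dl0) //; lra.
set c := dl + beta * (1 - dl).
have c01 : 0 <= c <= 1.
  have y1 : beta * (1 - dl) <= 1 - dl by rewrite ler_piMl // subr_ge0; lra.
  have y2 : 0 <= beta * (1 - dl) by rewrite mulr_ge0 // subr_ge0; lra.
  by apply/andP; split; rewrite /c; lra.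
have [c0 c1] := andP c01.
set L := 8 * dl ^+ 2 * _ in lost.
have L0 : 0 <= L.
  apply: mulr_ge0; first by rewrite mulr_ge0.
  by apply: addr_ge0; apply: mulr_ge0; rewrite ?exprn_ge0 // addr_ge0.
have cl : c * (\sum_e w e) - L <= c * (\sum_e u e).
  by have := ler_wpM2l c0 lost; have := ler_piMl L0 c1; lra.
have aM := ler_wpM2l a0 Mu.
have C00 : 0 <= Closs0.
  by rewrite /Closs0 -/k2; lra.
have C0M : Closs0 * dl ^+ 2 * (N2 + Msum v d H u) <= Closs0 * dl ^+ 2 * (N2 + Msum v d H w).
  by apply: ler_wpM2l; [rewrite mulr_ge0 | rewrite lerD2l].
have g1 : 0 <= 8 * k2 ^+ 2 + 8 * 23%:R ^+ 3 by rewrite addr_ge0 // mulr_ge0 ?exprn_ge0.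
have Zc0 : 0 <= Zcoef eta a b - (8 * k2 ^+ 2 + 8 * 23%:R ^+ 3).
  by have := Zcoef_ge eta0 a0 b0; have := Closs0_ge0; rewrite /Closs -/k2; lra.
have Zge : Esum v d H w <= Zsum om H w by lra.
have f1 := ler_wpM2l Zc0 Zu.
have f2 : 8 * 23%:R ^+ 3 * (dl ^+ 2 * Esum v d H w) <= (8 * k2 ^+ 2 + 8 * 23%:R ^+ 3) * Zsum om H w.
  apply: ler_pM.
  - by apply: mulr_ge0 => //; apply: exprn_ge0.
  - exact: mulr_ge0.
  - by rewrite lerDr; apply: mulr_ge0 => //; apply: exprn_ge0.
  - by apply: le_trans Zge; rewrite ler_piMl.
have f3 : 0 <= k2 ^+ 2 * (dl ^+ 2 * Msum v d H w).
  by apply: mulr_ge0; [exact: exprn_ge0 | exact: mulr_ge0].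
have f4 : 0 <= dl ^+ 2 * N2 by apply: mulr_ge0.
move: cl aM C0M f1 f2 f3 f4; rewrite /L /Closs -/k2.
move: (Zcoef _ _ _) (Zsum _ _ _) (Zsum _ _ _) (Msum _ _ _ _) (Msum _ _ _ _) (Esum _ _ _ _) Closs0.
move: (dl ^+ 2) (\sum_e w e) (\sum_e u e) (k2 ^+ 2); move=> *; lra.
Qed.

(** Multiplier of [Zsum] with [t] steps to go. It is enormous, but independent of [n]. *)
Fixpoint Zpot eta dl (t : nat) : R :=
  if t is t'.+1 then Zcoef eta (t'%:R * (Closs * dl ^+ 2)) (Zpot eta dl t') else 0.

Lemma Zpot_ge0 eta dl t : 0 <= dl -> 0 < eta -> 0 <= Zpot eta dl t.
Proof.
move=> dl0 eta0; elim: t => [|t IH] //=; apply: le_trans Closs_ge0 (Zcoef_ge eta0 _ IH).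
by rewrite mulr_ge0 ?ler0n // mulr_ge0 ?Closs_ge0 // exprn_ge0.
Qed.

(** With [t] steps to go a unit of weight is worth [1 - (1 - dl) ^ t] edges, the solution of
    [beta' = dl + beta * (1 - dl)]. Bounds on single weights double at each step, whence the
    hypothesis on [2 ^ t * om]. *)
Lemma iterate dl eta (t : nat) : 0 < dl <= 2^-1 -> 0 < eta ->
  forall om H w, state v d om H w -> 0 <= om -> 2 ^+ t * om <= 1 ->
  exists2 H', clean v d H' &
    #|H|%:R + (1 - (1 - dl) ^+ t) * (\sum_e w e) - t%:R * (Closs * dl ^+ 2) * Msum v d H w
    - t%:R * (Closs * dl ^+ 2 + eta) * N2 - Zpot eta dl t * Zsum om H w <= #|H'|%:R.
Proof.
move=> dl01 eta0; have [dl0 dl1] := andP dl01.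
have C0 := Closs_ge0.
have d20 : 0 <= Closs * dl ^+ 2 by rewrite mulr_ge0 // exprn_ge0 // ltW.
have Zp0 s : 0 <= Zpot eta dl s by apply: Zpot_ge0; rewrite ?ltW.
elim: t => [|t IH] om H w st om0 om1.
  by exists H; [exact: state_clean st | rewrite expr0 /=; lra].
have p1 : 1 <= 2 ^+ t :> R by rewrite exprn_ege1 // ler1n.
have om01 : 0 <= om <= 1.
  by rewrite om0 (le_trans _ om1) // ler_peMl // exprn_ege1 // ler1n.
have be01 : 0 <= 1 - (1 - dl) ^+ t <= 1.
  rewrite subr_ge0 exprn_ile1 ?subr_ge0 ?lerBlDr ?lerDl ?exprn_ge0 ?subr_ge0 //; lra.
have a0 : 0 <= t%:R * (Closs * dl ^+ 2) by rewrite mulr_ge0 ?ler0n.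
have [H1 [w1 [st1 le1]]] := step st om01 dl01 eta0 a0 (Zp0 t) be01.
have om2 : 2 ^+ t * (2 * om) <= 1 by rewrite mulrA -exprSr.
have [H2 cl2 le2] := IH _ _ _ st1 (mulr_ge0 (ler0n _ 2) om0) om2.
exists H2 => //; apply: le_trans le2.
rewrite [Zpot _ _ t.+1]/= exprS -natr1; move: le1.
by move=> le1; lra.
Qed.
End Iterate.

(** * Initial weights and the lower bound *)

Section Initial.

Variables (R : realFieldType) (n d : nat).
Hypothesis n0 : (0 < n)%N.

Definition rsets := {e : {set 'I_n} | #|e| == d.+2}.

Definition rval (e : rsets) : {set 'I_n} := val e.

Lemma rval_card e : #|rval e| = d.+2.
Proof. by apply/eqP; exact: (valP e). Qed.

(** At most ['C(n, d)] edges contain a given pair, so pair sums are at most one and asymptotically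
    equal to it. The total is then asymptotically [n ^ 2 / (r * (r - 1))], the density sought. *)
Definition om0 : R := d`!%:R / n%:R ^+ d.

Let nR : 0 < n%:R :> R. Proof. by rewrite ltr0n. Qed.

Lemma om0_ge0 : 0 <= om0.
Proof. by rewrite divr_ge0 ?ler0n ?exprn_ge0. Qed.

Lemma ffact_le_exp m k : (m ^_ k <= m ^ k)%N.
Proof. by elim: k => // k IH; rewrite ffactnSr expnSr leq_mul // leq_subr. Qed.

Lemma rsets_pair (p : {set 'I_n}) : #|p| = 2%N ->
  (#|[set e : rsets | p \subset rval e]| <= 'C(n, d))%N.
Proof.
move=> p2; pose f (e : rsets) := rval e :\: p.
have finj : {in [set e : rsets | p \subset rval e] &, injective f}.
  move=> e e'; rewrite !inE => pe pe' ff; apply: val_inj.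
  by rewrite -[val e](setID _ p) -[val e'](setID _ p) (setIidPr pe) (setIidPr pe') -/(f e) ff.
have -> : 'C(n, d) = #|[set A : {set 'I_n} | #|A| == d]| by rewrite card_draws card_ord.
rewrite -(card_in_imset finj); apply: subset_leq_card.
apply/subsetP => A /imsetP[e]; rewrite inE => pe ->; rewrite inE /f cardsD.
by rewrite (setIidPr pe) rval_card p2 subn2.
Qed.

Lemma init_state : state rval d om0 set0 (fun=> om0).
Proof.
have small (S : {set rsets}) : (#|S| <= 1)%N -> clean rval d S.
  move=> S1; apply/forallP => B; apply/implyP => BS; rewrite /bad.
  by have := leq_trans (subset_leq_card BS) S1; case: (#|B|) => [|[|m]].
split=> //.
- by apply: small; rewrite cards0.
- by move=> e; apply: om0_ge0.
- by move=> e _; rewrite inE /= small // setU0 cards1.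
move=> p p2; rewrite sumr_const -cardsE /om0.
have c := rsets_pair p2.
apply: (@le_trans _ _ (om0 *+ 'C(n, d))); first by rewrite ler_wpMn2l ?om0_ge0.
rewrite -mulr_natr /om0 mulrAC ler_pdivrMr ?exprn_gt0 // mul1r -natrM -natrX ler_nat.
by rewrite mulnC bin_ffact ffact_le_exp.
Qed.

Lemma init_total : \sum_(e : rsets) om0 = 'C(n, d.+2)%:R * om0.
Proof.
rewrite sumr_const -[LHS]mulr_natl; congr (_ * _); congr (_%:R).
have -> : 'C(n, d.+2) = #|[set A : {set 'I_n} | #|A| == d.+2]| by rewrite card_draws card_ord.
by rewrite card_sig cardsE.
Qed.

(** At most [L] vertices lie in the image of a map from ['I_L], and inside such an image there are
    at most [2 ^ L] edges. Nonemptiness of [S] supplies the default point of [nth]. *)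
Lemma card_span (L : nat) :
  (#|[set S : {set rsets} | (0 < #|S|)%N & (#|span rval S| <= L)%N]| <= n ^ L * 2 ^ (2 ^ L))%N.
Proof.
pose img (f : {ffun 'I_L -> 'I_n}) := f @: 'I_L.
pose F (f : {ffun 'I_L -> 'I_n}) := [set S : {set rsets} | span rval S \subset img f].
have Fcard f : (#|F f| <= 2 ^ (2 ^ L))%N.
  pose D := [set e : rsets | rval e \subset img f].
  have DL : (#|D| <= 2 ^ L)%N.
    rewrite -(card_imset _ val_inj); apply: leq_trans (_ : #|powerset (img f)| <= _)%N.
      apply: subset_leq_card; apply/subsetP => A /imsetP[e]; rewrite inE => De ->.
      by rewrite powersetE.
    rewrite card_powerset leq_pexp2l // (leq_trans (leq_imset_card _ _)) //.
    by rewrite card_ord.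
  apply: leq_trans (_ : #|powerset D| <= _)%N; last by rewrite card_powerset leq_pexp2l.
  apply: subset_leq_card; apply/subsetP => S; rewrite inE powersetE => sS.
  apply/subsetP => e eS; rewrite inE; apply: subset_trans sS; exact: sub_span.
apply: leq_trans (_ : #|\bigcup_(f : {ffun 'I_L -> 'I_n}) F f| <= _)%N.
  apply: subset_leq_card; apply/subsetP => S; rewrite inE => /andP[S0 SL].
  have [x xS] : exists x, x \in span rval S.
    move: S0 => /card_gt0P[e eS]; have /card_gt0P[x xe] : (0 < #|rval e|)%N by rewrite rval_card.
    by exists x; apply: mem_span eS xe.
  pose f : {ffun 'I_L -> 'I_n} := [ffun i : 'I_L => nth x (enum (span rval S)) i].
  apply/bigcupP; exists f => //; rewrite inE; apply/subsetP => y yS.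
  have yi : (index y (enum (span rval S)) < L)%N.
    by apply: leq_trans SL; rewrite cardE index_mem mem_enum.
  apply/imsetP; exists (Ordinal yi) => //.
  by rewrite ffunE /= nth_index // mem_enum.
have : (#|\bigcup_(f : {ffun 'I_L -> 'I_n}) F f| <= \sum_(f : {ffun 'I_L -> 'I_n}) 2 ^ (2 ^ L))%N.
  apply: (big_ind2 (fun (A : {set {set rsets}}) m => (#|A| <= m)%N)) => //; first by rewrite cards0.
  by move=> A a B b Aa Bb; apply: leq_trans (leq_card_setU _ _).1 (leq_add Aa Bb).
by move/leq_trans; apply; rewrite sum_nat_const card_ffun !card_ord.
Qed.

Definition Cinit (m c : nat) : R := \sum_(j < m.+1) d`!%:R ^+ j * (2 ^ (2 ^ (d * j + c)))%N%:R.

Lemma init_sum (P : pred {set rsets}) (m c : nat) :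
  (forall S, P S -> [/\ (0 < #|S|)%N, (#|S| <= m)%N & phi rval d S <= c%:Z]) ->
  \sum_(S | P S) wt set0 (fun=> om0) S <= Cinit m c * n%:R ^+ c.
Proof.
move=> hP; have wtE0 (S : {set rsets}) : wt set0 (fun=> om0) S = om0 ^+ #|S|.
  by rewrite (wtE init_state) setD0 prodr_const.
apply: (@le_trans _ _ (\sum_(S | P S) \sum_(j < m.+1 | #|S| == j) om0 ^+ j)).
  apply: ler_sum => S /hP [_ Sm _]; rewrite wtE0.
  have Sm' : (#|S| < m.+1)%N by [].
  by rewrite (bigD1 (Ordinal Sm')) //= lerDl sumr_ge0 // => j _; rewrite exprn_ge0 ?om0_ge0.
rewrite (exchange_big_dep xpredT) //= /Cinit mulr_suml; apply: ler_sum => j _.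
rewrite sumr_const; set k := #|_|.
have kle : (k <= n ^ (d * j + c) * 2 ^ (2 ^ (d * j + c)))%N.
  apply: leq_trans (card_span _); apply: subset_leq_card; apply/subsetP => S.
  rewrite unfold_in /= => /andP[/hP[S0 _ pS] /eqP Sj]; rewrite inE S0 /=.
  by move: pS; rewrite /phi Sj lerBlDl -PoszD lez_nat.
apply: (@le_trans _ _ (om0 ^+ j *+ (n ^ (d * j + c) * 2 ^ (2 ^ (d * j + c))))).
  by rewrite ler_wpMn2l // exprn_ge0 // om0_ge0.
rewrite -mulr_natr natrM natrX exprD exprM /om0 expr_div_n le_eqVlt; apply/orP; left; apply/eqP.
have nd0 : (n%:R ^+ d) ^+ j != 0 :> R by rewrite !expf_neq0 // gt_eqF.
move: (2 ^ _)%N%:R => K; field; exact: nd0.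
Qed.

Lemma init_M : Msum rval d set0 (fun=> om0) <= Cinit 11 2 * n%:R ^+ 2.
Proof. by apply: init_sum => S /and3P[? ? /goodP[]]. Qed.

Lemma init_E : Esum rval d set0 (fun=> om0) <= Cinit 23 1 * n%:R.
Proof. by rewrite -[n%:R]expr1; apply: init_sum => S /and3P[]. Qed.

Lemma om0_le : (0 < d)%N -> om0 <= d`!%:R / n%:R.
Proof.
move=> d0; rewrite /om0 ler_wpM2l ?ler0n // lef_pV2 ?posrE ?exprn_gt0 //.
by rewrite -[leLHS]expr1 ler_weXn2l // ler1n.
Qed.

Lemma pairs_le : (pairs 'I_n)%:R <= n%:R ^+ 2 :> R.
Proof.
rewrite /pairs card_ord -natrX ler_nat; apply: leq_trans (ffact_le_exp n 2).
by rewrite -bin_ffact leq_pmulr.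
Qed.

Lemma init_Z : (0 < d)%N -> Zsum rval d om0 set0 (fun=> om0) <=
  (Cinit 23 1 + d`!%:R * (Cinit 11 2 + 1)) * n%:R.
Proof.
move=> d0; have hE := init_E; have hM := init_M; have ho := om0_le d0.
have N2le := pairs_le.
have s0 : 0 <= Msum rval d set0 (fun=> om0) + (pairs 'I_n)%:R :> R.
  by rewrite addr_ge0 ?ler0n // (Msum_ge0 init_state).
rewrite /Zsum mulrDl lerD //.
apply: (@le_trans _ _ (d`!%:R / n%:R * ((Cinit 11 2 + 1) * n%:R ^+ 2))).
  by apply: ler_pM; rewrite ?om0_ge0 // mulrDl mul1r lerD.
rewrite le_eqVlt; apply/orP; left; apply/eqP; move: (Cinit _ _) => C; field.
by rewrite gt_eqF.
Qed.

Lemma ffact_ge m : (n%:R - (m ^ 2)%N%:R) * n%:R ^+ m <= n%:R * (n ^_ m)%:R :> R.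
Proof.
elim: m => [|m IH]; first by rewrite ffactn0 expr0 subr0.
case: (leqP m n) => mn; last first.
  rewrite ffact_small ?mulr0; last by apply: leq_trans mn _.
  rewrite mulr_le0_ge0 ?exprn_ge0 ?ler0n // subr_le0 ler_nat.
  by apply: leq_trans (ltnW mn) _; rewrite expnS; nia.
rewrite ffactnSr natrM natrB // exprSr mulrA [leRHS]mulrA.
have h : 0 <= n%:R - m%:R :> R by rewrite subr_ge0 ler_nat.
apply: le_trans (ler_wpM2r h IH).
have u0 : 0 <= n%:R ^+ m :> R by rewrite exprn_ge0 ?ler0n.
have key : (n%:R - (m.+1 ^ 2)%N%:R) * n%:R <= (n%:R - (m ^ 2)%N%:R) * (n%:R - m%:R) :> R.
  rewrite !natrX -natr1; have m0 : 0 <= m%:R :> R by rewrite ler0n.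
  have : 0 <= m%:R ^+ 3 :> R by rewrite exprn_ge0.
  have : 0 <= m%:R * n%:R :> R by rewrite mulr_ge0 // ltW.
  by have := nR; lra.
by have := ler_wpM2r u0 key; lra.
Qed.

Lemma init_total_ge :
  (n%:R ^+ 2 - (d.+2 ^ 2)%N%:R * n%:R) / (d.+2 * d.+1)%N%:R <= \sum_(e : rsets) om0.
Proof.
rewrite init_total ler_pdivrMr ?ltr0n //.
have := ffact_ge d.+2; rewrite -bin_ffact factS factS mulnA => h.
rewrite -(ler_pM2r (exprn_gt0 d.+1 nR)) /om0.
apply: le_trans (_ : (n%:R - (d.+2 ^ 2)%N%:R) * n%:R ^+ d.+2 <= _).
  by rewrite !exprS; lra.
apply: le_trans h _; rewrite !natrM le_eqVlt; apply/orP; left; apply/eqP.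
rewrite exprS; move: (d.+2%:R) (d.+1%:R) (d`!%:R) ('C(_, _)%:R) => x y z t.
have nd0 : n%:R ^+ d != 0 :> R by rewrite expf_neq0 // gt_eqF.
move: (n%:R ^+ d) nd0 => u u0; field; exact: u0.
Qed.

Lemma lower_bound (t : nat) (dl : R) : (0 < d)%N -> 0 < dl <= 2^-1 -> 2 ^+ t * om0 <= 1 ->
  exists2 H : {set rsets}, clean rval d H &
   (1 - (1 - dl) ^+ t) * ((n%:R ^+ 2 - (d.+2 ^ 2)%N%:R * n%:R) / (d.+2 * d.+1)%N%:R)
   - t%:R * dl ^+ 2 * (Closs R d * Cinit 11 2 + Closs R d + 1) * n%:R ^+ 2
   - Zpot d (dl ^+ 2) dl t * (Cinit 23 1 + d`!%:R * (Cinit 11 2 + 1)) * n%:R <= #|H|%:R.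
Proof.
move=> d0 dl01 om1; have [dl0 dl1] := andP dl01.
have eta0 : 0 < dl ^+ 2 by rewrite exprn_gt0.
have [H cl le] := iterate rval_card dl01 eta0 init_state om0_ge0 om1.
exists H => //; apply: le_trans le; rewrite cards0 add0r.
have C0 : 0 <= Closs R d := Closs_ge0 _ _.
have Z0 := Zpot_ge0 d t (ltW dl0) eta0.
have h1 : (1 - (1 - dl) ^+ t) * ((n%:R ^+ 2 - (d.+2 ^ 2)%N%:R * n%:R) / (d.+2 * d.+1)%N%:R) <=
    (1 - (1 - dl) ^+ t) * (\sum_(e : rsets) om0).
  apply: ler_wpM2l init_total_ge; rewrite subr_ge0; apply: exprn_ile1; lra.
have h2 : t%:R * (Closs R d * dl ^+ 2) * Msum rval d set0 (fun=> om0) <=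
    t%:R * (Closs R d * dl ^+ 2) * (Cinit 11 2 * n%:R ^+ 2).
  by rewrite ler_wpM2l ?init_M // mulr_ge0 ?ler0n // mulr_ge0 // ltW.
have h3 : t%:R * (Closs R d * dl ^+ 2 + dl ^+ 2) * (pairs 'I_n)%:R <=
    t%:R * (Closs R d * dl ^+ 2 + dl ^+ 2) * n%:R ^+ 2.
  by rewrite ler_wpM2l ?pairs_le // mulr_ge0 ?ler0n // addr_ge0 ?mulr_ge0 // ltW.
have h4 := ler_wpM2l Z0 (init_Z d0).
move: h1 h2 h3 h4; rewrite mulrA; move: (Zpot _ _ _ _) (Zsum _ _ _ _ _) (Msum _ _ _ _) => z1 z2 z3.
move: (\sum_e om0) (_ / _) (d`!%:R) (pairs _)%:R ((1 - dl) ^+ t) (dl ^+ 2) => x1 x2 x3 x4 x5 x6.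
by move: (Closs R d) (Cinit 11 2) (Cinit 23 1) (t%:R) (n%:R) => y1 y2 y3 y4 y5 *; lra.
Qed.

End Initial.

(** * The upper bound *)

Section Upper.

Variables (T : finType) (d : nat) (H : {set {set T}}).
Hypothesis d2 : (2 <= d)%N.
Hypothesis Hcard : forall e : {set T}, e \in H -> #|e| = d.+2.

Notation spn := (span (fun e : {set T} => e)).
Notation ph := (phi (fun e : {set T} => e) d).

Hypothesis Hfree : forall F : {set {set T}}, F \subset H -> #|F| = 6%N -> 3 <= ph F.
Implicit Types (A B C D F G K : {set {set T}}) (e f g h p q : {set T}).

Lemma sub_spn e A : e \in A -> e \subset spn A.
Proof. exact: (@sub_span _ _ (fun e => e) e A). Qed.

Lemma no6 B : B \subset H -> #|B| = 6%N -> ph B <= 2 -> False.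
Proof. by move=> BH B6 pB; have := Hfree BH B6; lia. Qed.

(** * Components of tightly overlapping edges *)

Definition tight e f := [&& e \in H, f \in H & (2 <= #|e :&: f|)%N].

Lemma tight_sym : symmetric tight.
Proof. by move=> e f; rewrite /tight setIC andbCA. Qed.

Lemma csym : connect_sym tight.
Proof. exact: sym_connect_sym tight_sym. Qed.

Definition comps : {set {set {set T}}} := equivalence_partition (connect tight) H.

Lemma comps_partition : partition comps H.
Proof.
apply/equivalence_partitionP => e f g _ _ _; split; first exact: connect0.
by move=> ef; apply: (same_connect csym).
Qed.

Lemma comp_sub F : F \in comps -> F \subset H.
Proof.
by move=> FP; rewrite -(cover_partition comps_partition); apply: bigcup_sup.
Qed.

Lemma comp_neq0 F : F \in comps -> F != set0.
Proof. exact: partition_neq0 comps_partition. Qed.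

Lemma comp_tight F e f : F \in comps -> e \in F -> tight e f -> f \in F.
Proof.
move=> FP eF ef; case/imsetP: (FP) => x xH FE; move: eF; rewrite FE !inE => /andP[eH xe].
case/and3P: (ef) => _ -> _ /=; exact: connect_trans xe (connect1 ef).
Qed.

Lemma comp_disj F G : F \in comps -> G \in comps -> F != G -> F :&: G = set0.
Proof.
move=> FP GP FG; case/and3P: comps_partition => _ /trivIsetP tr _.
by apply/eqP; rewrite setI_eq0; apply: tr.
Qed.

Lemma comp_uniq F G e : F \in comps -> G \in comps -> e \in F -> e \in G -> F = G.
Proof.
move=> FP GP eF eG; apply/eqP; apply: contraT => /(comp_disj FP GP)/setP/(_ e).
by rewrite !inE eF eG.
Qed.

Lemma comp_grow F A : F \in comps -> A \subset F -> A != set0 -> A != F ->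
  exists g, [/\ g \in F, g \notin A & exists2 a, a \in A & (2 <= #|g :&: a|)%N].
Proof.
move=> FP AF A0 AnF.
case: (boolP [exists g, [&& g \in F, g \notin A & [exists a, (a \in A) && (2 <= #|g :&: a|)%N]]]).
  by case/existsP => g /and3P[gF gA /existsP[a /andP[aA ga]]]; exists g; split=> //; exists a.
rewrite negb_exists => /forallP no.
have cl : closed tight (mem A).
  apply: intro_closed; first exact: csym.
  move=> a g /= ag aA; have := no g; apply: contraR => gA.
  rewrite (comp_tight FP (subsetP AF _ aA) ag) gA; apply/existsP; exists a.
  by rewrite aA; case/and3P: ag => _ _; rewrite setIC.
case/set0Pn: A0 => a aA; case/negP: AnF; rewrite eqEsubset AF.
apply/subsetP => f fF; case/imsetP: (FP) => x xH FE.
have := subsetP AF _ aA; move: fF; rewrite FE !inE => /andP[fH xf] /andP[aH xa].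
have af : connect tight a f.
  apply: connect_trans xf; rewrite csym //.
by rewrite -(closed_connect cl af).
Qed.

Lemma ph_add g A : g \in H -> g \notin A -> ph (g |: A) <= ph A + 2 - #|g :&: spn A|%:Z.
Proof. by move=> gH gA; exact: (@phi_add _ _ _ _ g A _ (Hcard gH) gA (leqnn _)). Qed.

Lemma ph_attach g A : g \in H -> (2 <= #|g :&: spn A|)%N -> ph (g |: A) <= ph A.
Proof.
move=> gH gA; case: (boolP (g \in A)) => gA'; first by rewrite (setUidPr _) ?sub1set.
by have := ph_add gH gA'; lia.
Qed.

Lemma ph_attachU B A : B \subset H -> (forall g, g \in B -> (2 <= #|g :&: spn A|)%N) ->
  ph (B :|: A) <= ph A.
Proof.
move: {2}#|B| (leqnn #|B|) => m; elim: m B => [|m IH] B Bm BH hB.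
  by move: Bm; rewrite leqn0 cards_eq0 => /eqP ->; rewrite set0U.
case: (set_0Vmem B) => [->|[g gB]]; first by rewrite set0U.
rewrite -(setD1K gB) -setUA; apply: le_trans (ph_attach (subsetP BH _ gB) _) (IH _ _ _ _).
- apply: leq_trans (hB g gB) _; apply: subset_leq_card; apply: setIS; apply: spanS.
  exact: subsetUr.
- by move: Bm; rewrite (cardsD1 g) gB.
- exact: subset_trans (subsetDl _ _) BH.
- by move=> x; rewrite inE => /andP[_ /hB].
Qed.

Lemma subset_card (X : finType) (A : {set X}) (m : nat) : (m <= #|A|)%N ->
  exists2 B : {set X}, B \subset A & #|B| = m.
Proof.
move=> mA; have : (0 < #|[set B : {set X} | (B \subset A) && (#|B| == m)]|)%N.
  by rewrite cards_draws bin_gt0.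
by case/card_gt0P => B; rewrite inE => /andP[BA /eqP Bm]; exists B.
Qed.

(** The edges of [C] attach to [B] without raising [phi], so with six edges available one could stop
    at exactly six with [phi <= 2]. *)
Lemma six_attach B C : B \subset H -> C \subset H -> B :&: C = set0 -> ph B <= 2 ->
  (forall g, g \in C -> (2 <= #|g :&: spn B|)%N) -> (#|B| <= 6)%N -> (#|B| + #|C| <= 5)%N.
Proof.
move=> BH CH BC pB hC B6; rewrite leqNgt; apply/negP => big.
have [D DC D6] := @subset_card _ C (6 - #|B|) ltac:(lia).
have BD : B :&: D = set0.
  by apply/eqP; rewrite -subset0 -BC; apply: setIS.
have pD : ph (D :|: B) <= 2.
  apply: le_trans pB; apply: ph_attachU; first exact: subset_trans DC CH.
  by move=> g gD; apply: hC; apply: (subsetP DC).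
apply: no6 pD; first by rewrite subUset BH (subset_trans DC CH).
by rewrite cardsU setIC BD cards0; lia.
Qed.

(** Inside a component one grows along tight edges, each meeting an earlier one in two vertices;
    this holds [phi] down even beside a foreign set [B], and [m] can be chosen to reach exactly six
    edges. *)
Lemma comp_extend F A B m : F \in comps -> A \subset F -> A != set0 -> B :&: F = set0 ->
  (#|A| <= m <= #|F|)%N ->
  exists A', [/\ A \subset A', A' \subset F, #|A'| = m & ph (A' :|: B) <= ph (A :|: B)].
Proof.
move=> FP AF A0 BF /andP[Am mF].
elim: m Am mF => [|m IH] Am mF.
  by exists A; split=> //; apply/eqP; rewrite -leqn0.
move: Am; rewrite leq_eqVlt => /orP[/eqP <-|Am]; first by exists A; split.
have [A' [AA' A'F A'm pA']] := IH Am (ltnW mF).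
have A'0 : A' != set0 by apply: contraNneq A0 => E0; rewrite -subset0 -E0.
have A'nF : A' != F by apply: contraTneq mF => <-; rewrite A'm ltnn.
have [g [gF gA' [a aA' ga]]] := comp_grow FP A'F A'0 A'nF.
exists (g |: A'); split.
- exact: subset_trans AA' (subsetUr _ _).
- by rewrite subUset sub1set gF.
- by rewrite cardsU1 gA' A'm.
apply: le_trans pA'; rewrite -setUA; apply: ph_attach; first exact: subsetP (comp_sub FP) _ gF.
apply: leq_trans ga _; apply: subset_leq_card; apply: setIS.
by apply: sub_spn; rewrite inE aA'.
Qed.

Lemma comp_extend0 F A m : F \in comps -> A \subset F -> A != set0 -> (#|A| <= m <= #|F|)%N ->
  exists A', [/\ A \subset A', A' \subset F, #|A'| = m & ph A' <= ph A].
Proof.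
move=> FP AF A0 mm; have [A' [? ? ?]] := comp_extend FP AF A0 (set0I F) mm.
by rewrite !setU0 => ?; exists A'.
Qed.

Lemma ph1 e : e \in H -> ph [set e] = 2.
Proof. by move=> eH; rewrite phi1 Hcard //; lia. Qed.

Lemma comp_ph F A : F \in comps -> A \subset F -> A != set0 -> ph F <= ph A.
Proof.
move=> FP AF A0; have [A' [_ A'F A'c pA]] := @comp_extend0 F A #|F| FP AF A0 ltac:(by rewrite (subset_leq_card AF) leqnn).
by have /eqP <- : A' == F by rewrite eqEcard A'F A'c leqnn.
Qed.

Lemma comp_ph2 F : F \in comps -> ph F <= 2.
Proof.
move=> FP; case/set0Pn: (comp_neq0 FP) => e eF.
rewrite -(ph1 (subsetP (comp_sub FP) e eF)); apply: comp_ph => //; first by rewrite sub1set.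
by apply/set0Pn; exists e; rewrite inE.
Qed.

Lemma comp_le5 F : F \in comps -> (#|F| <= 5)%N.
Proof.
move=> FP; rewrite leqNgt; apply/negP => F6; case/set0Pn: (comp_neq0 FP) => e eF.
have eH := subsetP (comp_sub FP) e eF.
have e0 : [set e] != set0 by apply/set0Pn; exists e; rewrite inE.
have [A [_ AF A6 pA]] := @comp_extend0 F [set e] 6 FP ltac:(by rewrite sub1set) e0 ltac:(by rewrite cards1).
by apply: (no6 (subset_trans AF (comp_sub FP)) A6); rewrite (le_trans pA) // ph1.
Qed.

Lemma comp_far F e g : F \in comps -> e \in F -> g \in H -> g \notin F -> (#|g :&: e| <= 1)%N.
Proof.
move=> FP eF gH gF; rewrite leqNgt; apply: contra gF => ge; apply: (comp_tight FP eF).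
by rewrite /tight gH (subsetP (comp_sub FP)) // setIC.
Qed.

Lemma ph_meet A B t : A :&: B = set0 -> (t <= #|spn A :&: spn B|)%N ->
  ph (A :|: B) <= ph A + ph B - t%:Z.
Proof. by move=> AB tAB; exact: (@phiU_disj _ _ _ d A B t AB tAB). Qed.

Lemma ph_join A B p : A :&: B = set0 -> #|p| = 2%N -> p \subset spn A -> p \subset spn B ->
  ph (A :|: B) <= ph A + ph B - 2.
Proof.
move=> AB p2 pA pB; apply: (@ph_meet A B 2 AB).
by rewrite -p2; apply: subset_leq_card; rewrite subsetI pA.
Qed.

(** * Covered pairs and cross pairs of a component *)

Definition cov F : {set {set T}} :=
  [set p : {set T} | (#|p| == 2%N) && [exists g : {set T}, (g \in F) && (p \subset g)]].

Lemma covP F p : reflect (#|p| = 2%N /\ exists2 g, g \in F & p \subset g) (p \in cov F).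
Proof.
rewrite inE; apply: (iffP andP) => [[/eqP p2 /existsP[g /andP[gF pg]]]|[p2 [g gF pg]]].
  by split=> //; exists g.
by split; [apply/eqP | apply/existsP; exists g; rewrite gF].
Qed.

Lemma cov_pairs g : g \in H -> #|[set p : {set T} | (p \subset g) && (#|p| == 2%N)]| = 'C(d.+2, 2).
Proof. by move=> gH; rewrite cards_draws Hcard. Qed.

Lemma cov1 g : g \in H -> #|cov [set g]| = 'C(d.+2, 2).
Proof.
move=> gH; rewrite -(cov_pairs gH); apply: eq_card => p; rewrite [RHS]inE; apply/covP/andP.
  by case=> -> [g']; rewrite inE => /eqP ->.
by case=> pg /eqP p2; split=> //; exists g; rewrite ?inE.
Qed.

(** As [phi] ends at 2 and no part of [F] lies below, each edge added meets the earlier ones in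
    exactly two vertices and repeats at most one covered pair. *)
Lemma card_cov F : F \in comps -> ph F = 2 ->
  (#|F| * 'C(d.+2, 2) <= #|cov F| + #|F|.-1)%N.
Proof.
move=> FP pF; case/set0Pn: (comp_neq0 FP) => e eF.
have eH := subsetP (comp_sub FP) e eF.
suff h m : (m < #|F|)%N -> exists A, [/\ A \subset F, #|A| = m.+1, ph A <= 2 &
    (m.+1 * 'C(d.+2, 2) <= #|cov A| + m)%N].
  have F0 : (0 < #|F|)%N by apply/card_gt0P; exists e.
  have [A [AF Ac _ le]] := h #|F|.-1 ltac:(by rewrite prednK).
  have AE : A = F by apply/eqP; rewrite eqEcard AF Ac prednK /=.
  by move: le; rewrite AE prednK.
elim: m => [_|m IH mF].
  by exists [set e]; rewrite sub1set cards1 ph1 // cov1 // mul1n addn0.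
have [A [AF Ac pA le]] := IH (ltnW mF).
have A0 : A != set0 by rewrite -card_gt0 Ac.
have AnF : A != F by apply: contraTneq mF => <-; rewrite Ac ltnn.
have [g [gF gA [a aA ga]]] := comp_grow FP AF A0 AnF.
have gH := subsetP (comp_sub FP) g gF.
have gAF : g |: A \subset F by rewrite subUset sub1set gF.
have gA2 : (#|g :&: spn A| <= 2)%N.
  have := comp_ph FP gAF; rewrite -card_gt0 cardsU1 gA pF => /(_ isT).
  by move: (ph_add gH gA) pA; clear; lia.
exists (g |: A); split=> //; first by rewrite cardsU1 gA Ac.
  apply: le_trans pA; apply: ph_attach => //; apply: leq_trans ga _; apply: subset_leq_card.
  by apply: setIS; apply: sub_spn.
have sub : cov A :|: [set p : {set T} | (p \subset g) && (#|p| == 2%N)] \subset cov (g |: A).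
  apply/subsetP => p; rewrite in_setU => /orP[/covP[p2 [h hA ph']]|].
    by apply/covP; split=> //; exists h; rewrite // !inE hA orbT.
  by rewrite inE => /andP[pg /eqP p2]; apply/covP; split=> //; exists g; rewrite // !inE eqxx.
have one : (#|cov A :&: [set p : {set T} | (p \subset g) && (#|p| == 2%N)]| <= 1)%N.
  apply: leq_trans (_ : 'C(#|g :&: spn A|, 2) <= 1)%N; last first.
    by case: (#|_|) gA2 => [|[|[|]]].
  rewrite -cards_draws; apply: subset_leq_card; apply/subsetP => p.
  rewrite in_setI => /andP[/covP[p2 [h hA ph']]]; rewrite !inE subsetI => /andP[-> ->].
  rewrite andbT /=; apply: subset_trans ph' _; exact: sub_spn.
have := subset_leq_card sub; rewrite cardsU cov_pairs //.
by move: one le; rewrite [in X in _ -> _ -> _ -> X]mulSn; clear; lia.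
Qed.

(** If no such pair of edges exists, the default makes [cross F] empty; membership in [cross F] thus
    certifies that the two edges are genuine. *)
Definition pick2 F : {set T} * {set T} :=
  odflt (set0, set0) [pick x : {set T} * {set T} |
    [&& x.1 \in F, x.2 \in F, x.1 != x.2 & (2 <= #|x.1 :&: x.2|)%N]].

Notation e1 F := (pick2 F).1.
Notation e2 F := (pick2 F).2.

Definition duo F : {set {set T}} := [set e1 F; e2 F].

Definition cross F : {set {set T}} :=
  [set [set x.1; x.2] | x in setX (e1 F :\: e2 F) (e2 F :\: e1 F)].

Lemma crossP F p : reflect
  (exists x y, [/\ x \in e1 F :\: e2 F, y \in e2 F :\: e1 F & p = [set x; y]]) (p \in cross F).
Proof.
apply: (iffP imsetP) => [[[x y]]|[x [y [xe ye ->]]]].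
  by rewrite in_setX /= => /andP[? ?] ->; exists x, y.
by exists (x, y) => //; rewrite in_setX xe.
Qed.

Lemma cross_pick F p : p \in cross F ->
  [/\ e1 F \in F, e2 F \in F, e1 F != e2 F & (2 <= #|e1 F :&: e2 F|)%N].
Proof.
case/crossP => x [y [xe _ _]]; move: xe; rewrite /pick2.
by case: pickP => [[e f] /and4P[] //|_] /=; rewrite !inE.
Qed.

Lemma pick2P F : F \in comps -> (2 <= #|F|)%N ->
  [/\ e1 F \in F, e2 F \in F, e1 F != e2 F & (2 <= #|e1 F :&: e2 F|)%N].
Proof.
move=> FP F2; rewrite /pick2; case: pickP => [[e f] /and4P[] //|no].
case/set0Pn: (comp_neq0 FP) => e eF.
have e0 : [set e] != set0 by apply/set0Pn; exists e; rewrite inE.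
have eF' : [set e] != F by apply: contraTneq F2 => <-; rewrite cards1.
have eF1 : [set e] \subset F by rewrite sub1set.
have [g [gF ge [a]]] := comp_grow FP eF1 e0 eF'.
rewrite inE => /eqP -> ga; move: ge; rewrite inE => ge.
by have := no (g, e); rewrite /= gF eF ge ga.
Qed.

Lemma duo_ph F : F \in comps -> e1 F \in F -> e2 F \in F -> e1 F != e2 F ->
  (2 <= #|e1 F :&: e2 F|)%N -> ph (duo F) <= 2.
Proof.
move=> FP h1 h2 h12 h; have e2H := subsetP (comp_sub FP) _ h2.
rewrite -(ph1 e2H); apply: ph_attach; first exact: subsetP (comp_sub FP) _ h1.
by rewrite /spn big_set1.
Qed.

Section Cross.

Variables (F : {set {set T}}) (p : {set T}).
Hypothesis FP : F \in comps.
Hypothesis pF : p \in cross F.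

Lemma cross_duo : [/\ duo F \subset F, #|duo F| = 2%N & ph (duo F) <= 2].
Proof.
have [h1 h2 h12 h] := cross_pick pF; split.
- by rewrite subUset !sub1set h1.
- by rewrite cards2 h12.
- exact: duo_ph.
Qed.

Lemma cross_card2 : #|p| = 2%N.
Proof.
case/crossP: pF => x [y [/setDP[xe xf] /setDP[yf ye] ->]]; rewrite cards2.
by case: eqP => // xy; rewrite xy yf in xf.
Qed.

Lemma cross_span : p \subset spn (duo F).
Proof.
case/crossP: pF => x [y [/setDP[xe _] /setDP[yf _] ->]].
rewrite subUset !sub1set; apply/andP; split; apply/bigcupP.
  by exists (e1 F) => //; rewrite set21.
by exists (e2 F) => //; rewrite set22.
Qed.

Lemma cross_nsub g : g \in duo F -> ~~ (p \subset g).
Proof.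
case/crossP: pF => x [y [/setDP[xe xf] /setDP[yf ye] ->]].
by case/set2P => ->; rewrite subUset !sub1set ?(negPf xf) ?(negPf ye) ?andbF.
Qed.

(** An edge of [F] containing [p], when attached, would meet the earlier ones in its two tight
    vertices and in another vertex of [p], forcing [phi F <= 1]. *)
Lemma cross_uncov g : ph F = 2 -> g \in F -> ~~ (p \subset g).
Proof.
move=> pF2; have [dF d2' pd] := cross_duo.
suff h m : (m.+2 <= #|F|)%N -> exists A, [/\ duo F \subset A, A \subset F, #|A| = m.+2, ph A <= 2 &
    forall g, g \in A -> ~~ (p \subset g)].
  have F2 : (2 <= #|F|)%N by rewrite -d2' subset_leq_card.
  have [A [_ AF Ac _ hA]] := h #|F|.-2 ltac:(by case: #|F| F2 => [|[|]]).
  have <- : A = F; last exact: hA.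
  by apply/eqP; rewrite eqEcard AF Ac; case: #|F| F2 => [|[|k]] //= _; rewrite leqnn.
elim: m => [_|m IH mF]; first by exists (duo F); split=> // x; apply: cross_nsub.
have [A [dA AF Ac pA hA]] := IH (ltnW mF).
have A0 : A != set0 by rewrite -card_gt0 Ac.
have AnF : A != F by apply: contraTneq mF => <-; rewrite Ac ltnn.
have [x [xF xA [a aA xa]]] := comp_grow FP AF A0 AnF.
have xH := subsetP (comp_sub FP) x xF.
have xAF : x |: A \subset F by rewrite subUset sub1set xF.
have aS : x :&: a \subset x :&: spn A by apply: setIS; apply: sub_spn.
exists (x |: A); split=> //.
- exact: subset_trans dA (subsetUr _ _).
- by rewrite cardsU1 xA Ac.
- apply: le_trans pA; apply: ph_attach => //; apply: leq_trans xa _; exact: subset_leq_card.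
move=> y; rewrite in_setU1 => /orP[/eqP ->|]; last exact: hA.
apply/negP => px; have xa3 : (3 <= #|x :&: spn A|)%N.
  have pS : p \subset x :&: spn A.
    by rewrite subsetI px (subset_trans cross_span) // spanS.
  apply: leq_trans (_ : #|x :&: a :|: p| <= _)%N; last by rewrite subset_leq_card // subUset aS.
  apply: leq_ltn_trans xa _; apply: proper_card; rewrite properUl //.
  by apply: contra (hA a aA) => /subset_trans; apply; rewrite subsetIr.
have := comp_ph FP xAF; rewrite -card_gt0 cardsU1 xA pF2 => /(_ isT).
by move: (ph_add xH xA) xa3 pA; clear; lia.
Qed.

(** An outside edge meets each of the two picked edges in at most one vertex, which determines both
    ends of the pair. *)
Lemma cross_edge q g : q \in cross F -> g \in H -> g \notin F -> p \subset g -> q \subset g -> p = q.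
Proof.
move=> qF gH gF pg qg; have [h1 h2 _ _] := cross_pick pF.
have /card_le1_eqP far1 := comp_far FP h1 gH gF.
have /card_le1_eqP far2 := comp_far FP h2 gH gF.
case/crossP: pF pg => x [y [/setDP[xe _] /setDP[yf _] ->]].
case/crossP: qF qg => u [w [/setDP[ue _] /setDP[wf _] ->]].
rewrite !subUset !sub1set => /andP[ug wg] /andP[xg yg].
by rewrite (far1 x u) ?inE ?xe ?xg ?ue ?ug // (far2 y w) ?inE ?yf ?yg ?wf ?wg.
Qed.

End Cross.

(** With [phi F = 2] the picked edges share exactly two vertices, so there are [d * d] cross pairs.
    This is where [r >= 4] yields four. *)
Lemma card_cross F : F \in comps -> (2 <= #|F|)%N -> ph F = 2 -> (4 <= #|cross F|)%N.
Proof.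
move=> FP F2 pF; have [h1 h2 h12 h] := pick2P FP F2.
have h1H := subsetP (comp_sub FP) _ h1; have h2H := subsetP (comp_sub FP) _ h2.
have I2 : #|e1 F :&: e2 F| = 2%N.
  apply/eqP; rewrite eqn_leq h andbT.
  have := @ph_add (e1 F) [set e2 F] h1H; rewrite inE => /(_ h12).
  have dF : duo F \subset F by rewrite subUset !sub1set h1.
  have := comp_ph FP dF; rewrite -card_gt0 cards2 pF => /(_ isT).
  by rewrite /duo ph1 // span1; clear; lia.
have c1 : #|e1 F :\: e2 F| = d by rewrite cardsD I2 Hcard // subn2.
have c2 : #|e2 F :\: e1 F| = d by rewrite cardsD setIC I2 Hcard // subn2.
rewrite /cross card_in_imset; first by rewrite cardsX c1 c2; apply: (@leq_mul 2 2).
move=> [x y] [x' y']; rewrite !in_setX /= => /andP[/setDP[xe xf] /setDP[yf ye]].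
move=> /andP[/setDP[xe' xf'] /setDP[yf' ye']] E.
have : x \in [set x'; y'] by rewrite -E set21.
have : y \in [set x'; y'] by rewrite -E set22.
case/set2P => Ey; first by rewrite -Ey yf in xf'.
by case/set2P => Ex; [rewrite Ex Ey | rewrite Ex yf' in xf].
Qed.

Definition cedge p : {set T} := odflt set0 [pick g | (g \in H) && (p \subset g)].

Lemma cedgeP p : p \in cov H -> cedge p \in H /\ p \subset cedge p.
Proof.
case/covP => _ [g gH pg]; rewrite /cedge; case: pickP => [x /andP[] //|no].
by have := no g; rewrite gH pg.
Qed.

(** If [phi F = 2], distinct covered cross pairs yield distinct edges, all outside [F]. Lost cross
    pairs can therefore be counted as edges attached to [F], subject to the bound of five. *)
Definition cedges F : {set {set T}} := [set cedge p | p in cross F :&: cov H].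

Lemma cedges_sub F : cedges F \subset H.
Proof. by apply/subsetP => g /imsetP[p /setIP[_ /cedgeP[gH _]] ->]. Qed.

Lemma cedges_disj F : F \in comps -> ph F = 2 -> F :&: cedges F = set0.
Proof.
move=> FP pF; apply/setP => g; rewrite !inE; apply/negP => /andP[gF /imsetP[p /setIP[pc /cedgeP[_ pg]] E]].
by have := cross_uncov FP pc pF gF; rewrite E pg.
Qed.

Lemma card_cedges F : F \in comps -> ph F = 2 -> #|cedges F| = #|cross F :&: cov H|.
Proof.
move=> FP pF; apply: card_in_imset => p q /setIP[pc pv] /setIP[qc qv] E.
have [gH pg] := cedgeP pv; have [_ qg] := cedgeP qv.
apply: (cross_edge FP pc qc gH) => //; last by rewrite E.
by apply/negP => gF; have := cross_uncov FP pc pF gF; rewrite pg.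
Qed.

Lemma cedges_attach F g : g \in cedges F -> (2 <= #|g :&: spn (duo F)|)%N.
Proof.
case/imsetP => p /setIP[pc /cedgeP[_ pg]] ->; rewrite -(cross_card2 pc).
by apply: subset_leq_card; rewrite subsetI pg cross_span.
Qed.

Lemma cedges_le F : F \in comps -> (2 <= #|F|)%N -> ph F = 2 -> (#|F| + #|cedges F| <= 5)%N.
Proof.
move=> FP F2 pF; have [h1 h2 h12 h] := pick2P FP F2.
apply: (six_attach (comp_sub FP) (cedges_sub F) (cedges_disj FP pF)); first by rewrite pF.
  move=> g /cedges_attach h'; apply: leq_trans h' _; apply: subset_leq_card; apply: setIS.
  by apply: spanS; rewrite subUset !sub1set h1.
exact: leq_trans (comp_le5 FP) _.
Qed.

Lemma share_join F G p : F \in comps -> G \in comps -> F != G -> p \in cross F -> p \in cross G ->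
  duo F :&: duo G = set0 /\ ph (duo F :|: duo G) <= 2.
Proof.
move=> FP GP FG pF pG; have [dF _ qF] := cross_duo FP pF; have [dG _ qG] := cross_duo GP pG.
have D0 : duo F :&: duo G = set0.
  by apply/eqP; rewrite -subset0 -(comp_disj FP GP FG) setISS.
by split=> //; move: (ph_join D0 (cross_card2 pF) (cross_span pF) (cross_span pG)) qF qG; clear; lia.
Qed.

Lemma share_le5 F G p : F \in comps -> G \in comps -> F != G -> p \in cross F -> p \in cross G ->
  (#|F| + #|G| <= 5)%N.
Proof.
move=> FP GP FG pF pG; rewrite leqNgt; apply/negP => big.
have [dF cF _] := cross_duo FP pF; have [dG cG _] := cross_duo GP pG.
have [D0 pD] := share_join FP GP FG pF pG; have FG0 := comp_disj FP GP FG.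
have F2 : (2 <= #|F|)%N by rewrite -cF subset_leq_card.
have G2 : (2 <= #|G|)%N by rewrite -cG subset_leq_card.
have ne (X : {set {set T}}) : #|X| = 2%N -> X != set0 by rewrite -card_gt0 => ->.
have dGF : duo G :&: F = set0 by apply/eqP; rewrite -subset0 -FG0 setIC setIS.
(* Both duos are grown to six edges in total; [F] stops at four so that the two edges of [duo G]
   still fit. *)
have [A [dA AF Am pA]] := @comp_extend F (duo F) (duo G) (minn #|F| 4) FP dF (ne _ cF) dGF ltac:(rewrite cF; move: F2; clear; lia).
have AG : A :&: G = set0 by apply/eqP; rewrite -subset0 -FG0 setSI.
have [B [dB BG Bm pB]] := @comp_extend G (duo G) A (6 - minn #|F| 4) GP dG (ne _ cG) AG ltac:(rewrite cG; move: F2 G2 big; clear; lia).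
apply: (@no6 (B :|: A)).
- by rewrite subUset (subset_trans BG (comp_sub GP)) (subset_trans AF (comp_sub FP)).
- rewrite cardsU (_ : B :&: A = set0) ?cards0 ?Am ?Bm; first by move: F2; clear; lia.
  by apply/eqP; rewrite -subset0 -AG setIC setIS.
- by apply: le_trans pB _; rewrite setUC; apply: le_trans pA _.
Qed.

(** Three duos glued along [p] and [q] would be six edges with [phi <= 2]. With [q = p], a pair has
    at most two claimants, so halves suffice. *)
Lemma share_uniq F G K p q : F \in comps -> G \in comps -> K \in comps ->
  F != G -> F != K -> G != K -> p \in cross F -> p \in cross G -> q \in cross F -> q \in cross K -> False.
Proof.
move=> FP GP KP FG FK GK pF pG qF qK.
have [dF cF _] := cross_duo FP pF; have [dG cG _] := cross_duo GP pG.
have [dK cK qK2] := cross_duo KP qK.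
have [D0 pD] := share_join FP GP FG pF pG.
have D1 : (duo F :|: duo G) :&: duo K = set0.
  rewrite setIUl; apply/eqP; rewrite setU_eq0 -!subset0.
  by rewrite -{1}(comp_disj FP KP FK) -(comp_disj GP KP GK) !setISS.
apply: (@no6 (duo F :|: duo G :|: duo K)).
- by rewrite 2!subUset (subset_trans dF (comp_sub FP)) (subset_trans dG (comp_sub GP)) (subset_trans dK (comp_sub KP)).
- by rewrite cardsU D1 cards0 cardsU D0 cards0 cF cG cK.
have sp : q \subset spn (duo F :|: duo G).
  by apply: subset_trans (cross_span qF) _; apply: spanS; apply: subsetUl.
by move: (ph_join D1 (cross_card2 qF) sp (cross_span qK)) pD qK2; clear; lia.
Qed.

Definition shared F p : bool := [exists G, [&& G \in comps, G != F & p \in cross G]].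

(* Twice the share of the pair [p] owned by the component [F]. *)
Definition weight F p : nat :=
  (2 * (p \in cov F) + (if p \in cross F :\: cov H then (if shared F p then 1 else 2) else 0))%N.

(** The count in [weight_lower] relies on [phi F = 2] and, for three edges sharing a pair with a
    two-edge component [G], on [phi (F :|: G) >= 2]. *)
Definition exceptional F : bool :=
  ((2 <= #|F|)%N && (ph F <= 1)) ||
  ((#|F| == 3) && [exists G, [&& G \in comps, #|G| == 2, G != F & ph (F :|: G) <= 1]]).

Lemma cov_card2 F p : p \in cov F -> #|p| = 2%N.
Proof. by case/covP. Qed.

Lemma weight0 F p : #|p| != 2%N -> weight F p = 0%N.
Proof.
move=> p2; rewrite /weight; case: (boolP (p \in cov F)) => [/cov_card2 p2'|_].
  by rewrite p2' eqxx in p2.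
by rewrite in_setD; case: (boolP (p \in cross F)) => [/cross_card2 p2'|_]; rewrite ?andbF //;
  rewrite p2' eqxx in p2.
Qed.

Lemma cov_uniq F G p : F \in comps -> G \in comps -> p \in cov F -> p \in cov G -> F = G.
Proof.
move=> FP GP /covP[p2 [f fF pf]] /covP[_ [g gG pg]].
apply: (comp_uniq FP GP (e := g)) => //; apply: (comp_tight FP fF).
rewrite /tight (subsetP (comp_sub FP)) // (subsetP (comp_sub GP)) //= -p2.
by apply: subset_leq_card; rewrite subsetI pf.
Qed.

Lemma covH F p : F \in comps -> p \in cov F -> p \in cov H.
Proof.
move=> FP /covP[p2 [g gF pg]]; apply/covP; split=> //; exists g => //.
exact: subsetP (comp_sub FP) _ gF.
Qed.

Lemma weight_upper p : (\sum_(F in comps) weight F p <= 2)%N.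
Proof.
case: (boolP (p \in cov H)) => pH.
  have W F : weight F p = (2 * (p \in cov F))%N by rewrite /weight in_setD pH addn0.
  rewrite (eq_bigr _ (fun F _ => W F)).
  case: (boolP [exists F in comps, p \in cov F]) => [/existsP[F /andP[FP pF]]|].
    rewrite (bigD1 F) //= pF big1 // => G /andP[GP GF]; case: (boolP (p \in cov G)) => // pG.
    by rewrite (cov_uniq GP FP pG pF) eqxx in GF.
  rewrite negb_exists => /forallP no; rewrite big1 // => F FP.
  by have := no F; rewrite FP /= => /negPf ->.
have W F : F \in comps -> weight F p = (if p \in cross F then (if shared F p then 1 else 2) else 0)%N.
  move=> FP; rewrite /weight in_setD pH /=; case: (boolP (p \in cov F)) => // /(covH FP).
  by rewrite (negPf pH).
rewrite (eq_bigr _ W); case: (boolP [exists F in comps, p \in cross F]) => [/existsP[F /andP[FP pF]]|]; last first.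
  rewrite negb_exists => /forallP no; rewrite big1 // => F FP.
  by have := no F; rewrite FP /= => /negPf ->.
rewrite (bigD1 F) //= pF; case: (boolP (shared F p)) => [/existsP[G /and3P[GP GF pG]]|]; last first.
  rewrite negb_exists => /forallP no; rewrite big1 ?addn0 // => G /andP[GP GF].
  by have := no G; rewrite GP GF /= => /negPf ->.
rewrite (bigD1 G) ?GP //= pG.
have -> : shared G p by apply/existsP; exists F; rewrite FP pF eq_sym GF.
rewrite big1 // => K /andP[/andP[KP KF] KG]; case: (boolP (p \in cross K)) => // pK.
by exfalso; apply: (share_uniq FP GP KP _ _ _ pF pG pF pK); rewrite 1?eq_sym.
Qed.

(** The points are [x], [u2] outside [f] and [y], [w] in [f]. Of the first two only [u2] lies in
    [f']; of the last two only [w] lies in [e']. *)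
Lemma four_points e f e' f' x y q1 q2 u w u2 w2 (S S' : {set T}) :
  x \in e :\: f -> y \in f :\: e -> x \in e' :\: f' -> y \in f' :\: e' ->
  u \in e :\: f -> w \in f :\: e -> q1 = [set u; w] -> q1 \subset e' ->
  u2 \in e :\: f -> w2 \in f :\: e -> q2 = [set u2; w2] -> q2 \subset f' ->
  (#|e' :&: e| <= 1)%N -> (#|f' :&: f| <= 1)%N ->
  e \subset S -> f \subset S -> e' \subset S' -> f' \subset S' -> (4 <= #|S :&: S'|)%N.
Proof.
move=> /setDP[xe xf] /setDP[yf ye] /setDP[xe' xf'] /setDP[yf' ye'].
move=> /setDP[ue uf] /setDP[wf we] ->; rewrite subUset !sub1set => /andP[ue' we'].
move=> /setDP[u2e u2f] /setDP[w2f w2e] ->; rewrite subUset !sub1set => /andP[u2f' w2f'] _ _.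
move=> /subsetP eS /subsetP fS /subsetP eS' /subsetP fS'.
have cA : #|[set x; u2]| = 2%N by rewrite cards2; case: eqP => // E; rewrite E u2f' in xf'.
have cB : #|[set y; w]| = 2%N by rewrite cards2; case: eqP => // E; rewrite E we' in ye'.
have D0 : [set x; u2] :&: [set y; w] = set0.
  apply/setP => z; rewrite !inE; apply/negP => /andP[/orP[]/eqP-> /orP[]/eqP E].
  - by rewrite E yf in xf.
  - by rewrite E wf in xf.
  - by rewrite E yf in u2f.
  - by rewrite E wf in u2f.
have <- : #|[set x; u2] :|: [set y; w]| = 4%N by rewrite cardsU D0 cards0 cA cB.
apply: subset_leq_card; rewrite subsetI !subUset !sub1set.
by rewrite (eS x) // (eS u2) // (fS y) // (fS w) // (eS' x) // (fS' u2) // (fS' y) // (eS' w).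
Qed.

Hypothesis H6 : (6 <= #|H|)%N.

(** Given three covering edges, at most one avoids the two duos, so both edges of [duo G] cover
    cross pairs of [F]. The spans then share four vertices and the two duos have [phi <= 0]. A
    covering edge attaches for free, and any sixth edge completes a configuration. *)
Lemma share_cedges F G p : F \in comps -> G \in comps -> F != G -> p \in cross F -> p \in cross G ->
  ph F = 2 -> #|F| = 2%N -> (#|cedges F| <= 2)%N.
Proof.
move=> FP GP FG pF pG pF2 F2; rewrite leqNgt; apply/negP => c3.
have [dF cF qF] := cross_duo FP pF; have [dG cG qG] := cross_duo GP pG.
have FE : duo F = F by apply/eqP; rewrite eqEcard dF F2 cF.
have [D0 pD] := share_join FP GP FG pF pG; set A := duo F :|: duo G in pD.
have cA : #|A| = 4%N by rewrite cardsU D0 cards0 cF cG.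
have AH : A \subset H by rewrite subUset (subset_trans dF (comp_sub FP)) (subset_trans dG (comp_sub GP)).
have out1 : (#|cedges F :\: A| <= 1)%N.
  have := @six_attach A (cedges F :\: A) AH; rewrite cA => h.
  suff : (4 + #|cedges F :\: A| <= 5)%N by [].
  apply: h => //.
  - by apply: subset_trans (subsetDl _ _) (cedges_sub F).
  - by apply/setP => x; rewrite in_setI in_setD in_set0; case: (x \in A).
  move=> g /setDP[gc _]; apply: leq_trans (cedges_attach gc) _; apply: subset_leq_card.
  by apply: setIS; apply: spanS; apply: subsetUl.
have CF0 := cedges_disj FP pF2.
have inG : cedges F :&: A = cedges F :&: duo G.
  by rewrite setIUr FE setIC CF0 set0U.
have cin : (2 <= #|cedges F :&: duo G|)%N.
  by move: (cardsID A (cedges F)) out1 c3; rewrite inG; clear; lia.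
have GC : duo G \subset cedges F.
  apply/setIidPr/eqP; rewrite eqEcard subsetIr cG //.
have [g gc gA] : exists2 g, g \in cedges F & g \notin A.
  have : (0 < #|cedges F :\: A|)%N.
    move: (cardsID A (cedges F)) (subset_leq_card (subsetIr (cedges F) (duo G))) c3; rewrite inG cG.
    by clear; lia.
  by case/card_gt0P => g /setDP[gc gA]; exists g.
have e1C : e1 G \in cedges F by rewrite (subsetP GC) ?set21.
have e2C : e2 G \in cedges F by rewrite (subsetP GC) ?set22.
have [h1 h2 h12 h] := cross_pick pF; have [k1 k2 k12 k] := cross_pick pG.
have GF x : x \in G -> x \notin F.
  move=> xG; apply/negP => xF; have := comp_uniq FP GP xF xG => E; by rewrite E eqxx in FG.
have k1H := subsetP (comp_sub GP) _ k1; have k2H := subsetP (comp_sub GP) _ k2.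
have far1 := comp_far FP h1 k1H (GF _ k1); have far2 := comp_far FP h2 k1H (GF _ k1).
have far3 := comp_far FP h1 k2H (GF _ k2); have far4 := comp_far FP h2 k2H (GF _ k2).
have I4 : (4 <= #|spn (duo F) :&: spn (duo G)|)%N.
  case/imsetP: e1C => q1 /setIP[q1c /cedgeP[_ q1g]] E1; rewrite -E1 in q1g.
  case/imsetP: e2C => q2 /setIP[q2c /cedgeP[_ q2g]] E2; rewrite -E2 in q2g.
  case/crossP: q1c => u [w [ue wf q1E]]; case/crossP: q2c => u2 [w2 [u2e w2f q2E]].
  have s1 : e1 F \subset spn (duo F) by apply: sub_spn; rewrite set21.
  have s2 : e2 F \subset spn (duo F) by apply: sub_spn; rewrite set22.
  have s3 : e1 G \subset spn (duo G) by apply: sub_spn; rewrite set21.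
  have s4 : e2 G \subset spn (duo G) by apply: sub_spn; rewrite set22.
  case/crossP: pF => x [y [xe yf pE]]; case/crossP: pG => x' [y' [xe' yf' pE']].
  have xy : x != y by apply: contraTneq xe => ->; rewrite inE; case/setDP: yf => ->.
  have : x \in [set x'; y'] by rewrite -pE' pE set21.
  have : y \in [set x'; y'] by rewrite -pE' pE set22.
  case/set2P => Ey; case/set2P => Ex; try by rewrite Ex Ey eqxx in xy.
    rewrite -Ex in yf'; rewrite -Ey in xe'.
    exact: (four_points xe yf yf' xe' u2e w2f q2E q2g ue wf q1E q1g far3 far2 s1 s2 s4 s3).
  rewrite -Ex in xe'; rewrite -Ey in yf'.
  exact: (four_points xe yf xe' yf' ue wf q1E q1g u2e w2f q2E q2g far1 far4 s1 s2 s3 s4).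
have pA0 : ph A <= 0 by move: (ph_meet D0 I4) qF qG; rewrite -/A; clear; lia.
have gH := subsetP (cedges_sub F) g gc.
have pgA : ph (g |: A) <= 0.
  apply: le_trans pA0; apply: ph_attach => //; apply: leq_trans (cedges_attach gc) _.
  by apply: subset_leq_card; apply: setIS; apply: spanS; apply: subsetUl.
have c5 : #|g |: A| = 5%N by rewrite cardsU1 gA cA.
have [x xH xA] : exists2 x, x \in H & x \notin g |: A.
  apply/subsetPn; apply/negP => /subset_leq_card; rewrite c5; move: H6; clear; lia.
apply: (@no6 (x |: (g |: A))).
- by rewrite 2!subUset !sub1set xH gH.
- by rewrite cardsU1 xA c5.
- have := ph_add xH xA; move: pgA.
  by move: (ph (g |: A)) (ph (x |: _)) #|x :&: _| => a b c; clear; lia.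
Qed.

(** Let [F] have [m >= 2] edges. Its covered pairs fall short by at most [m - 1]. Of at least four
    cross pairs at most [5 - m] are covered, so [m - 1] are free, enough if none is shared. If one
    is shared, [m] is 2 or 3, and at least two, respectively four, free pairs at half value make up
    for it. *)
Lemma weight_lower F : F \in comps -> ~~ exceptional F ->
  (2 * (#|F| * 'C(d.+2, 2)) <= \sum_p weight F p)%N.
Proof.
move=> FP; rewrite negb_or => /andP[ex1 ex2].
have sumW : (\sum_p weight F p = 2 * #|cov F| +
    \sum_(p in cross F :\: cov H) (if shared F p then 1 else 2))%N.
  rewrite big_split /= -big_mkcond /= -big_distrr /=; congr (2 * _ + _)%N.
  by rewrite -sum1_card [RHS]big_mkcond; apply: eq_bigr => p _; case: (p \in cov F).
rewrite sumW; case: (ltnP 1 #|F|) => F2; last first.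
  have /cards1P[g FE] : #|F| == 1%N by rewrite eqn_leq F2 card_gt0 comp_neq0.
  have gH : g \in H by apply: subsetP (comp_sub FP) _ _; rewrite FE inE.
  by rewrite FE cards1 mul1n cov1 // leq_addr.
have pF : ph F = 2.
  by move: ex1 (comp_ph2 FP); rewrite F2 /=; clear; lia.
have cF := card_cross FP F2 pF; have cc := cedges_le FP F2 pF.
have cE := card_cedges FP pF; have cID := cardsID (cov H) (cross F).
have cv := card_cov FP pF.
case: (boolP [exists p in cross F :\: cov H, shared F p]) => [/existsP[p /andP[]]|no]; last first.
  rewrite (eq_bigr (fun=> 2%N)); last first.
    move=> p pc; case: ifP => // sp; case/negP: no; apply/existsP; exists p; by rewrite pc.
  rewrite sum_nat_const; move: cF cc cE cID cv F2; clear.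
  by move: #|cross F| #|cedges F| #|_ :&: _| #|_ :\: _| #|cov F| (#|F| * 'C(d.+2, 2))%N #|F| => a b c e f g h; lia.
case/setDP => pc pH /existsP[G /and3P[GP GF pG]].
have FG : F != G by rewrite eq_sym.
have le5 := share_le5 FP GP FG pc pG.
have G2 : (2 <= #|G|)%N.
  by have [dG cG _] := cross_duo GP pG; rewrite -cG subset_leq_card.
have s1 : (#|cross F :\: cov H| <= \sum_(p in cross F :\: cov H) (if shared F p then 1 else 2))%N.
  by rewrite -sum1_card; apply: leq_sum => q _; case: ifP.
case: (ltnP 2 #|F|) => F3; last first.
  have c2 := share_cedges FP GP FG pc pG pF ltac:(by apply/eqP; rewrite eqn_leq F3).
  move: cF cc cE cID cv F2 F3 s1 c2; clear.
  by move: #|cross F| #|cedges F| #|_ :&: _| #|_ :\: _| #|cov F| (#|F| * 'C(d.+2, 2))%N #|F| (\sum_(_ in _) _)%N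
     => a b c e f g h i; lia.
have F3' : #|F| = 3%N by move: le5 G2 F3; clear; lia.
have G2' : #|G| = 2%N by move: le5 G2 F3; clear; lia.
have pFG : 2 <= ph (F :|: G).
  move: ex2; rewrite F3' eqxx /= negb_exists => /forallP/(_ G); rewrite GP G2' eqxx GF /=.
  by move: (ph _); clear; lia.
have FG0 := comp_disj FP GP FG.
have sF : spn (duo F) \subset spn F by apply: spanS; have [] := cross_duo FP pc.
have sG : spn (duo G) \subset spn G by apply: spanS; have [] := cross_duo GP pG.
have pSF : p \subset spn F := subset_trans (cross_span pc) sF.
have pSG : p \subset spn G := subset_trans (cross_span pG) sG.
(* [F] and [G] have five edges together. A covering edge is either a sixth attached edge, or lies in
   [G]; then the spans share a third vertex and [F] is exceptional. *)
have c0 : cedges F = set0.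
  apply/eqP; rewrite -subset0; apply/subsetP => g gc; exfalso.
  have gH := subsetP (cedges_sub F) g gc.
  have pFGle : ph (F :|: G) <= 2.
    by have := ph_join FG0 (cross_card2 pc) pSF pSG; have := comp_ph2 GP; rewrite pF; clear; lia.
  case: (boolP (g \in G)) => gG.
    case/imsetP: gc => q /setIP[qc /[dup] qH /cedgeP[_ qg]] E; rewrite -E in qg.
    have I3 : (3 <= #|spn F :&: spn G|)%N.
      apply: leq_trans (_ : #|p :|: q| <= _)%N; last first.
        apply: subset_leq_card; rewrite subUset !subsetI pSF pSG (subset_trans (cross_span qc) sF) /=.
        by apply: subset_trans qg _; apply: sub_spn.
      rewrite -(cross_card2 pc); apply: proper_card; rewrite properUl //.
      apply/negP => qp; have E2 : q = p by apply/eqP; rewrite eqEcard qp (cross_card2 pc) (cross_card2 qc).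
      by rewrite -E2 qH in pH.
    have := ph_meet FG0 I3; have := comp_ph2 GP; rewrite pF.
    by move: pFG; clear; lia.
  have gF : g \notin F.
    by apply/negP => gF; have /setP/(_ g) := cedges_disj FP pF; rewrite !inE gF gc.
  have h := @six_attach (F :|: G) [set g].
  have : (#|F :|: G| + #|[set g]| <= 5)%N.
    apply: h => //.
    - by rewrite subUset !comp_sub.
    - by rewrite sub1set.
    - by apply/setP => x; rewrite !inE; apply/negP => /andP[h /eqP E]; move: h; rewrite E (negPf gF) (negPf gG).
    - move=> x; rewrite inE => /eqP ->; apply: leq_trans (cedges_attach gc) _.
      apply: subset_leq_card; apply: setIS; apply: subset_trans sF _; apply: spanS; exact: subsetUl.
    - by rewrite cardsU FG0 cards0 F3' G2'.
  by rewrite cardsU FG0 cards0 F3' G2' cards1.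
have cE0 : #|cedges F| = 0%N by rewrite c0 cards0.
move: cF cc cE cID cv F3' s1 cE0; clear.
by move: #|cross F| #|cedges F| #|_ :&: _| #|_ :\: _| #|cov F| (#|F| * 'C(d.+2, 2))%N #|F| (\sum_(_ in _) _)%N
     => a b c e f g h i; lia.
Qed.

(** * Counting exceptional components *)

Lemma comp_other F G g : F \in comps -> G \in comps -> F != G -> g \in G -> g \notin F.
Proof.
move=> FP GP FG gG; apply/negP => gF.
by have E := comp_uniq FP GP gF gG; rewrite E eqxx in FG.
Qed.

Lemma touch_ph A g x : g \in H -> g \notin A -> x \in g -> x \in spn A -> ph A <= 1 ->
  ph (g |: A) <= 2.
Proof.
move=> gH gA xg xA pA; have : (0 < #|g :&: spn A|)%N.
  by apply/card_gt0P; exists x; rewrite inE xg.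
by move: (ph_add gH gA) pA; clear; lia.
Qed.

Definition exc_far : {set {set {set T}}} :=
  [set F in comps | exceptional F & (4 <= #|F|)%N || ((#|F| == 3) && (2 <= ph F))].

Definition exc3 : {set {set {set T}}} := [set F in comps | (#|F| == 3) && (ph F <= 1)].

Definition exc2 : {set {set {set T}}} := [set F in comps | (#|F| == 2) && (ph F <= 1)].

Lemma exc_cover F : F \in comps -> exceptional F -> F \in exc_far :|: exc3 :|: exc2.
Proof.
move=> FP ex; rewrite !inE FP ex /=; move: ex; rewrite /exceptional.
case: (ltnP #|F| 3) => F3.
  case/orP => [/andP[F2 ->]|/andP[/eqP E _]]; last by rewrite E in F3.
  have -> : #|F| = 2%N by move: F2 F3; clear; lia.
  by rewrite orbT.
case: (eqVneq #|F| 3) => [->|n3] /=; last first.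
  by rewrite (_ : (3 < #|F|)%N) // ltn_neqAle eq_sym n3.
move=> _; case: (lerP (ph F) 1) => p1; rewrite ?orbT //.
by rewrite (_ : 2 <= ph F) //; move: p1; clear; lia.
Qed.

(** [F], or [F] with its partner [G], has [phi <= 1], so a touching edge of [F'] leaves [phi <= 2].
    This reaches six edges, with a second edge of [F'] if [F] has four. The size of [F'] keeps it
    apart from [G]. *)
Lemma exc_far_disj F F' : F \in exc_far -> F' \in comps -> (3 <= #|F'|)%N -> F != F' ->
  spn F :&: spn F' = set0.
Proof.
rewrite inE => /and3P[FP ex sz] FP' F3 FF'.
case: (set_0Vmem (spn F :&: spn F')) => // -[x /setIP[xF /bigcupP[h hF' xh]]]; exfalso.
have hH := subsetP (comp_sub FP') h hF'.
have hF := comp_other FP FP' FF' hF'.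
have FH := comp_sub FP.
case: (boolP (ph F <= 1)) => pF1.
  have p2 := touch_ph hH hF xh xF pF1.
  have F4 : (4 <= #|F|)%N by move: sz pF1; move: (ph F) #|F|; clear; lia.
  have h0 : [set h] != set0 by apply/set0Pn; exists h; rewrite inE.
  have hFs : [set h] \subset F' by rewrite sub1set.
  have hn : [set h] != F' by apply: contraTneq F3 => <-; rewrite cards1.
  have [g [gF' gh [a]]] := comp_grow FP' hFs h0 hn; rewrite inE => /eqP -> ga.
  rewrite inE in gh; have gH := subsetP (comp_sub FP') g gF'.
  have gF := comp_other FP FP' FF' gF'.
  case: (leqP #|F| 4) => F5.
    apply: (@no6 (g |: (h |: F))).
    - by rewrite 2!subUset !sub1set gH hH.
    - by rewrite !cardsU1 hF in_setU1 negb_or gh gF (_ : #|F| = 4%N) //; move: F4 F5; clear; lia.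
    - apply: le_trans p2; apply: ph_attach => //; apply: leq_trans ga _; apply: subset_leq_card.
      by apply: setIS; apply: sub_spn; rewrite !inE eqxx.
  apply: (@no6 (h |: F)) => //; first by rewrite subUset sub1set hH.
  by rewrite cardsU1 hF; move: F5 (comp_le5 FP); clear; lia.
move: ex; rewrite /exceptional (negPf pF1) andbF /= => /andP[/eqP Fc /existsP[G /and4P[GP /eqP Gc GF pFG]]].
have hG : h \notin G.
  by apply: comp_other GP FP' _ hF'; apply: contraTneq F3 => <-; rewrite Gc.
have FG0 : F :&: G = set0 by apply: comp_disj => //; rewrite eq_sym.
have hFG : h \notin F :|: G by rewrite in_setU negb_or hF.
apply: (@no6 (h |: (F :|: G))).
- by rewrite 2!subUset sub1set hH FH comp_sub.
- by rewrite cardsU1 hFG cardsU FG0 cards0 Fc Gc.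
- by apply: (touch_ph (x := x)) => //; rewrite spanU inE xF.
Qed.

(** Each span is represented by one of its points; the extra 1 comes from counting in [option T]. *)
Lemma card_disj (Q : {set {set {set T}}}) : Q \subset comps ->
  {in Q &, forall F F', F != F' -> spn F :&: spn F' = set0} -> (#|Q| <= #|T|.+1)%N.
Proof.
move=> QP dis; pose f F := [pick x in spn F].
have finj : {in Q &, injective f}.
  move=> F F' FQ FQ' E; apply/eqP; apply: contraT => /(dis _ _ FQ FQ') D.
  case/set0Pn: (comp_neq0 (subsetP QP F FQ)) => e eF.
  have /card_gt0P[x xe] : (0 < #|e|)%N by rewrite Hcard // (subsetP (comp_sub (subsetP QP F FQ))).
  move: E; rewrite /f; case: pickP => [y yF|/(_ x)]; last by rewrite (mem_span (v := fun e => e) eF xe).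
  by case: pickP => // z zF [yz]; have /setP/(_ y) := D; rewrite !inE yF yz zF.
rewrite -(card_in_imset finj) -card_option; exact: max_card.
Qed.

Lemma card_exc3 : (#|exc3| <= 1)%N.
Proof.
apply/card_le1_eqP => F F'; rewrite !inE => /and3P[FP /eqP F3 pF] /and3P[FP' /eqP F3' pF'].
apply/eqP; apply: contraT; rewrite eq_sym => FF'; exfalso; have D := comp_disj FP FP' FF'.
apply: (@no6 (F :|: F')); first by rewrite subUset !comp_sub.
  by rewrite cardsU D cards0 F3 F3'.
by move: (ph_meet D (leq0n _)) pF pF'; clear; lia.
Qed.

(** If two members touch, their union has [phi <= 1] and a third member would complete six edges;
    otherwise all spans are disjoint. *)
Lemma card_exc2 : (#|exc2| <= #|T| + 3)%N.
Proof.
have sP : exc2 \subset comps by apply/subsetP => F; rewrite inE => /andP[].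
case: (boolP [forall F in exc2, forall F' in exc2, (F != F') ==> (spn F :&: spn F' == set0)]).
  move=> /forallP h; apply: leq_trans (card_disj sP _) _; last by rewrite addnS ltnS leq_addr.
  move=> F F' FQ FQ' FF'; have /implyP/(_ FQ)/forallP/(_ F')/implyP/(_ FQ')/implyP/(_ FF') := h F.
  by move/eqP.
rewrite negb_forall => /existsP[F]; rewrite negb_imply => /andP[FQ].
rewrite negb_forall => /existsP[F']; rewrite !negb_imply => /and3P[FQ' FF' touch].
apply: leq_trans (_ : #|[set F; F']| <= _)%N; last by rewrite cards2 FF' addnC.
apply: subset_leq_card; apply/subsetP => K KQ; rewrite !inE.
apply: contraT; rewrite negb_or => /andP[KF KF']; exfalso.
move: FQ FQ' KQ; rewrite !inE => /and3P[FP /eqP F2 pF] /and3P[FP' /eqP F2' pF'] /and3P[KP /eqP K2 pK].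
have D := comp_disj FP FP' FF'.
have t1 : (1 <= #|spn F :&: spn F'|)%N by rewrite card_gt0.
have D' : (F :|: F') :&: K = set0.
  by rewrite setIUl (comp_disj FP KP) 1?eq_sym // (comp_disj FP' KP) 1?eq_sym // setU0.
apply: (@no6 (F :|: F' :|: K)); first by rewrite !subUset !comp_sub.
  by rewrite cardsU D' cards0 cardsU D cards0 F2 F2' K2.
by move: (ph_meet D t1) (ph_meet D' (leq0n _)) pF pF' pK; clear; lia.
Qed.

Lemma card_exc : (#|[set F in comps | exceptional F]| <= 2 * #|T| + 5)%N.
Proof.
have sub : [set F in comps | exceptional F] \subset exc_far :|: exc3 :|: exc2.
  by apply/subsetP => F; rewrite inE => /andP[FP ex]; apply: exc_cover.
apply: leq_trans (subset_leq_card sub) _.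
have hf : (#|exc_far| <= #|T|.+1)%N.
  apply: card_disj; first by apply/subsetP => F; rewrite inE => /and3P[].
  move=> F F' FQ; rewrite [F' \in _]inE => /and3P[FP' _ sz] FF'.
  apply: exc_far_disj => //; by move: sz; move: #|F'| (2 <= _); clear; lia.
move: hf card_exc3 card_exc2 (leq_card_setU (exc_far :|: exc3) exc2).1 (leq_card_setU exc_far exc3).1.
by clear; lia.
Qed.

Lemma upper_bound : (#|H| * 'C(d.+2, 2) <= 'C(#|T|, 2) + 5 * (2 * #|T| + 5) * 'C(d.+2, 2))%N.
Proof.
pose K := 'C(d.+2, 2).
have Hsum : #|H| = (\sum_(F in comps) #|F|)%N by exact: card_partition comps_partition.
have split2 : (#|H| <= \sum_(F in comps | ~~ exceptional F) #|F| + 5 * (2 * #|T| + 5))%N.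
  rewrite Hsum (bigID exceptional) /= addnC leq_add2l.
  apply: leq_trans (_ : \sum_(F in [set F in comps | exceptional F]) 5 <= _)%N; last first.
    by rewrite sum_nat_const mulnC leq_mul2l /= card_exc.
  rewrite [X in (_ <= X)%N](eq_bigl (fun F => (F \in comps) && exceptional F)); last by move=> F; rewrite inE.
  by apply: leq_sum => F /andP[FP _]; apply: comp_le5.
have good_sum : (2 * (\sum_(F in comps | ~~ exceptional F) #|F| * K) <= 2 * 'C(#|T|, 2))%N.
  apply: leq_trans (_ : \sum_(F in comps) \sum_p weight F p <= _)%N.
    rewrite big_distrr /= [X in (_ <= X)%N](bigID exceptional) /=.
    apply: leq_trans (leq_addl _ _); apply: leq_sum => F /andP[FP ex]; exact: weight_lower.
  rewrite exchange_big /= (bigID (fun p : {set T} => #|p| == 2%N)) /=.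
  rewrite [X in (_ + X)%N]big1 ?addn0; last first.
    by move=> p p2; rewrite big1 // => F _; apply: weight0.
  apply: leq_trans (leq_sum _ (fun p _ => weight_upper p)) _.
  rewrite sum_nat_const mulnC leq_mul2l /= -card_draws; apply: eq_leq.
  by apply: eq_card => p; rewrite !inE.
move: split2 good_sum; rewrite -big_distrl /= -/K.
move: (\sum_(_ in _ | _) _)%N (5 * _)%N => x y; clear => h1 h2.
have h3 : (x * K <= 'C(#|T|, 2))%N by rewrite leq_mul2l /= in h2.
by apply: leq_trans (leq_mul h1 (leqnn K)) _; rewrite mulnDl leq_add2r.
Qed.

End Upper.

(** * The extremal function *)

Section Extremal.

Variables (d n : nat).

Notation fex := (f_ex d.+2 n (6 * d.+2 - 10) 6).

Lemma fex_upper : (2 <= d)%N ->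
  (fex * 'C(d.+2, 2) <= 'C(n, 2) + 5 * (2 * n + 5) * 'C(d.+2, 2))%N.
Proof.
move=> d2; have K0 : (0 < 'C(d.+2, 2))%N by rewrite bin_gt0.
rewrite /f_ex; elim/big_ind: _ => //.
  by move=> x y hx hy; rewrite maxnMl geq_max hx hy.
(* [share_cedges] needs a sixth edge in [H]; smaller graphs are absorbed by the linear term. *)
move=> H /andP[/forallP uH fH]; case: (ltnP #|H| 6) => H6.
  apply: leq_trans (leq_addl _ _); rewrite leq_mul2r; apply/orP; right.
  by move: H6; clear; lia.
rewrite -{1}[n in X in (_ <= X)%N]card_ord -{1}[n in (2 * n)%N]card_ord.
apply: upper_bound => //.
  by move=> e eH; have := uH e; rewrite eH /= => /eqP.
move=> F FH F6; move: fH; rewrite /sk_free /has_config negb_exists => /forallP/(_ F).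
rewrite FH F6 eqxx /= -ltnNge /phi /span F6 => h.
by move: h; move: #|_| => m; move: d2; clear; lia.
Qed.

Lemma fex_lower (H : {set rsets n d}) : clean (@rval n d) d H -> (#|H| <= fex)%N.
Proof.
move=> cl; rewrite -(card_imset _ val_inj) /f_ex.
apply: (@leq_bigmax_cond _ _ (fun X : {set {set 'I_n}} => #|X|)); apply/andP; split.
  apply/forallP => e; apply/implyP => /imsetP[x _ ->]; exact: valP x.
rewrite /sk_free /has_config negb_exists; apply/forallP => F; apply/negP => /and3P[FH /eqP F6 small].
pose S := [set e in H | val e \in F].
have FS : F = [set val e | e in S].
  apply/setP => x; apply/idP/imsetP => [xF|[e]]; last by rewrite inE => /andP[_ ?] ->.
  have /imsetP[e eH xE] := subsetP FH x xF; exists e => //; by rewrite inE eH -xE.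
have S6 : #|S| = 6%N by rewrite -F6 FS card_imset //; apply: val_inj.
have SH : S \subset H by apply/subsetP => e; rewrite inE => /andP[].
have spS : span (@rval n d) S = \bigcup_(e in F) e.
  by rewrite FS big_imset //= => x y _ _; apply: val_inj.
move/forallP/(_ S)/implyP/(_ SH)/negP: cl; apply; rewrite /bad S6 /= /phi spS S6.
by move: small; move: #|_| => m; clear; lia.
Qed.

End Extremal.

(** * Passage to the limit *)

Section Limit.

Variable R : archiRealFieldType.

Lemma bernoulli_inv (x : R) t : 0 <= x <= 1 -> (1 - x) ^+ t * (1 + t%:R * x) <= 1.
Proof.
move=> /andP[x0 x1]; elim: t => [|t IH]; first by rewrite expr0 mul0r addr0 mul1r.
apply: le_trans IH; rewrite exprSr -mulrA ler_wpM2l ?exprn_ge0 ?subr_ge0 //.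
rewrite -natr1; have t0 : 0 <= t%:R :> R by rewrite ler0n.
by have := mulr_ge0 t0 (sqr_ge0 x); have := sqr_ge0 x; lra.
Qed.

Lemma fex_lim_upper (d : nat) (eps : R) : (2 <= d)%N -> 0 < eps ->
  exists N : nat, forall n, (N <= n)%N ->
   (f_ex d.+2 n (6 * d.+2 - 10) 6)%:R < ((d.+2 * d.+1)%N%:R^-1 + eps) * n%:R ^+ 2 :> R.
Proof.
(* The 35 comes from [5 * (2 * n + 5) <= 35 * n] for positive [n]. *)
move=> d2 eps0; pose N := (Num.bound (35 / eps)).+1.
exists N => n Nn; have n0 : (0 < n)%N by apply: leq_trans Nn.
have nR : 1 <= n%:R :> R by rewrite ler1n.
have big : 35 < eps * n%:R.
  rewrite mulrC -ltr_pdivrMr //; apply: lt_le_trans (archi_boundP _) _.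
    by rewrite divr_ge0 // ltW.
  by rewrite ler_nat; apply: leq_trans Nn.
have K0 : 0 < (d.+2 * d.+1)%N%:R :> R by rewrite ltr0n.
have := fex_upper n d2; set f := f_ex _ _ _ _ => h.
have h2 : (f * (d.+2 * d.+1) <= n * n + 35 * n * (d.+2 * d.+1))%N.
  have bin2 m : (2 * 'C(m, 2) = m * m.-1)%N by have := bin_ffact m 2; rewrite ffactnS ffactn1 => <-; exact: mulnC.
  have e1 : (d.+2 * d.+1 = 2 * 'C(d.+2, 2))%N by rewrite bin2.
  have e2 : (2 * 'C(n, 2) <= n * n)%N by rewrite bin2 leq_mul // leq_pred.
  have e3 := leq_pmull 'C(d.+2, 2) n0.
  by rewrite e1; move: h e2 e3; move: (f) ('C(d.+2, 2)) ('C(n, 2)); clear; lia.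
have h3 : f%:R * (d.+2 * d.+1)%N%:R <= n%:R ^+ 2 + 35 * n%:R * (d.+2 * d.+1)%N%:R :> R.
  by move: h2; rewrite -(ler_nat R) !(natrD, natrM).
rewrite -(ltr_pM2r K0); apply: le_lt_trans h3 _.
move: K0; set K : R := (_ * _)%:R; clearbody K => K0.
have -> : (K^-1 + eps) * n%:R ^+ 2 * K = n%:R ^+ 2 + eps * n%:R * n%:R * K.
  by field; rewrite gt_eqF.
by rewrite ltrD2l ltr_pM2r // ltr_pM2r // (lt_le_trans ltr01).
Qed.

Lemma error_budget (c eps x y s Z N : R) :
    0 < N -> 0 < eps -> 0 <= c -> c <= 1 -> 0 <= x -> x <= 1 -> 0 <= s ->
    x * c <= eps / 4 -> y <= eps / 4 -> 4 * (s + Z) < eps * N ->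
  (c - eps) * N ^+ 2 < (1 - x) * ((N ^+ 2 - s * N) * c) - y * N ^+ 2 - Z * N.
Proof.
move=> N0 eps0 c0 c1 x0 x1 s0 xc yle big.
have cs : (1 - x) * c * s <= s.
  by rewrite ler_piMl // mulr_ile1 ?subr_ge0 // gerBl.
have xcN := ler_wpM2r (ltW N0) xc; have yN := ler_wpM2r (ltW N0) yle.
suff h : (c - eps) * N < c * N - x * c * N - (1 - x) * c * s - y * N - Z.
  by move: h; rewrite -(ltr_pM2r N0) => /lt_le_trans; rewrite expr2 mulrA; apply; rewrite le_eqVlt; apply/orP; left; apply/eqP; ring.
by move: cs xcN yN big; have := mulr_gt0 eps0 N0; lra.
Qed.

Lemma fex_lim_lower (d : nat) (eps : R) : (2 <= d)%N -> 0 < eps ->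
  exists N : nat, forall n, (N <= n)%N ->
   ((d.+2 * d.+1)%N%:R^-1 - eps) * n%:R ^+ 2 < (f_ex d.+2 n (6 * d.+2 - 10) 6)%:R :> R.
Proof.
move=> d2 eps0; set c := (d.+2 * d.+1)%N%:R^-1.
have K0 : 0 < (d.+2 * d.+1)%N%:R :> R by rewrite ltr0n.
have c0 : 0 < c by rewrite invr_gt0.
have c1 : c <= 1 by rewrite invf_le1 // ler1n muln_gt0.
pose B := Closs R d * Cinit R d 11 2 + Closs R d + 1.
have B0 : 0 <= B.
  have Ci : 0 <= Cinit R d 11 2.
    by apply: sumr_ge0 => j _; rewrite mulr_ge0 ?ler0n // exprn_ge0 ?ler0n.
  by rewrite /B addr_ge0 // addr_ge0 ?Closs_ge0 // mulr_ge0 ?Closs_ge0.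
pose M := (Num.bound (4 / eps)).+1.
have Mbig : 4 < eps * M%:R.
  rewrite mulrC -ltr_pdivrMr //; apply: lt_le_trans (archi_boundP _) _.
    by rewrite divr_ge0 // ltW.
  by rewrite ler_nat.
pose t := (2 * M + Num.bound (4 * M%:R ^+ 2 * B / eps))%N.
have tM : (2 * M <= t)%N by apply: leq_addr.
have t0 : 0 < t%:R :> R by rewrite ltr0n; apply: leq_trans tM.
have M0 : 0 < M%:R :> R by rewrite ltr0n.
have tbig : 4 * M%:R ^+ 2 * B <= eps * t%:R.
  rewrite [leRHS]mulrC -ler_pdivrMr //; apply: ltW.
  apply: lt_le_trans (archi_boundP _) _.
    by rewrite divr_ge0 ?(ltW eps0) // !mulr_ge0 ?exprn_ge0 // ltW.
  by rewrite ler_nat leq_addl.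
pose dl : R := M%:R / t%:R.
have tdl : t%:R * dl = M%:R by rewrite mulrC divfK // gt_eqF.
have dl01 : 0 < dl <= 2^-1.
  rewrite divr_gt0 //= ler_pdivrMr // mulrC ler_pdivlMr // -natrM ler_nat mulnC //.
have [dl0 dl1] := andP dl01.
have dlle1 : dl <= 1 by apply: le_trans dl1 _; rewrite invf_le1 // ler1n.
have p0 : 0 <= (1 - dl) ^+ t by rewrite exprn_ge0 // subr_ge0.
have small1 : (1 - dl) ^+ t * c <= eps / 4.
  have dl01' : 0 <= dl <= 1 by rewrite ltW.
  have := bernoulli_inv t dl01'; rewrite tdl => bern.
  have : (1 - dl) ^+ t <= eps / 4.
    rewrite -(ler_pM2r M0); apply: le_trans (_ : 1 <= _).
      by apply: le_trans bern; rewrite ler_wpM2l // lerDr.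
    by rewrite mulrAC ler_pdivlMr // mul1r ltW.
  by move/(ler_pM p0 (ltW c0))/(_ c1); rewrite mulr1.
have small2 : t%:R * dl ^+ 2 * B <= eps / 4.
  rewrite expr2 mulrA tdl /dl; have -> : M%:R * (M%:R / t%:R) * B = (4 * M%:R ^+ 2 * B) / t%:R / 4.
    by field; rewrite gt_eqF.
  by rewrite ler_pM2r ?invr_gt0 // ler_pdivrMr.
pose Z := Zpot d (dl ^+ 2) dl t * (Cinit R d 23 1 + d`!%:R * (Cinit R d 11 2 + 1)).
have Z0 : 0 <= Z.
  have Ci m k : 0 <= Cinit R d m k.
    by apply: sumr_ge0 => j _; rewrite mulr_ge0 ?ler0n // exprn_ge0 ?ler0n.
  rewrite /Z mulr_ge0 ?Zpot_ge0 ?(ltW dl0) ?exprn_gt0 //.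
  by rewrite addr_ge0 // mulr_ge0 ?ler0n // addr_ge0.
pose Y := (d.+2 ^ 2)%N%:R + Z.
have Y0 : 0 <= Y by rewrite addr_ge0 ?ler0n.
(* The second summand keeps single weights at most 1 through all [t] doublings. *)
exists ((Num.bound (4 * Y / eps)).+1 + 2 ^ t * d`!)%N => n Nn.
have n0 : (0 < n)%N by apply: leq_trans Nn; rewrite addSn.
have nR : 0 < n%:R :> R by rewrite ltr0n.
have nbig : 4 * Y < eps * n%:R.
  rewrite mulrC [X in _ < X]mulrC -ltr_pdivrMr // [Y * _]mulrC.
  apply: lt_le_trans (archi_boundP _) _; first by rewrite divr_ge0 ?mulr_ge0 // ltW.
  by rewrite ler_nat; apply: leq_trans Nn; rewrite addSn -addnS leq_addr.
have om : 2 ^+ t * om0 R n d <= 1.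
  apply: le_trans (_ : 2 ^+ t * (d`!%:R / n%:R) <= _).
    by rewrite ler_wpM2l ?exprn_ge0 // om0_le // (leq_trans _ d2).
  rewrite mulrA ler_pdivrMr // mul1r -natrX -natrM ler_nat.
  by apply: leq_trans Nn; apply: leq_addl.
have [H cl] := lower_bound n0 (ltnW d2) dl01 om.
have := fex_lower cl; rewrite -(ler_nat R) => le1 le2.
apply: lt_le_trans (le_trans le2 le1).
rewrite -/c -/B -/Z.
by apply: error_budget; rewrite ?exprn_ile1 ?subr_ge0 ?gerBl ?(ltW c0) ?ler0n // ltW.
Qed.

End Limit.

Lemma fex_lim (R : archiRealFieldType) (d : nat) (eps : R) : (2 <= d)%N -> 0 < eps ->
  exists N : nat, forall n, (N <= n)%N ->
   `|(f_ex d.+2 n (6 * d.+2 - 10) 6)%:R / n%:R ^+ 2 - (d.+2 * d.+1)%N%:R^-1| < eps :> R.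
Proof.
move=> d2 eps0.
have [N1 up] := fex_lim_upper d2 eps0; have [N2 low] := fex_lim_lower d2 eps0.
(* The successor makes [n] positive, so that dividing by [n ^ 2] is genuine. *)
exists (maxn N1 N2).+1 => n Nn.
have n0 : 0 < n%:R ^+ 2 :> R by rewrite exprn_gt0 // ltr0n; apply: leq_trans Nn.
have N1n : (N1 <= n)%N by apply: leq_trans (ltnW Nn); apply: leq_maxl.
have N2n : (N2 <= n)%N by apply: leq_trans (ltnW Nn); apply: leq_maxr.
rewrite ltr_distl ltr_pdivlMr // low //= ltr_pdivrMr //; exact: up.
Qed.

Lemma natr_sqrB (R : pzRingType) (d : nat) :
  d.+2%:R ^+ 2 - d.+2%:R = (d.+2 * d.+1)%N%:R :> R.
Proof. by rewrite expr2 -[X in _ - X]mulr1 -mulrBr -[d.+2 in X in _ * X]addn1 natrD addrK -natrM. Qed.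

Local Close Scope ring_scope.
Delimit Scope R_scope with R.

Theorem theorem1p4 (r : nat) : (4 <= r)%N ->
  Un_cv (fun n : nat => (INR (f_ex r n (6 * r - 10) 6) / (INR n ^ 2))%R)
        (1 / (INR r ^ 2 - INR r))%R.
Proof.
move=> r4; have [d rE] : exists d, r = d.+2 by exists r.-2; move: r4; clear; lia.
have d2 : (2 <= d)%N by move: r4; rewrite rE.
rewrite rE => eps /RltP eps0.
have [N HN] := fex_lim d2 eps0.
exists N => n /ssrnat.leP Nn; apply/RltP; move: (HN n Nn).
by rewrite /Rdist !RealsE natr_sqrB div1r.
Qed.
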